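(* Let $\mathcal{X}$ be a Polish space and let $\mathcal{H}\subseteq\{0,1\}^{\mathcal{X}}$ be a measurable concept class with $|\mathcal{H}|\ge 3$. Then exactly one of the following holds: (i) $\mathcal{H}$ is learnable with optimal rate $e^{-n}$; (ii) $\mathcal{H}$ is learnable with optimal rate $\frac{1}{n}$; (iii) $\mathcal{H}$ requires arbitrarily slow rates.
   Context: A concept class $\mathcal{H}\subseteq\{0,1\}^{\mathcal{X}}$ on a Polish space $\mathcal{X}$ is measurable if there exist a Polish space $\Theta$ and a Borel-measurable map $\mathsf{h}:\Theta\times\mathcal{X}\to\{0,1\}$ with $\mathcal{H}=\{\mathsf{h}(\theta,\cdot):\theta\in\Theta\}$. A classifier is a universally measurable function $h:\mathcal{X}\to\{0,1\}$. For a probability distribution $P$ on $\mathcal{X}\times\{0,1\}$, the error of a classifier is $\mathrm{er}_P(h)=P\{(x,y):h(x)\neq y\}$; $P$ is realizable (for $\mathcal{H}$) if $\inf_{h\in\mathcal{H}}\mathrm{er}_P(h)=0$. A learning algorithm is a sequence of universally measurable maps $H_n:(\mathcal{X}\times\{0,1\})^n\times\mathcal{X}\to\{0,1\}$, $n\in\mathbb{N}$; given i.i.d. samples $(X_1,Y_1),(X_2,Y_2),\ldots$ from $P$, its output is $\hat h_n(x)=H_n((X_1,Y_1),\ldots,(X_n,Y_n),x)$. A rate function is $R:\mathbb{N}\to[0,1]$ with $R(n)\to0$. $\mathcal{H}$ is learnable at rate $R$ if there is a learning algorithm such that for every realizable $P$ there exist $C,c>0$ with $\mathbf{E}[\mathrm{er}_P(\hat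 h_n)]\le CR(cn)$ for all $n$. $\mathcal{H}$ is not learnable at rate faster than $R$ if for every learning algorithm there exist a realizable $P$ and $C,c>0$ with $\mathbf{E}[\mathrm{er}_P(\hat h_n)]\ge CR(cn)$ for infinitely many $n$. $\mathcal{H}$ is learnable with optimal rate $R$ if both hold. $\mathcal{H}$ requires arbitrarily slow rates if for every rate function $R$, $\mathcal{H}$ is not learnable at rate faster than $R$. *)

(* Defs.v *)
From HB Require Import structures.
From mathcomp Require Import all_boot all_order all_algebra.
From mathcomp Require Import all_classical all_reals all_analysis.
Set Implicit Arguments.
Unset Strict Implicit.
Unset Printing Implicit Defensive.
Import Order.TTheory GRing.Theory Num.Theory.
Import numFieldNormedType.Exports.
Local Open Scope classical_set_scope.
Local Open Scope ring_scope.

Definition polish (R : realType) (X : topologicalType) : Prop :=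
  (exists D : set X, countable D /\ closure D = setT) /\
  exists d : X -> X -> R,
    (forall x y, 0 <= d x y) /\
    (forall x y, d x y = 0 <-> x = y) /\
    (forall x y, d x y = d y x) /\
    (forall x y z, d x z <= d x y + d y z) /\
        (forall A : set X, open A <->
            (forall x, A x -> exists2 e : R, 0 < e & [set y | d x y < e] `<=` A)) /\
    (forall u : nat -> X,
           (forall e : R, 0 < e -> exists N, forall m n,
               (N <= m)%N -> (N <= n)%N -> d (u m) (u n) < e) ->
           exists x, forall e : R, 0 < e -> exists N, forall n,
               (N <= n)%N -> d (u n) x < e).

Definition borel (X : ptopologicalType) := g_sigma_algebraType (@open X).

Section univ.
Context (R : realType) {d : measure_display} (T : measurableType d).

Definition univ_measurable_set (A : set T) : Prop :=
  forall P : probability T R, exists B : set T,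
    measurable B /\ negligible P ((A `\` B) `|` (B `\` A)).

Definition univ_measurable_fun {d' : measure_display} {U : measurableType d'}
  (f : T -> U) : Prop :=
  forall B : set U, measurable B -> univ_measurable_set (f @^-1` B).
End univ.

Section learning.
Context (R : realType) (X : ptopologicalType).

Local Notation XY := (borel X * bool)%type.

Definition measurable_concept_class (H : set (X -> bool)) : Prop :=
  exists (Theta : ptopologicalType) (h : Theta * X -> bool),
    polish R Theta /\
    measurable_fun setT (h : (borel Theta * borel X)%type -> bool) /\
    H = [set (fun x => h (theta, x)) | theta in [set: Theta]].

(* the value of P on the (universally measurable) set {(x,y) | h x <> y};
   computed as the outer measure, which coincides with the completed measure
   on universally measurable sets *)
Definition outer (P : probability XY R) (A : set XY) : \bar R :=
  ereal_inf [set P B | B in [set B : set XY | measurable B /\ A `<=` B]].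

Definition er (P : probability XY R) (h : X -> bool) : \bar R :=
  outer P [set z : XY | h z.1 != z.2].

Definition realizable (H : set (X -> bool)) (P : probability XY R) : Prop :=
  ereal_inf [set er P h | h in H] = 0%E.

Definition learning_algorithm
  (A : forall n : nat, (n.-tuple XY * borel X)%type -> bool) : Prop :=
  forall n, univ_measurable_fun R (A n).

(* expectation of f(Z_1,...,Z_n) for Z_1,...,Z_n i.i.d. with law P,
   as an iterated integral *)
Fixpoint iexp (P : probability XY R) (n : nat) :
    (n.-tuple XY -> \bar R) -> \bar R :=
  match n return (n.-tuple XY -> \bar R) -> \bar R with
  | 0 => fun f => f [tuple]
  | n'.+1 => fun f => (\int[P]_z iexp P (fun t : n'.-tuple XY => f (cons_tuple z t)))%E
  end.

Definition exp_error (A : forall n : nat, (n.-tuple XY * borel X)%type -> bool)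
  (P : probability XY R) (n : nat) : \bar R :=
  iexp P (fun s : n.-tuple XY => er P (fun x => A n (s, x))).

Definition rate_function (rate : nat -> R) : Prop :=
  (forall n, 0 <= rate n <= 1) /\ rate @ \oo --> 0.

Definition rate_at (rate : nat -> R) (c : R) (n : nat) : R :=
  rate `|Num.ceil (c * n%:R)|%N.

Definition learnable_at_rate (H : set (X -> bool)) (rate : nat -> R) : Prop :=
  exists A, learning_algorithm A /\
    forall P : probability XY R, realizable H P ->
      exists C c : R, 0 < C /\ 0 < c /\
        forall n : nat, (0 < n)%N -> (exp_error A P n <= (C * rate_at rate c n)%:E)%E.

Definition not_learnable_faster (H : set (X -> bool)) (rate : nat -> R) : Prop :=
  forall A, learning_algorithm A ->
    exists P : probability XY R, realizable H P /\
      exists C c : R, 0 < C /\ 0 < c /\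
        forall N, exists n : nat, (N < n)%N /\
          ((C * rate_at rate c n)%:E <= exp_error A P n)%E.

Definition optimal_rate (H : set (X -> bool)) (rate : nat -> R) : Prop :=
  learnable_at_rate H rate /\ not_learnable_faster H rate.

Definition arbitrarily_slow (H : set (X -> bool)) : Prop :=
  forall rate, rate_function rate -> not_learnable_faster H rate.

End learning.

Definition exp_rate (R : realType) (n : nat) : R := expR (- n%:R).
Definition inv_rate (R : realType) (n : nat) : R := n%:R^-1.

(* Main.v *)
(** Write a tree of type [k] for an infinite tree whose nodes at depth [t] consist
of [k t] points, such that every finite branch is realized by [H]: Littlestone trees have
[k = 1], VCL trees have [k t = t + 1].

If there is no tree of type [k], then a learner wins the game in which it is shown
[k t] points at round [t] and must exclude one labeling of them. The positions won with a
certificate bounded by a well-founded code are complements of Souslin sets, hence universally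
measurable, and a position that no code refutes would produce a tree. Following the
winning strategy on i.i.d. examples, each time an excluded labeling occurs the play moves to a
smaller code, so almost surely this eventually stops: some patterns of size [k t] are then
avoided by the distribution, and the one-inclusion graph predictor for the avoiding labelings
errs with probability at most [2 (k t - 1) / (m + 1)]. The right number of rounds is found by
validation, and a majority vote over independent blocks makes the failure of this search
exponentially unlikely; this gives the rate [e^-n] for [k = 1] and [1/n] for [k t = t + 1].

Conversely, a distribution supported on a branch of a tree, with a mass
decreasing quickly in the depth, hides the labels of a whole level from a sample of the right
size: the mass of a level must decrease geometrically when its node is a single point, but can
be prescribed at will when the number of points grows. Finally, two concepts that agree at one
point and differ at another already force [e^-n]. *)
Require Import Defs.
From HB Require Import structures.
From mathcomp Require Import all_boot all_order all_algebra.
From mathcomp Require Import all_classical all_reals all_analysis.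
From mathcomp Require Import measurable_realfun.
From mathcomp Require Import perm zify ring lra.
Set Implicit Arguments.
Unset Strict Implicit.
Unset Printing Implicit Defensive.
Import Order.TTheory GRing.Theory Num.Theory.
Import numFieldNormedType.Exports.

(** * One-inclusion graphs *)

(** Two measurability obstacles shape the proof. The usual rank of a position is a countable
    ordinal, and its use rests on boundedness theorems for coanalytic sets. Codes replace these by
    one observation: finite approximations to a tree are countable in number, so the codes that rule
    them out one by one combine by [Inter] into a single code. Secondly, the learner is only
    universally measurable, while [exp_error] integrates against [P] itself. The integral of a
    nonnegative function, being a supremum over simple functions below it, is monotone without any
    measurability: upper bounds pass to integrals against the completion [hat P], where Fubini
    holds, and lower bounds come from finitely many atoms below [P]. The number of rounds that
    suffices and the least probability of a pattern still worth detecting depend on [P]. The learner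
    knows neither; they enter only the constants of the rate. *)

Section families.
Variable I : finType.
Implicit Types (A B S : {set I}) (V W : {set {set I}}) (r : seq I).

Definition flip (i : I) A := if i \in A then A :\ i else i |: A.

Lemma in_flip i j A : (j \in flip i A) = (j \in A) (+) (j == i).
Proof.
rewrite /flip; case: ifP => iA; rewrite !inE; have [->|ji] := eqVneq j i;
  by rewrite ?iA ?addbF.
Qed.

Definition shatters V S := forall B, B \subset S -> exists2 A, A \in V & A :&: S = B.

Definition deg V A := #|[set i | flip i A \in V]|.

(** Each edge with direction in [r] is counted from both ends, which is the origin of the factors 2
    below. *)
Definition deg_in r V := \sum_(A in V) \sum_(i <- r) (flip i A \in V).

(** Holds edge by edge: an edge of one family is an edge of the union, and an edge of both is also
    one of the intersection. The two halves of a family can thus be traded for their union and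
    intersection, whose shattered sets are better controlled. *)
Lemma deg_in_supermodular r V W : deg_in r V + deg_in r W <=
  deg_in r (V :|: W) + deg_in r (V :&: W).
Proof.
have dE U : deg_in r U = \sum_A \sum_(i <- r) ((A \in U) && (flip i A \in U)).
  rewrite /deg_in big_mkcond; apply: eq_bigr => A _; case: ifP => // _.
  by rewrite big1.
rewrite !dE -!big_split; apply: leq_sum => A _; rewrite -!big_split.
apply: leq_sum => i _; rewrite !inE.
by case: (A \in V); case: (A \in W); case: (flip i A \in V); case: (flip i A \in W).
Qed.

(* Haussler's bound on the number of edges of the one-inclusion graph, by induction on the coordinates. *)
Lemma deg_in_le r D V : uniq r ->
  (forall S, S \subset r -> #|S| = D.+1 -> ~ shatters V S) ->
  deg_in r V <= 2 * D * #|V|.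
Proof.
elim: r D V => [|x r IH] D V.
  by move=> _ _; rewrite /deg_in big1// => A _; rewrite big_nil.
move=> /= /andP[xr ur] nsh.
pose V0 := [set A in V | x \notin A].
pose V1 := [set A : {set I} | (x \notin A) && (x |: A \in V)].
have split_sum (F : {set I} -> nat) : \sum_(A in V) F A =
    \sum_(A in V0) F A + \sum_(A in V1) F (x |: A).
  rewrite (bigID (fun A => x \notin A))/=; congr (_ + _).
    by apply: eq_bigl => A; rewrite inE.
  rewrite (reindex_onto (fun A => x |: A) (fun A => A :\ x)) /=; last first.
    by move=> A /andP[_]; rewrite negbK => xA; rewrite finset.setD1K.
  apply: eq_bigl => A; rewrite !inE eqxx/= andbT.
  have [xA|xA] := boolP (x \in A).
    rewrite /= (_ : _ == _ = false) ?andbF//; apply/negbTE/eqP => E.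
    by have := xA; rewrite -E !inE eqxx.
  by rewrite setU1K// eqxx andbT.
have cV : #|V| = #|V0| + #|V1|.
  by rewrite -!sum1_card; exact: split_sum.
have flip0 A i : x \notin A -> i \in r -> (flip i A \in V) = (flip i A \in V0).
  move=> xA ir; rewrite inE in_flip (negbTE xA)/=.
  by case: eqP xr => [->|_ _]; rewrite ?ir ?andbT.
have flip1 A i : x \notin A -> i \in r -> (flip i (x |: A) \in V) = (flip i A \in V1).
  move=> xA ir; have xi : x != i by apply: contraNneq xr => ->.
  rewrite inE in_flip (negbTE xA) (negbTE xi)/=; congr (_ \in V).
  apply/setP => j; rewrite in_flip !inE in_flip.
  by have [->|] := eqVneq j x; rewrite ?(negbTE xi).
have c01 : #|V0 :&: V1| = \sum_(A in V0) (A \in V1).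
  rewrite -sum1_card big_mkcond [RHS]big_mkcond; apply: eq_bigr => A _.
  by rewrite inE; case: (A \in V0); case: (A \in V1).
have c10 : #|V0 :&: V1| = \sum_(A in V1) (A \in V0).
  rewrite -sum1_card big_mkcond [RHS]big_mkcond; apply: eq_bigr => A _.
  by rewrite inE; case: (A \in V0); case: (A \in V1).
(* An edge in direction [x] joins some [A] in [V0] to [x |: A], so there is one for each member of
   [V0 :&: V1], seen from both ends. *)
have sE : deg_in (x :: r) V = 2 * #|V0 :&: V1| + (deg_in r V0 + deg_in r V1).
  rewrite /deg_in split_sum.
  have -> : \sum_(A in V0) \sum_(i <- x :: r) (flip i A \in V) =
      #|V0 :&: V1| + \sum_(A in V0) \sum_(i <- r) (flip i A \in V0).
    rewrite c01 -big_split; apply: eq_bigr => A.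
    rewrite inE => /andP[AV xA]; rewrite big_cons; congr (_ + _).
      by rewrite /flip (negbTE xA) inE xA.
    by apply: eq_big_seq => i ir; rewrite flip0.
  have -> : \sum_(A in V1) \sum_(i <- x :: r) (flip i (x |: A) \in V) =
      #|V0 :&: V1| + \sum_(A in V1) \sum_(i <- r) (flip i A \in V1).
    rewrite c10 -big_split; apply: eq_bigr => A.
    rewrite inE => /andP[xA AV]; rewrite big_cons; congr (_ + _).
      by rewrite /flip !inE eqxx/= setU1K// xA andbT.
    by apply: eq_big_seq => i ir; rewrite flip1.
  by rewrite mul2n -addnn addnACA.
have cUI : #|V0 :|: V1| + #|V0 :&: V1| = #|V| by rewrite cardsUI -cV.
have subr S : S \subset r -> S \subset x :: r.
  by move=> /fintype.subsetP Sr; apply/fintype.subsetP => i /Sr ir; rewrite inE ir orbT.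
have nx S : S \subset r -> x \notin S.
  by move=> /fintype.subsetP Sr; apply: contra xr => /Sr.
have IHU : deg_in r (V0 :|: V1) <= 2 * D * #|V0 :|: V1|.
  apply: IH => // S Sr cS sh; apply: (nsh S) => //; first exact: subr.
  move=> B BS; have [A] := sh B BS; rewrite !inE => /orP[/andP[AV _] AB|/andP[xA AV] AB].
    by exists A.
  exists (x |: A) => //; rewrite -AB; apply/setP => j; rewrite !inE.
  by have [->|] := eqVneq j x; rewrite ?(negbTE (nx S Sr)) ?andbF.
have shI S : S \subset r -> shatters (V0 :&: V1) S -> shatters V (x |: S).
  move=> Sr sh B BS; have [|A] := sh (B :\ x).
    by apply/fintype.subsetP => j; rewrite !inE => /andP[jx /(fintype.subsetP BS)]; rewrite !inE (negbTE jx).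
  rewrite !inE => /andP[/andP[AV xA] /andP[_ AV']] AS.
  have memB j : (j \in B) = if j == x then x \in B else (j \in A) && (j \in S).
    have := congr1 (fun C : {set I} => j \in C) AS; rewrite !inE.
    by have [->|] := eqVneq j x.
  case xB : (x \in B); [exists (x |: A)|exists A] => //; apply/setP => j; rewrite memB xB !inE.
    by have [->|] := eqVneq j x.
  by have [->|] := eqVneq j x; rewrite ?(negbTE xA).
(* [V0 :&: V1] shatters no subset of [r] of size [D], since adding [x] would give one of size [D.+1]
   for [V]; the saved dimension pays for the edges in direction [x]. For [D = 0] the intersection is
   empty, as one member would already shatter [[set x]]. *)
have IHI : 2 * #|V0 :&: V1| + deg_in r (V0 :&: V1) <= 2 * D * #|V0 :&: V1|.
  case: D nsh {IHU} => [|D] nsh.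
    have -> : V0 :&: V1 = finset.set0.
      apply/eqP; apply/negPn/negP => /set0Pn[A AI].
      apply: (nsh [set x]); rewrite ?cards1//.
        by apply/fintype.subsetP => j; rewrite !inE => ->.
      rewrite -[[set x]]finset.setU0; apply: shI; first by apply/fintype.subsetP => j; rewrite inE.
      by move=> B; rewrite finset.subset0 => /eqP ->; exists A; rewrite ?finset.setI0.
    by rewrite cards0 /deg_in big_set0.
  suff : deg_in r (V0 :&: V1) <= 2 * D * #|V0 :&: V1| by lia.
  apply: IH => // S Sr cS sh; apply: (nsh (x |: S)) (shI S Sr sh).
    apply/fintype.subsetP => j; rewrite !inE => /predU1P[->|/(fintype.subsetP Sr) ->]; first by rewrite eqxx.
    by rewrite orbT.
  by rewrite cardsU1 nx// cS.
rewrite sE -cUI mulnDr.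
by have := deg_in_supermodular r V0 V1; lia.
Qed.

(** The average degree is at most [2 * D]. A subfamily shatters no more than the family, so this
    applies to every layer of the peeling below. *)
Lemma low_degree D V : (forall S, #|S| = D.+1 -> ~ shatters V S) -> V != finset.set0 ->
  exists2 A, A \in V & deg V A <= 2 * D.
Proof.
move=> nsh V0; have H : deg_in (enum I) V <= 2 * D * #|V|.
  by apply: deg_in_le; [exact: enum_uniq|move=> S _; exact: nsh].
apply/exists_inP; apply: contraTT H => /exists_inPn H; rewrite -ltnNge.
have : \sum_(A in V) (2 * D).+1 <= deg_in (enum I) V.
  apply: leq_sum => A /H; rewrite -ltnNge => /leq_trans; apply.
  by rewrite /deg -sum1dep_card big_mkcond big_enum/=; apply: leq_sum => i _; case: ifP.
rewrite sum_nat_const; apply: leq_trans.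
rewrite mulnC ltn_pmul2l//; last by rewrite card_gt0.
Qed.

Section peeling.
Variable d : nat.

(* Peeling off the sets of degree at most [d] ranks the family; an edge of the one-inclusion graph is charged to its endpoint that is peeled first, so that no set is charged more than [d] times. *)
Definition core V := [set A in V | d < deg V A].
Definition layer V n := iter n core V.
Definition rk V A := find (fun n => A \notin layer V n) (iota 0 #|{set I}|.+1).
Definition err V A i := (flip i A \in V) && (rk V A <= rk V (flip i A)).

Lemma before_rk V A n : n < rk V A -> A \in layer V n.
Proof.
move=> nr; have := before_find 0 nr; rewrite nth_iota ?add0n => [/negbFE//|].
by apply: leq_trans nr _; rewrite -[leqRHS](size_iota 0); exact: find_size.
Qed.

(** A nonempty layer loses at least one set, so its size plus its index never exceeds the number of
    all sets. *)
Lemma layer_empty V : (forall W, W \subset V -> W != finset.set0 ->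
  exists2 A, A \in W & deg W A <= d) -> layer V #|{set I}| = finset.set0.
Proof.
move=> low.
have sub n : layer V n \subset V.
  elim: n => //= n; apply: fintype.subset_trans.
  by apply/fintype.subsetP => A; rewrite inE => /andP[].
have H n : layer V n == finset.set0 \/ #|layer V n| + n <= #|{set I}|.
  elim: n => [|n [/eqP E|IH]]; first by right; rewrite addn0 max_card.
    by left; rewrite /= E -finset.subset0; apply/fintype.subsetP => A; rewrite inE => /andP[].
  have [E|N0] := eqVneq (layer V n) finset.set0.
    by left; rewrite /= E -finset.subset0; apply/fintype.subsetP => A; rewrite inE => /andP[].
  right; have [A AW dA] := low _ (sub n) N0.
  suff : #|layer V n.+1| < #|layer V n| by lia.
  apply: proper_card; apply/properP; split.
    by apply/fintype.subsetP => B; rewrite inE => /andP[].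
  by exists A => //; rewrite /= inE negb_and -leqNgt dA orbT.
have [/eqP//|] := H #|{set I}|.
by rewrite -[X in _ <= X]add0n leq_add2r leqn0 cards_eq0 => /eqP.
Qed.

(** In the last layer that contains [A] its degree is at most [d], and every neighbour of no smaller
    rank is still present there. *)
Lemma card_err V A : (forall W, W \subset V -> W != finset.set0 ->
  exists2 A, A \in W & deg W A <= d) -> A \in V ->
  #|[set i | err V A i]| <= d.
Proof.
move=> low AV.
have hs : has (fun n => A \notin layer V n) (iota 0 #|{set I}|.+1).
  apply/hasP; exists #|{set I}|; first by rewrite mem_iota leq0n add0n ltnSn.
  by rewrite layer_empty// inE.
have rN : rk V A < #|{set I}|.+1.
  by rewrite -[leqRHS](size_iota 0) -has_find.
have := nth_find 0 hs; rewrite -/(rk V A) nth_iota// add0n.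
case E : (rk V A) => [|r]; first by rewrite AV.
have Ar : A \in layer V r by apply: before_rk; rewrite E.
rewrite /= inE Ar/= -leqNgt; apply: leq_trans; apply: subset_leq_card.
apply/fintype.subsetP => i; rewrite !inE => /andP[_]; rewrite E => ri.
exact: before_rk.
Qed.

(** The prediction at [j] reads [A] only off [j]: of the two completions in [V] it follows the one
    peeled last, so that an error is charged to the endpoint peeled first. Ties go to [false]. *)
Definition orient V j A :=
  let A0 := A :\ j in let A1 := j |: A in
  if A1 \in V then (if A0 \in V then rk V A0 < rk V A1 else true) else false.

Lemma orient_err V j A : A \in V -> orient V j A != (j \in A) -> err V A j.
Proof.
move=> AV; rewrite /orient /err /flip /=; have [jA|jA] := boolP (j \in A).
  have -> : j |: A = A by apply/finset.setUidPr; rewrite finset.sub1set.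
  rewrite AV; case: ifP => // _.
  by rewrite eqb_id -leqNgt.
rewrite (_ : A :\ j = A); last by apply/finset.setDidPl; rewrite disjoint_sym disjoints1.
rewrite AV; case: ifP => // _; rewrite eqbF_neg negbK; exact: ltnW.
Qed.

Lemma orient_setD1 V j A : orient V j (A :\ j) = orient V j A.
Proof.
have e1 : A :\ j :\ j = A :\ j by rewrite finset.setDDl finset.setUid.
have e2 : j |: (A :\ j) = j |: A by apply/setP => i; rewrite !inE; case: (i == j).
by rewrite /orient e1 e2.
Qed.

Section equivariance.
Variable p : {perm I}.
Definition act A : {set I} := [set i | p i \in A].

Lemma act_flip i A : act (flip (p i) A) = flip i (act A).
Proof. by apply/setP => j; rewrite inE !in_flip inE (inj_eq perm_inj). Qed.

Variables V V' : {set {set I}}.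
Hypothesis VV' : forall A, (act A \in V') = (A \in V).

(** Peeling commutes with a renaming of the points. Exchangeability of the sample will thereby turn
    the error at the last point into an average over all points. *)
Lemma rk_act A : rk V' (act A) = rk V A.
Proof.
have H n B : (act B \in layer V' n) = (B \in layer V n).
  elim: n B => [|n IH] B //=; rewrite !inE IH; congr (_ && (_ < _)).
  rewrite /deg -(card_imset _ (@perm_inj _ p)); apply: eq_card => i.
  rewrite [RHS]inE; apply/imsetP/idP => [[j + ->]|].
    by rewrite inE -act_flip IH.
  move=> iW; exists (perm_inv p i); last by rewrite permKV.
  by rewrite inE -act_flip permKV IH.
by apply: eq_find => n; rewrite H.
Qed.

Lemma err_act A i : err V' (act A) i = err V A (p i).
Proof. by rewrite /err -act_flip VV' !rk_act. Qed.

End equivariance.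
End peeling.
End families.

Local Open Scope classical_set_scope.
Local Open Scope ring_scope.

(** * Universally measurable sets *)

Section univ_sigma_algebra.
Context (R : realType) {d : measure_display} (T : measurableType d).
Implicit Types A B : set T.

Lemma univ_measurableP A : univ_measurable_set R A <->
  forall P : probability T R, exists B N : set T,
    [/\ measurable B, measurable N, P N = 0%E & forall x, ~ N x -> A x <-> B x].
Proof.
split=> [mA P|mA P].
  have [B [mB [N [mN N0 AN]]]] := mA P.
  exists B, N; split => // x Nx; split=> [Ax|Bx]; apply: contrapT => H.
    by apply: Nx; apply: AN; left.
  by apply: Nx; apply: AN; right.
have [B [N [mB mN N0 AB]]] := mA P.
exists B; split => //; exists N; split => // x.
by case=> -[Ax nBx]; apply: contrapT => Nx; apply: nBx; apply/AB.
Qed.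

Lemma measurable_univ A : measurable A -> univ_measurable_set R A.
Proof.
by move=> mA; apply/univ_measurableP => P; exists A, set0; split.
Qed.

Lemma univ_measurable0 : univ_measurable_set R (@set0 T).
Proof. exact: measurable_univ. Qed.

Lemma univ_measurableC A :
  univ_measurable_set R A -> univ_measurable_set R (~` A).
Proof.
move=> /univ_measurableP mA; apply/univ_measurableP => P.
have [B [N [mB mN N0 AB]]] := mA P.
exists (~` B), N; split => //; first exact: measurableC.
by move=> x /AB {}AB; split; apply: contra_not => /AB.
Qed.

Lemma univ_measurable_bigcup (F : (set T)^nat) :
  (forall i, univ_measurable_set R (F i)) ->
  univ_measurable_set R (\bigcup_i F i).
Proof.
move=> mF; apply/univ_measurableP => P.
have /choice[B /choice[N BN]] i := (univ_measurableP _).1 (mF i) P.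
exists (\bigcup_i B i), (\bigcup_i N i); split.
- by apply: bigcup_measurable => i _; have [] := BN i.
- by apply: bigcup_measurable => i _; have [] := BN i.
- apply: measure_negligible.
    by apply: bigcup_measurable => i _; have [] := BN i.
  apply: negligible_bigcup => i; apply/negligibleP; by have [] := BN i.
- move=> x Nx; split=> -[i _] FB; exists i => //; have [_ _ _ H] := BN i.
    by apply/H => // Nix; apply: Nx; exists i.
  by apply/H => // Nix; apply: Nx; exists i.
Qed.

End univ_sigma_algebra.

(* A copy of [T] carrying the sigma-algebra of universally measurable sets. *)
Definition ut (R : realType) d (T : measurableType d) : Type := T.

Definition ut_display : measure_display -> measure_display.
Proof. exact. Qed.

HB.instance Definition _ (R : realType) d (T : measurableType d) :=
  Pointed.copy (ut R T) T.

HB.instance Definition _ (R : realType) d (T : measurableType d) :=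
  @isMeasurable.Build (ut_display d) (ut R T) (@univ_measurable_set R d T)
    (@univ_measurable0 R d T) (@univ_measurableC R d T)
    (@univ_measurable_bigcup R d T).

Section completion.
Context {R : realType} {d : measure_display} {T : measurableType d}.
Variable P : probability T R.

(* The completion of [P]; on [borel X * bool] it is convertible to [outer P]. *)
Definition hat (A : set (ut R T)) : \bar R :=
  ereal_inf [set P B | B in [set B : set T | measurable B /\ A `<=` B]].

Lemma hatE (A : set (ut R T)) (B N : set T) :
  measurable B -> measurable N -> P N = 0%E ->
  (forall x, ~ N x -> A x <-> B x) -> hat A = P B.
Proof.
move=> mB mN N0 AB; apply/eqP; rewrite eq_le; apply/andP; split.
  apply: ereal_inf_lbound; exists (B `|` N); last first.
    rewrite measureU0//; exact: N0.
  split; first exact: measurableU.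
  by move=> x Ax; have [Nx|Nx] := pselect (N x); [right|left; apply/AB].
apply: le_ereal_inf_tmp => _ [C [mC AC] <-].
have -> : P C = P (C `|` N) by rewrite measureU0.
apply: le_measure; rewrite ?inE//; first exact: measurableU.
by move=> x Bx; have [Nx|Nx] := pselect (N x); [right|left; apply/AC/AB].
Qed.

Lemma hat_measurable (A : set T) : measurable A -> hat A = P A.
Proof. by move=> mA; apply: (@hatE A A set0). Qed.

Let hat0 : hat set0 = 0%E.
Proof. by rewrite hat_measurable. Qed.

Let hat_ge0 A : (0 <= hat A)%E.
Proof. by apply: le_ereal_inf_tmp => _ [B _ <-]. Qed.

Let hat_sigma_additive : semi_sigma_additive hat.
Proof.
move=> F mF tF mUF.
have /choice[B /choice[N BN]] i := (univ_measurableP R _).1 (mF i) P.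
pose M := \bigcup_i N i.
have mM : measurable M by apply: bigcup_measurable => i _; have [] := BN i.
have M0 : P M = 0%E.
  apply: measure_negligible => //.
  apply: negligible_bigcup => i; apply/negligibleP; by have [] := BN i.
(* Off the common null set [M] the versions agree with the [F i], so removing [M] makes them
   disjoint. *)
pose B' i := B i `\` M.
have mB' i : measurable (B' i) by apply: measurableD => //; have [] := BN i.
have FB' i x : ~ M x -> F i x <-> B' i x.
  move=> Mx; have [_ _ _ H] := BN i.
  have Nx : ~ N i x by move=> Nx; apply: Mx; exists i.
  by rewrite /B' /setD/=; split=> [/(H _ Nx)|[/(H _ Nx)]].
rewrite (_ : hat (\bigcup_n F n) = P (\bigcup_n B' n)); last first.
  apply: (@hatE _ _ M) => //; first exact: bigcup_measurable.
  by move=> x Mx; split=> -[i _ h]; exists i => //; apply/FB'.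
rewrite (_ : (fun _ => _) = (fun n => \sum_(0 <= i < n) P (B' i))%E); last first.
  apply/funext => n; apply: eq_bigr => i _.
  by apply: (@hatE _ _ M) => // x; exact: FB'.
apply: measure_semi_sigma_additive => //; last exact: bigcup_measurable.
move=> i j _ _ [x [[Bi Mx] [Bj _]]]; apply: (tF i j I I).
by exists x; split; apply/FB'.
Qed.

HB.instance Definition _ := isMeasure.Build _ (ut R T) R hat
  hat0 hat_ge0 hat_sigma_additive.

Let hat_setT : hat setT = 1%E.
Proof. by rewrite hat_measurable// probability_setT. Qed.

HB.instance Definition _ := Measure_isProbability.Build _ (ut R T) R hat hat_setT.

Lemma measurable_to_ut : measurable_fun setT (id : ut R T -> T).
Proof.
by move=> _ Y mY; rewrite setTI; exact: measurable_univ.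
Qed.

End completion.

Section hat_integral.
Import HBNNSimple.
Context {R : realType} {d : measure_display} {T : measurableType d}.
Variable P : probability T R.
Local Open Scope ereal_scope.

(* No measurability is required: the integral of a nonnegative function is a supremum over simple functions below it. *)
Lemma le_nonmeas_integral d' (S : measurableType d') (mu : {measure set S -> \bar R})
    (f g : S -> \bar R) :
  (forall x, 0 <= f x) -> (forall x, f x <= g x) ->
  \int[mu]_x f x <= \int[mu]_x g x.
Proof.
move=> f0 fg; have g0 x : 0 <= g x by exact: le_trans (f0 x) (fg x).
rewrite !ge0_integralTE//; apply: ereal_sup_le => _ [h hf <-]; exists h => //.
by move=> x; apply: le_trans (hf x) (fg x).
Qed.

Lemma integral_hat (f : T -> \bar R) : (forall x, 0 <= f x) ->
  measurable_fun setT f -> \int[hat P]_x f x = \int[P]_x f x.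
Proof.
move=> f0 mf.
have mid : measurable_fun setT (id : ut R T -> T) by exact: measurable_to_ut.
rewrite [RHS](@eq_measure_integral _ _ _ setT (pushforward (hat P) (id : ut R T -> T))).
  by rewrite ge0_integral_pushforward// => y _.
by move=> A mA _; rewrite [RHS]hat_measurable.
Qed.

(** A Borel simple function below [f] is also simple for the completion, so [f] need not be
    measurable in either sense. This carries the error from the iterated integral of its definition
    to completed measures. *)
Lemma le_integral_hat (f : T -> \bar R) : (forall x, 0 <= f x) ->
  \int[P]_x f x <= \int[hat P]_x f x.
Proof.
move=> f0; rewrite ge0_integralTE//; apply: ge_ereal_sup => _ [h hf <-].
rewrite -integralT_nnsfun -integral_hat//.
- apply: le_nonmeas_integral => x; last exact: hf.
  by rewrite lee_fin; apply: fun_ge0.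
- by move=> x; rewrite lee_fin; apply: fun_ge0.
- by apply/measurable_EFinP.
Qed.

End hat_integral.

Section borel_version.
Context {R : realType} {d : measure_display} {T : measurableType d}.
Variable P : probability T R.
Local Open Scope ereal_scope.

(* The Borel version of [f] is the supremum of [q 1_(B_q)], [B_q] being a Borel version of [f > q]. *)
Lemma borel_version (f : ut R T -> \bar R) :
  (forall x, 0 <= f x) -> measurable_fun setT f ->
  exists (g : T -> \bar R) (N : set T), [/\ forall x, 0 <= g x,
    measurable_fun setT g, measurable N, P N = 0 & forall x, ~ N x -> f x = g x].
Proof.
move=> f0 mf.
pose q (n : nat) : R := if unpickle n is Some r then `|ratr r : R|%R else 0%R.
have q0 n : (0 <= q n)%R by rewrite /q; case: unpickle.
have mq n : univ_measurable_set R [set x : T | (q n)%:E < f x].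
  by have := emeasurable_fun_o_infty measurableT mf (q n)%:E; rewrite setTI; apply.
have /choice[B /choice[N BN]] n := (univ_measurableP R _).1 (mq n) P.
pose M := \bigcup_n N n.
pose h n x := if x \in B n then (q n)%:E else 0.
have mh n : measurable_fun setT (h n).
  have [mB _ _ _] := BN n.
  apply: measurable_fun_ifT => //; apply: (measurable_fun_bool true).
  rewrite setTI (_ : _ @^-1` _ = B n)//; apply/seteqP; split=> x /=.
    exact: set_mem.
  exact: mem_set.
pose g x := esups (h ^~ x) 0%N.
have gub n x : h n x <= g x by apply: ereal_sup_ubound; exists n.
exists g, M; split.
- by move=> x; apply: le_trans (gub 0%N x); rewrite /h; case: ifP.
- exact: measurable_fun_esups.
- by apply: bigcup_measurable => i _; have [] := BN i.
- apply: measure_negligible.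
    by apply: bigcup_measurable => i _; have [] := BN i.
  apply: negligible_bigcup => i; apply/negligibleP; by have [] := BN i.
move=> x Mx.
have BE n : (x \in B n) = ((q n)%:E < f x).
  have [_ _ _ H] := BN n; apply/idP/idP; rewrite inE => Bx.
    by apply/H => // Nx; apply: Mx; exists n.
  by apply/H => // Nx; apply: Mx; exists n.
apply/eqP; rewrite eq_le; apply/andP; split; last first.
  apply: ge_ereal_sup => _ [n _ <-]; rewrite /h BE; case: ifPn => // qf.
  exact: ltW.
rewrite leNgt; apply/negP => gf.
have [r /andP[gr rf]] : exists r : R, (g x < r%:E) && (r%:E < f x).
  have g0 : 0 <= g x.
    by apply: le_trans (gub 0%N x); rewrite /h; case: ifP.
  case: (g x) g0 gf => [a| |] //= _; last by case: (f x).
  case: (f x) (f0 x) => [b| |] //= _ ab.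
    exists ((a + b) / 2)%R; rewrite !lte_fin; rewrite lte_fin in ab; lra.
  by exists (a + 1)%R; rewrite lte_fin ltry andbT; lra.
have g0 : 0 <= g x.
  by apply: le_trans (gub 0%N x); rewrite /h; case: ifP.
case: (g x) (gub^~ x) g0 gr gf => [a| |] //= gub' g0 gr gf.
have [s] := rat_in_itvoo gr; rewrite inE/= => /andP[]; rewrite !bnd_simp => a_s sr.
have s0 : (0 <= ratr s :> R)%R by apply: le_trans (ltW a_s); rewrite -lee_fin.
have qs : q (pickle s) = ratr s by rewrite /q pickleK ger0_norm.
have := gub' (pickle s); rewrite /h BE qs.
rewrite (_ : _ < f x = true); last first.
  by apply/(lt_trans _ rf); rewrite lte_fin.
by rewrite lee_fin leNgt a_s.
Qed.

End borel_version.

Definition ufun (R : realType) d (T : measurableType d) d' (U : measurableType d')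
  (f : T -> U) : Prop := measurable_fun (@setT (ut R T)) f.

Lemma measurable_ufun (R : realType) d (T : measurableType d) d'
    (U : measurableType d') (f : T -> U) :
  measurable_fun setT f -> ufun R f.
Proof.
move=> mf _ Y mY; rewrite setTI; apply: measurable_univ.
by have := mf measurableT Y mY; rewrite setTI.
Qed.

Lemma univ_measurable_preimage (R : realType) d (T : measurableType d) d'
    (U : measurableType d') (f : T -> U) (A : set U) :
  measurable_fun setT f -> univ_measurable_set R A ->
  univ_measurable_set R (f @^-1` A).
Proof.
move=> mf mA; apply/univ_measurableP => P.
pose Q : set U -> \bar R := pushforward P f.
have mpre B : measurable B -> measurable (f @^-1` B).
  by move=> mB; have := mf measurableT B mB; rewrite setTI.
have [B [N [mB mN N0 AB]]] :=
  (univ_measurableP R A).1 mA (distribution P (mfun_Sub (mem_set mf))).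
exists (f @^-1` B), (f @^-1` N); split; [exact: mpre|exact: mpre|exact: N0|].
by move=> x Nx; apply: AB.
Qed.

Lemma ufun_comp (R : realType) d (T : measurableType d) d'
    (U : measurableType d') d'' (V : measurableType d'') (f : T -> U) (g : U -> V) :
  measurable_fun setT f -> ufun R g -> ufun R (g \o f).
Proof.
move=> mf mg _ Y mY; rewrite setTI.
apply: (univ_measurable_preimage mf (A := g @^-1` Y)).
by have := mg measurableT Y mY; rewrite setTI.
Qed.

(** * Fubini for completed measures *)

Section fubini_hat.
Context {R : realType} d1 d2 (T1 : measurableType d1) (T2 : measurableType d2).
Variables (Q : probability T1 R) (P : probability T2 R).
Local Open Scope ereal_scope.

Lemma ae_null d (T : measurableType d) (mu : probability T R) (f : T -> \bar R) :
  measurable_fun setT f -> (forall x, 0 <= f x) -> \int[mu]_x f x = 0 ->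
  exists M, [/\ measurable M, mu M = 0 & forall t, ~ M t -> f t = 0].
Proof.
move=> mf f0 If.
have mM : measurable [set x | f x != 0].
  by have := emeasurable_neq measurableT mf 0; rewrite setTI.
exists [set t | f t != 0]; split => //.
- apply/(negligibleP _ mM).
  have [+ _] := ae_eq_integral_abs mu measurableT mf.
  under eq_integral do rewrite gee0_abs//.
  move=> /(_ If) H.
  by apply: (negligibleS _ H) => x/= /eqP fx0 H'; apply: fx0; exact: H'.
- by move=> t /=; apply: contra_notP => /eqP.
Qed.

Variable f : T1 * T2 -> \bar R.
Hypotheses (f0 : forall z, 0 <= f z) (mf : ufun R f).

(** By Tonelli, the null set where [f] differs from its Borel version has null sections almost
    everywhere; off two exceptional null sets the partial integrals of [f] and of the version
    agree. *)
Let versions : exists (g : T1 * T2 -> \bar R) (M1 : set T1) (M2 : set T2),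
  [/\ measurable_fun setT g /\ (forall z, 0 <= g z), measurable M1 /\ Q M1 = 0,
   measurable M2 /\ P M2 = 0,
   forall t, ~ M1 t -> \int[hat P]_z f (t, z) = fubini_F P g t &
   forall z, ~ M2 z -> \int[hat Q]_t f (t, z) = fubini_G Q g z].
Proof.
have [g [N [g0 mg mN N0 fg]]] := borel_version (Q \x P) f0 mf.
pose k z : \bar R := (\1_N z)%:E.
have mk : measurable_fun setT k by apply/measurable_EFinP/measurable_indic.
have k0 z : 0 <= k z by rewrite lee_fin indicE; case: (_ \in _).
have Ik : \int[Q \x P]_z k z = 0 by rewrite integral_indic// setIT.
have [M1 [mM1 M10 HM1]] : exists M, [/\ measurable M, Q M = 0 &
    forall t, ~ M t -> fubini_F P k t = 0].
  apply: ae_null; first exact: measurable_fun_fubini_tonelli_F.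
    by move=> x; apply: integral_ge0.
  by rewrite -fubini_tonelli1.
have [M2 [mM2 M20 HM2]] : exists M, [/\ measurable M, P M = 0 &
    forall t, ~ M t -> fubini_G Q k t = 0].
  apply: ae_null; first exact: measurable_fun_fubini_tonelli_G.
    by move=> x; apply: integral_ge0.
  by rewrite -fubini_tonelli2.
exists g, M1, M2; split => //.
- move=> t /HM1 Ht.
  have mN' : measurable (xsection N t) by exact: measurable_xsection.
  have N'0 : P (xsection N t) = 0.
    rewrite -Ht /fubini_F /k.
    rewrite (eq_integral (fun z => (\1_(xsection N t) z)%:E)) ?integral_indic ?setIT//.
    by move=> z _; rewrite !indicE mem_xsection.
  rewrite /fubini_F -[RHS]integral_hat//; last exact: measurableT_comp.
  apply: ge0_ae_eq_integral => //.
  + exact: (ufun_comp (pair1_measurable t) mf).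
  + by apply: (measurable_ufun (f := fun z => g (t, z))); exact: measurableT_comp.
  + exists (xsection N t); split.
    * exact: measurable_univ.
    * by rewrite [LHS]hat_measurable.
    * move=> z /=; apply: contra_notP => Nz _; apply: fg => Ntz; apply: Nz.
      by rewrite /xsection/= inE.
- move=> t /HM2 Ht.
  have mN' : measurable (ysection N t) by exact: measurable_ysection.
  have N'0 : Q (ysection N t) = 0.
    rewrite -Ht /fubini_G /k.
    rewrite (eq_integral (fun z => (\1_(ysection N t) z)%:E)) ?integral_indic ?setIT//.
    by move=> z _; rewrite !indicE mem_ysection.
  rewrite /fubini_G -[RHS]integral_hat//; last exact: measurableT_comp.
  apply: ge0_ae_eq_integral => //.
  + exact: (ufun_comp (pair2_measurable t) mf).
  + by apply: (measurable_ufun (f := fun z => g (z, t))); exact: measurableT_comp.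
  + exists (ysection N t); split.
    * exact: measurable_univ.
    * by rewrite [LHS]hat_measurable.
    * move=> z /=; apply: contra_notP => Nz _; apply: fg => Ntz; apply: Nz.
      by rewrite /ysection/= inE.
Qed.

Lemma hat_fubini_version : exists (g : T1 -> \bar R) (M : set T1),
  [/\ measurable_fun setT g, measurable M /\ Q M = 0 &
   forall t, ~ M t -> \int[hat P]_z f (t, z) = g t].
Proof.
have [g [M1 [M2 [[mg g0] M1P M2P H1 H2]]]] := versions.
by exists (fubini_F P g), M1; split => //; exact: measurable_fun_fubini_tonelli_F.
Qed.

Hypothesis mF : ufun R (fun t => \int[hat P]_z f (t, z)).
Hypothesis mG : ufun R (fun z => \int[hat Q]_t f (t, z)).

Lemma hat_fubini_swap :
  \int[hat Q]_t \int[hat P]_z f (t, z) = \int[hat P]_z \int[hat Q]_t f (t, z).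
Proof.
have [g [M1 [M2 [[mg g0] [mM1 M10] [mM2 M20] H1 H2]]]] := versions.
have mgF : measurable_fun setT (fubini_F P g).
  exact: measurable_fun_fubini_tonelli_F.
have mgG : measurable_fun setT (fubini_G Q g).
  exact: measurable_fun_fubini_tonelli_G.
have gF0 x : 0 <= fubini_F P g x by apply: integral_ge0.
have gG0 x : 0 <= fubini_G Q g x by apply: integral_ge0.
transitivity (\int[hat Q]_t fubini_F P g t).
  apply: ge0_ae_eq_integral => //.
  - by apply: measurable_ufun; exact: mgF.
  - by move=> x _; apply: integral_ge0.
  - exists M1; split; [exact: measurable_univ|by rewrite [LHS]hat_measurable|].
    by move=> z /=; apply: contra_notP => /H1.
rewrite integral_hat// -fubini_tonelli1// fubini_tonelli2// -[LHS]integral_hat//.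
apply/esym; apply: ge0_ae_eq_integral => //.
- by apply: measurable_ufun; exact: mgG.
- by move=> x _; apply: integral_ge0.
- exists M2; split; [exact: measurable_univ|by rewrite [LHS]hat_measurable|].
  by move=> z /=; apply: contra_notP => /H2.
Qed.

End fubini_hat.

(** Universal measurability is tested one law [Q] of the parameter at a time, and for each the
    partial integral has a Borel version off a [Q]-null set. *)
Lemma ufun_integral (R : realType) d1 d2 (T1 : measurableType d1)
    (T2 : measurableType d2) (P : probability T2 R) (f : T1 * T2 -> \bar R) :
  (forall z, 0 <= f z)%E -> ufun R f ->
  ufun R (fun t => \int[hat P]_z f (t, z))%E.
Proof.
move=> f0 mf _ Y mY; rewrite setTI; apply/(univ_measurableP R _) => Q.
have [g [M [mg [mM M0] H]]] := hat_fubini_version Q P f0 mf.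
exists (g @^-1` Y), M; split => //.
  by have := mg measurableT Y mY; rewrite setTI.
by move=> t /H /= ->.
Qed.

Section ufun_theory.
Context {R : realType} {d : measure_display} {T : measurableType d}.
Local Open Scope ereal_scope.

Definition ind (A : Prop) : \bar R := if `[< A >] then 1 else 0.

Lemma ind_ge0 A : 0 <= ind A. Proof. by rewrite /ind; case: ifP. Qed.
Lemma ind_le1 A : ind A <= 1. Proof. by rewrite /ind; case: ifP. Qed.
Lemma indT A : A -> ind A = 1. Proof. by rewrite /ind => /asboolP ->. Qed.
Lemma indF A : ~ A -> ind A = 0. Proof. by rewrite /ind => /asboolPn/negbTE ->. Qed.

Lemma le_ind (A B : Prop) : (A -> B) -> ind A <= ind B.
Proof.
move=> AB; have [a|a] := pselect A; last by rewrite (indF a) ind_ge0.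
by rewrite (indT (AB a)) ind_le1.
Qed.

Definition uset (A : set T) := univ_measurable_set R A.

Lemma usetC A : uset A -> uset (~` A). Proof. exact: univ_measurableC. Qed.
Lemma uset_bigcup (F : (set T)^nat) : (forall i, uset (F i)) ->
  uset (\bigcup_i F i).
Proof. exact: univ_measurable_bigcup. Qed.

Lemma usetU A B : uset A -> uset B -> uset (A `|` B).
Proof. exact: (@measurableU _ (ut R T)). Qed.
Lemma usetI A B : uset A -> uset B -> uset (A `&` B).
Proof. exact: (@measurableI _ (ut R T)). Qed.
Lemma uset_cst (p : Prop) : uset [set _ | p].
Proof.
have [h|h] := pselect p.
  by rewrite (_ : [set _ | p] = setT); [exact: measurable_univ|apply/seteqP; split].
by rewrite (_ : [set _ | p] = set0); [exact: measurable_univ|apply/seteqP; split].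
Qed.

Lemma uset_ex (I : countType) (F : I -> set T) : (forall i, uset (F i)) ->
  uset [set t | exists i, F i t].
Proof.
move=> mF; pose G n := if unpickle n is Some i then F i else set0.
rewrite (_ : [set t | _] = \bigcup_n G n).
  apply: uset_bigcup => n; rewrite /G; case: unpickle => // .
  exact: measurable_univ.
apply/seteqP; split=> t /= [i].
  by move=> Ft; exists (pickle i) => //; rewrite /G pickleK.
by move=> _; rewrite /G; case: unpickle => // j; exists j.
Qed.

Lemma uset_all (I : countType) (F : I -> set T) : (forall i, uset (F i)) ->
  uset [set t | forall i, F i t].
Proof.
move=> mF; rewrite -[X in uset X]setCK; apply: usetC.
rewrite (_ : ~` _ = [set t | exists i, (~` F i) t]).
  by apply: uset_ex => i; exact: usetC.
by apply/seteqP; split=> t /= => [/existsNP//|[i Fi] /(_ i)].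
Qed.

Lemma uset_imp A (p : Prop) : (p -> uset A) -> uset [set t | p -> A t].
Proof.
move=> h; have [hp|hp] := pselect p.
  by rewrite (_ : mkset _ = A); [exact: h|apply/seteqP; split=> t/= //; exact].
rewrite (_ : mkset _ = setT); first exact: measurable_univ.
by apply/seteqP; split=> // t _ /hp.
Qed.

Lemma uset_and A (p : Prop) : (p -> uset A) -> uset [set t | p /\ A t].
Proof.
move=> h; have [hp|hp] := pselect p.
  by rewrite (_ : mkset _ = A); [exact: h|apply/seteqP; split=> t/=; [case|]].
rewrite (_ : mkset _ = set0); first exact: measurable_univ.
by apply/seteqP; split=> // t [/hp].
Qed.

Lemma ufun_ind (A : set T) : uset A -> ufun R (fun t => ind (A t)).
Proof.
move=> mA; apply: (measurable_fun_ifT (T1 := ut R T)) => //.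
apply: (measurable_fun_bool true); rewrite setTI.
rewrite (_ : _ @^-1` _ = A)//; apply/seteqP; split=> x /=; by move/asboolP.
Qed.

Lemma uset_lt (f : T -> \bar R) (a : \bar R) : ufun R f -> uset [set t | a < f t].
Proof. by move=> /(emeasurable_fun_o_infty measurableT) => /(_ a); rewrite setTI. Qed.

Lemma uset_gt (f : T -> \bar R) (a : \bar R) : ufun R f -> uset [set t | f t < a].
Proof. by move=> /(emeasurable_fun_infty_o measurableT) => /(_ a); rewrite setTI. Qed.

Lemma ufun_add (f g : T -> \bar R) : ufun R f -> ufun R g -> ufun R (fun t => f t + g t).
Proof. exact: emeasurable_funD. Qed.

Lemma ufun_mul (f g : T -> \bar R) : ufun R f -> ufun R g -> ufun R (fun t => f t * g t).
Proof. exact: emeasurable_funM. Qed.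

Lemma ufun_cst (c : \bar R) : ufun R (fun _ : T => c).
Proof. exact: measurable_cst. Qed.

Lemma ufun_sum (I : Type) (r : seq I) (f : I -> T -> \bar R) :
  (forall i, ufun R (f i)) -> ufun R (fun t => \sum_(i <- r) f i t).
Proof. exact: emeasurable_sum. Qed.

(** Used throughout to freeze a countably valued function, such as an index, a list of labels or a
    selected time, at each of its values. *)
Lemma uset_case (I : countType) (h : T -> I) (F : I -> set T) :
  (forall i, uset [set t | h t = i]) -> (forall i, uset (F i)) ->
  uset [set t | F (h t) t].
Proof.
move=> mh mF; rewrite (_ : mkset _ = [set t | exists i, ([set t | h t = i] `&` F i) t]).
  by apply: uset_ex => i; exact: usetI.
by apply/seteqP; split=> t /= => [Ft|[i [<-]]//]; exists (h t).
Qed.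

End ufun_theory.

(** * Expectations over i.i.d. samples *)

Section expectation.
Context {R : realType} {dz : measure_display} {Z : measurableType dz}.
Local Open Scope ereal_scope.

(* Random lists of constant length with measurable entries: functions of samples are tested on them, which avoids a sigma-algebra on [seq Z]. *)
Definition mlist d (T : measurableType d) (l : T -> seq Z) :=
  (exists n, forall t, size (l t) = n) /\
  forall i, measurable_fun setT (fun t => nth point (l t) i).

Section mlist.
Context d (T : measurableType d).

Lemma mlist_nil : mlist (fun _ : T => [::]).
Proof. by split=> [|i]; [exists 0%N|rewrite nth_nil; exact: measurable_cst]. Qed.

Lemma mlist_cons (q : T -> Z) (l : T -> seq Z) : measurable_fun setT q -> mlist l ->
  mlist (fun t => q t :: l t).
Proof.
move=> mq [[n ln] ml]; split; first by exists n.+1 => t /=; rewrite ln.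
by case=> [|i] /=; [exact: mq|exact: ml].
Qed.

Lemma mlist_cat (l1 l2 : T -> seq Z) : mlist l1 -> mlist l2 ->
  mlist (fun t => l1 t ++ l2 t).
Proof.
move=> [[n ln] ml] [[m lm] ml']; split.
  by exists (n + m)%N => t /=; rewrite size_cat ln lm.
move=> i; under eq_fun do rewrite nth_cat ln.
by case: (i < n)%N; [exact: ml|exact: ml'].
Qed.

Lemma mlist_rcons (l : T -> seq Z) (q : T -> Z) : mlist l -> measurable_fun setT q ->
  mlist (fun t => rcons (l t) (q t)).
Proof.
move=> ml mq; under eq_fun do rewrite -cats1.
by apply: mlist_cat => //; apply: mlist_cons => //; exact: mlist_nil.
Qed.

Lemma mlist_take k (l : T -> seq Z) : mlist l -> mlist (fun t => take k (l t)).
Proof.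
move=> [[n ln] ml]; split.
  by exists (minn k n) => t; rewrite size_take_min ln.
move=> i; have [ik|ki] := ltnP i k.
  by under eq_fun do rewrite nth_take//; exact: ml.
under eq_fun do rewrite nth_default ?size_take_min ?ln ?geq_min ?ki//.
exact: measurable_cst.
Qed.

Lemma mlist_drop k (l : T -> seq Z) : mlist l -> mlist (fun t => drop k (l t)).
Proof.
move=> [[n ln] ml]; split; first by exists (n - k)%N => t; rewrite size_drop ln.
by move=> i; under eq_fun do rewrite nth_drop; exact: ml.
Qed.

Lemma mlist_comp d' (T' : measurableType d') (phi : T' -> T) (l : T -> seq Z) :
  measurable_fun setT phi -> mlist l -> mlist (fun t => l (phi t)).
Proof.
move=> mphi [[n ln] ml]; split; first by exists n => t.
by move=> i; exact: (measurableT_comp (ml i) mphi).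
Qed.

End mlist.

Definition nicep d (T : measurableType d) (F : T -> seq Z -> \bar R) :=
  forall d' (T' : measurableType d') (phi : T' -> T) (l : T' -> seq Z),
  measurable_fun setT phi -> mlist l -> ufun R (fun t => F (phi t) (l t)).

Definition nice (F : seq Z -> \bar R) :=
  forall d' (T' : measurableType d') (l : T' -> seq Z),
  mlist l -> ufun R (fun t => F (l t)).

Definition nices (A : set (seq Z)) :=
  forall d' (T' : measurableType d') (l : T' -> seq Z),
  mlist l -> uset (R := R) [set t | A (l t)].

Lemma nice_ind A : nices A -> nice (fun s => ind (A s)).
Proof. by move=> mA d T l ml; apply: (@ufun_ind _ _ _ (fun t => A (l t))); exact: mA. Qed.

Variable P : probability Z R.

(** Replaces [iexp] for functions of lists; integrating against the completion makes Fubini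
    available for universally measurable integrands. *)
Fixpoint E n (F : seq Z -> \bar R) : \bar R :=
  if n is n'.+1 then \int[hat P]_z E n' (fun s => F (z :: s)) else F [::].

Lemma E_ge0 n F : (forall s, 0 <= F s) -> 0 <= E n F.
Proof. by elim: n F => //= n IH F F0; apply: integral_ge0 => z _; apply: IH. Qed.

Lemma E_le n F G : (forall s, 0 <= F s) ->
  (forall s, size s = n -> F s <= G s) -> E n F <= E n G.
Proof.
elim: n F G => [|n IH] F G F0 FG /=; first exact: FG.
apply: le_nonmeas_integral => z; first exact: E_ge0.
by apply: IH => // s ss; apply: FG; rewrite /= ss.
Qed.

Lemma eq_E n F G : (forall s, size s = n -> F s = G s) -> E n F = E n G.
Proof.
elim: n F G => [|n IH] F G FG /=; first exact: FG.
by apply: eq_integral => z _; apply: IH => s ss; apply: FG; rewrite /= ss.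
Qed.

(** Each integrated point first joins the parameter, so the parameter space must be allowed to vary
    in the induction. *)
Lemma ufun_E n d (T : measurableType d) (F : T -> seq Z -> \bar R) :
  (forall t s, 0 <= F t s) -> nicep F -> ufun R (fun t => E n (F t)).
Proof.
elim: n d T F => [|n IH] d T F F0 nF /=.
  by apply: (nF _ _ id (fun=> [::])) => //; exact: mlist_nil.
apply: (ufun_integral P (f := fun tz => E n (fun s => F tz.1 (tz.2 :: s)))).
  by move=> z; exact: E_ge0.
apply: (IH _ _ (fun tz s => F tz.1 (tz.2 :: s))) => // d' T' phi l mphi ml.
apply: nF; first exact: measurableT_comp.
by apply: mlist_cons => //; exact: measurableT_comp.
Qed.

Lemma nicep_E n d (T : measurableType d) (F : T -> seq Z -> seq Z -> \bar R) :
  (forall t s s', 0 <= F t s s') ->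
  (forall d' (T' : measurableType d') (phi : T' -> T) (l l' : T' -> seq Z),
     measurable_fun setT phi -> mlist l -> mlist l' ->
     ufun R (fun t => F (phi t) (l t) (l' t))) ->
  nicep (fun t s => E n (F t s)).
Proof.
move=> F0 nF d' T' phi l mphi ml.
apply: (ufun_E n (F := fun t => F (phi t) (l t))) => // d'' T'' psi l' mpsi ml'.
apply: (nF _ _ (fun t => phi (psi t)) (fun t => l (psi t))) => //.
  exact: measurableT_comp.
exact: mlist_comp.
Qed.

Lemma nice_cons F z : nice F -> nice (fun s => F (z :: s)).
Proof.
by move=> nF d T l ml; apply: nF; apply: mlist_cons => //; exact: measurable_cst.
Qed.

Lemma ufun_Econs n F : (forall s, 0 <= F s) -> nice F ->
  ufun R (fun z => E n (fun s => F (z :: s))).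
Proof.
move=> F0 nF; apply: (ufun_E n (F := fun z s => F (z :: s))) => //.
by move=> d T phi l mphi ml; apply: nF; exact: mlist_cons.
Qed.

Lemma E_add n F G : (forall s, 0 <= F s) -> (forall s, 0 <= G s) ->
  nice F -> nice G -> E n (fun s => F s + G s) = E n F + E n G.
Proof.
elim: n F G => [//|n IH] F G F0 G0 nF nG /=.
transitivity (\int[hat P]_z (E n (fun s => F (z :: s)) + E n (fun s => G (z :: s)))).
  by apply: eq_integral => z _; apply: IH => //; exact: nice_cons.
rewrite ge0_integralD//.
- by move=> z _; exact: E_ge0.
- exact: ufun_Econs.
- by move=> z _; exact: E_ge0.
- exact: ufun_Econs.
Qed.

Lemma E_cst n c : 0 <= c -> E n (fun=> c) = c.
Proof.
move=> c0; elim: n => //= n IH; under eq_integral do rewrite IH.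
by rewrite integral_cst// [X in _ * X](@probability_setT _ (ut R Z) R (hat P)) mule1.
Qed.

Lemma E_sum n (I : Type) (r : seq I) (F : I -> seq Z -> \bar R) :
  (forall i s, 0 <= F i s) -> (forall i, nice (F i)) ->
  E n (fun s => \sum_(i <- r) F i s) = \sum_(i <- r) E n (F i).
Proof.
move=> F0 nF; elim: r => [|i r IH].
  by rewrite big_nil; under eq_E do rewrite big_nil; rewrite E_cst.
rewrite big_cons -IH -E_add//.
- by apply: eq_E => s _; rewrite big_cons.
- by move=> s; apply: sume_ge0.
- by move=> d T l ml; apply: ufun_sum => j; exact: nF.
Qed.

Lemma E_scale n (c : R) F : (0 <= c)%R -> (forall s, 0 <= F s) -> nice F ->
  E n (fun s => c%:E * F s) = c%:E * E n F.
Proof.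
move=> c0; elim: n F => [//|n IH] F F0 nF /=.
transitivity (\int[hat P]_z (c%:E * E n (fun s => F (z :: s)))).
  by apply: eq_integral => z _; apply: IH => //; exact: nice_cons.
rewrite ge0_integralZl//; first exact: ufun_Econs.
by move=> z _; exact: E_ge0.
Qed.

Lemma E_cat m n F : E (m + n) F = E m (fun s => E n (fun s' => F (s ++ s'))).
Proof. by elim: m F => [|m IH] F //=; apply: eq_integral => z _; rewrite IH. Qed.

Lemma E_le1 n F : (forall s, 0 <= F s) -> (forall s, F s <= 1) -> E n F <= 1.
Proof.
by move=> F0 F1; rewrite -[leRHS](@E_cst n 1)//; apply: E_le => // s _; exact: F1.
Qed.

Lemma E_cvg0 n (F : nat -> seq Z -> \bar R) :
  (forall j s, 0 <= F j s) -> (forall j s, F j s <= 1) -> (forall j, nice (F j)) ->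
  (forall s, F j s @[j --> \oo] --> 0) -> E n (F j) @[j --> \oo] --> 0.
Proof.
elim: n F => [|n IH] F F0 F1 nF cF /=; first exact: cF.
rewrite -[X in _ --> X](@integral0 _ (ut R Z) R (hat P) setT).
have := @dominated_convergence _ (ut R Z) R (hat P) setT measurableT
  (fun j z => E n (fun s => F j (z :: s))) (cst 0) (cst 1).
case => //.
- by move=> j; exact: ufun_Econs.
- by apply: aeW => z _; apply: IH => // j; exact: nice_cons.
- by apply: finite_measure_integrable_cst.
- by apply: aeW => z j _; rewrite gee0_abs; [exact: E_le1|exact: E_ge0].
Qed.

Lemma integral_E_exchange n (G : Z -> seq Z -> \bar R) :
  (forall z s, 0 <= G z s) -> nicep G ->
  \int[hat P]_z E n (G z) = E n (fun s => \int[hat P]_z G z s).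
Proof.
elim: n G => [//|n IH] G G0 nG /=.
pose f (zz : Z * Z) := E n (fun s => G zz.1 (zz.2 :: s)).
have f0 zz : 0 <= f zz by exact: E_ge0.
have mf : ufun R f.
  apply: (ufun_E n (F := fun (zz : Z * Z) s => G zz.1 (zz.2 :: s))) => //.
  move=> d T phi l mphi ml; apply: nG; first exact: measurableT_comp.
  by apply: mlist_cons => //; exact: measurableT_comp.
rewrite (@hat_fubini_swap R _ _ Z Z P P f f0 mf).
- apply: eq_integral => z _; apply: (IH (fun z' s => G z' (z :: s))) => //.
  move=> d T phi l mphi ml; apply: nG => //.
  by apply: mlist_cons => //; exact: measurable_cst.
- exact: (@ufun_integral R _ _ Z Z P f).
- apply: (@ufun_integral R _ _ Z Z P (fun zz => f (zz.2, zz.1))) => //.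
  apply: (ufun_comp (f := fun zz : Z * Z => (zz.2, zz.1))) mf.
  by apply: measurable_fun_pair.
Qed.

Lemma E_take m n F : (forall s, 0 <= F s) ->
  E (m + n) (fun s => F (take m s)) = E m F.
Proof.
move=> F0; rewrite E_cat; apply: eq_E => s ss.
under eq_E do rewrite take_size_cat//.
exact: E_cst.
Qed.

Lemma E_drop m n F : (forall s, 0 <= F s) ->
  E (m + n) (fun s => F (drop m s)) = E n F.
Proof.
move=> F0; rewrite E_cat -[RHS](@E_cst m); last exact: E_ge0.
by apply: eq_E => s ss; apply: eq_E => s' _; rewrite drop_size_cat.
Qed.

(** Independence of disjoint blocks, taken off one at a time; the [r] trailing points absorb the
    remainder of the sample size modulo [k]. *)
Lemma E_blocks k m r (w : seq Z -> R) (c : R) :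
  (0 <= c)%R -> (forall s, (0 <= w s)%R) -> nice (fun s => (w s)%:E) ->
  E k (fun s => (w s)%:E) <= c%:E ->
  E (m * k + r) (fun s => (\prod_(i < m) w (take k (drop (i * k) s)))%:E)
    <= (c ^+ m)%:E.
Proof.
move=> c0 w0 nw wc; elim: m => [|m IH].
  under eq_E do rewrite big_ord0.
  by rewrite E_cst.
have nprod : nice (fun s => (\prod_(i < m) w (take k (drop (i * k) s)))%:E).
  move=> d T l ml; apply/measurable_EFinP.
  apply: (@measurable_prod _ (ut R T)) => i _; apply/measurable_EFinP.
  by apply: nw; apply: mlist_take; exact: mlist_drop.
have prod0 s : (0 <= \prod_(i < m) w (take k (drop (i * k) s)))%R.
  by apply: prodr_ge0 => i _.
rewrite mulSn -addnA E_cat.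
rewrite (@eq_E k _ (fun s => (w s)%:E * E (m * k + r) (fun s' =>
   (\prod_(i < m) w (take k (drop (i * k) s')))%:E))).
  apply: (@le_trans _ _ (E k (fun s => (c ^+ m)%:E * (w s)%:E))).
    apply: E_le => s.
      by apply: mule_ge0; rewrite ?lee_fin//; apply: E_ge0 => s'; rewrite lee_fin.
    by move=> _; rewrite muleC; apply: lee_wpmul2r => //; rewrite lee_fin.
  rewrite E_scale//; last exact: exprn_ge0.
  by rewrite exprSr EFinM; apply: lee_wpmul2l => //; rewrite lee_fin exprn_ge0.
move=> s ss; rewrite -E_scale//.
apply: eq_E => s' _; rewrite -EFinM big_ord_recl mul0n drop0 take_size_cat//.
congr (_ * _)%:E; apply: eq_bigr => i _; rewrite lift0 mulSn.
by rewrite drop_cat ss ltnNge leq_addr/= addKn.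
Qed.

End expectation.

(** * Souslin sets *)

Notation baire := (nat -> nat).

Definition agree (m : nat) (a b : baire) := forall i, (i < m)%N -> a i = b i.

Lemma agreeC m a b : agree m a b -> agree m b a.
Proof. by move=> ab i im; rewrite ab. Qed.

Lemma agree_leq m n a b : (m <= n)%N -> agree n a b -> agree m a b.
Proof. by move=> mn ab i im; apply: ab; exact: leq_trans im mn. Qed.

Definition finitary2 (A : Type) (f : baire -> baire -> A) :=
  exists m, forall a a' b b', agree m a a' -> agree m b b' -> f a b = f a' b'.

Definition locally_finitary (phi : baire -> baire) :=
  forall k, exists m, forall a a', agree m a a' -> agree k (phi a) (phi a').

Lemma locally_finitaryP (phi : baire -> baire) :
  (forall k, exists m, forall a a', agree m a a' -> phi a k = phi a' k) ->
  locally_finitary phi.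
Proof.
move=> H; elim=> [|k [m Hm]]; first by exists 0%N.
have [m' Hm'] := H k; exists (maxn m m') => a a' aa i.
rewrite ltnS leq_eqVlt => /predU1P[->|ik].
  by apply: Hm'; apply: agree_leq aa; exact: leq_maxr.
by apply: Hm => //; apply: agree_leq aa; exact: leq_maxl.
Qed.

Definition evn (a : baire) : baire := fun k => a k.*2.
Definition odn (a : baire) : baire := fun k => a k.*2.+1.
Definition mrg (a b : baire) : baire := fun k => if odd k then b k./2 else a k./2.
Definition sub (a : baire) (i : nat) : baire := fun k => a (pickle (i, k)).
Definition join (f : nat -> baire) : baire := fun j =>
  if unpickle j is Some (i, k) then f i k else 0%N.
Definition shift (a : baire) : baire := fun k => a k.+1.

Lemma evn_mrg a b : evn (mrg a b) = a.
Proof. by apply/funext => k; rewrite /evn /mrg odd_double doubleK. Qed.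
Lemma odn_mrg a b : odn (mrg a b) = b.
Proof. by apply/funext => k; rewrite /odn /mrg /= odd_double/= uphalf_double. Qed.
Lemma sub_join f i : sub (join f) i = f i.
Proof. by apply/funext => k; rewrite /sub /join pickleK. Qed.

Lemma lf_coord (r : nat -> nat) : locally_finitary (fun a k => a (r k)).
Proof. by apply: locally_finitaryP => k; exists (r k).+1 => a a' aa; exact: aa. Qed.

Lemma lf_evn : locally_finitary evn. Proof. exact: (lf_coord double). Qed.
Lemma lf_odn : locally_finitary odn.
Proof. exact: (lf_coord (fun k => k.*2.+1)). Qed.
Lemma lf_sub i : locally_finitary (sub^~ i).
Proof. exact: (lf_coord (fun k => pickle (i, k))). Qed.

Lemma lf_comp f g : locally_finitary f -> locally_finitary g ->
  locally_finitary (fun a => f (g a)).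
Proof.
move=> lf lg k; have [m Hm] := lf k; have [m' Hm'] := lg m.
by exists m' => a a' /Hm' /Hm.
Qed.

Lemma mrg_agree m a a' b b' : agree m a a' -> agree m b b' ->
  agree m (mrg a b) (mrg a' b').
Proof.
move=> aa bb i im; have i2 : (i./2 < m)%N by apply: leq_ltn_trans im; lia.
by rewrite /mrg; case: ifP => _; [exact: bb|exact: aa].
Qed.

Section souslin.
Context {d : measure_display} {T : measurableType d}.

(* Souslin sets with a parameter [a]: [exists b, forall n, E n a b t] with each [E n] measurable in [t] and depending on finitely many entries of [a] and [b]. *)
Definition sous (B : baire -> T -> Prop) :=
  exists E : nat -> baire -> baire -> set T,
    [/\ forall n, finitary2 (E n), forall n a b, measurable (E n a b) &
     forall a t, B a t <-> exists b, forall n, E n a b t].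

Lemma eq_sous (B C : baire -> T -> Prop) :
  (forall a t, B a t <-> C a t) -> sous B -> sous C.
Proof.
by move=> BC [E [fE mE HE]]; exists E; split => // a t; rewrite -BC.
Qed.

Lemma sous_subst phi (B : baire -> T -> Prop) : locally_finitary phi -> sous B ->
  sous (fun a t => B (phi a) t).
Proof.
move=> lphi [E [fE mE HE]]; exists (fun n a b => E n (phi a) b); split => //.
move=> n; have [m Hm] := fE n; have [m' Hm'] := lphi m.
exists (maxn m m') => a a' b b' aa bb; apply: Hm.
  by apply: Hm'; apply: agree_leq aa; exact: leq_maxr.
by apply: agree_leq bb; exact: leq_maxl.
Qed.

(** Witnesses for all [i] are packed into one sequence by [join]. *)
Lemma sous_all (B : nat -> baire -> T -> Prop) : (forall i, sous (B i)) ->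
  sous (fun a t => forall i, B i a t).
Proof.
move=> /choice[E EP].
exists (fun p a b => if unpickle p is Some (i, n) then E i n a (sub b i) else setT).
split.
- move=> p; case: unpickle => [[i n]|]; last by exists 0%N.
  have [/(_ n)[m Hm] _ _] := EP i; have [m' Hm'] := lf_sub i m.
  exists (maxn m m') => a a' b b' aa bb; apply: Hm.
    by apply: agree_leq aa; exact: leq_maxl.
  by apply: Hm'; apply: agree_leq bb; exact: leq_maxr.
- by move=> p a b; case: unpickle => [[i n]|]//; have [_ + _] := EP i; exact.
move=> a t; split=> [H|[b Hb] i].
  have /choice[b Hb] i : exists b, forall n, E i n a b t.
    by have [_ _ <-] := EP i.
  by exists (join b) => p; case: unpickle => // -[i n]; rewrite sub_join.
have [_ _ ->] := EP i; exists (sub b i) => n.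
by have := Hb (pickle (i, n)); rewrite pickleK.
Qed.

(** The first entry of the witness names the index; the conditions belonging to other indices become
    vacuous. *)
Lemma sous_ex (B : nat -> baire -> T -> Prop) : (forall i, sous (B i)) ->
  sous (fun a t => exists i, B i a t).
Proof.
move=> /choice[E EP].
exists (fun p a b => if unpickle p is Some (i, n) then
   (if b 0%N == i then E i n a (shift b) else setT) else setT).
split.
- move=> p; case: unpickle => [[i n]|]; last by exists 0%N.
  have [/(_ n)[m Hm] _ _] := EP i.
  exists m.+1 => a a' b b' aa bb; rewrite (bb 0%N)//; case: ifP => // _; apply: Hm.
    exact: agree_leq aa.
  by move=> j jm; exact: bb.
- move=> p a b; case: unpickle => [[i n]|]//; case: ifP => // _.
  by have [_ + _] := EP i; exact.
move=> a t; split=> [[i]|[b Hb]].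
  have [_ _ ->] := EP i => -[b Hb].
  exists (fun k => if k is k'.+1 then b k' else i) => p.
  by case: unpickle => // -[j n]; case: eqP => // <-.
exists (b 0%N); have [_ _ ->] := EP (b 0%N); exists (shift b) => n.
by have := Hb (pickle (b 0%N, n)); rewrite pickleK eqxx.
Qed.

Lemma sous_proj (B : baire -> T -> Prop) : sous B ->
  sous (fun a t => exists c, B (mrg a c) t).
Proof.
move=> [E [fE mE HE]].
exists (fun n a b => E n (mrg a (evn b)) (odn b)); split => //.
- move=> n; have [m Hm] := fE n; have [m1 H1] := lf_evn m; have [m2 H2] := lf_odn m.
  exists (maxn m (maxn m1 m2)) => a a' b b' aa bb; apply: Hm.
    apply: mrg_agree; first by apply: agree_leq aa; exact: leq_maxl.
    by apply: H1; apply: agree_leq bb; lia.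
  by apply: H2; apply: agree_leq bb; lia.
move=> a t; split=> [[c /HE[b Hb]]|[b Hb]].
  by exists (mrg c b) => n; rewrite evn_mrg odn_mrg.
by exists (evn b); apply/HE; exists (odn b).
Qed.

Lemma sous_measurable (C : set T) : measurable C -> sous (fun _ t => C t).
Proof.
move=> mC; exists (fun _ _ _ => C); split => // [n|a t]; first by exists 0%N.
by split=> [Ct|[b /(_ 0%N)]]; first by exists (fun=> 0%N).
Qed.

Lemma sous_finitary (C : baire -> Prop) :
  (exists m, forall a a', agree m a a' -> C a -> C a') -> sous (fun a _ => C a).
Proof.
move=> [m Hm]; exists (fun _ a _ => [set _ | C a]); split.
- move=> n; exists m => a a' b b' aa _; apply/funext => t /=; apply/propext.
  by split; apply: Hm => //; exact: agreeC.
- move=> n a b; have [h|h] := pselect (C a).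
    by rewrite (_ : mkset _ = setT)//; apply/seteqP; split.
  by rewrite (_ : mkset _ = set0)//; apply/seteqP; split.
- by move=> a t; split=> [Ct|[b /(_ 0%N)]]; first by exists (fun=> 0%N).
Qed.

Lemma sous_true : sous (fun _ _ => True).
Proof. by apply: sous_finitary; exists 0%N. Qed.

Lemma sous_all_count (I : countType) (B : I -> baire -> T -> Prop) :
  (forall i, sous (B i)) -> sous (fun a t => forall i, B i a t).
Proof.
move=> sB; apply: (@eq_sous (fun a t => forall n,
  (if unpickle n is Some i then B i else (fun _ _ => True)) a t)).
  move=> a t; split=> [H i|H n]; last by case: unpickle => // i.
  by have := H (pickle i); rewrite pickleK.
by apply: sous_all => n; case: unpickle => // ; exact: sous_true.
Qed.

Lemma sous_imp (p : Prop) B : (p -> sous B) -> sous (fun a t => p -> B a t).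
Proof.
move=> h; have [hp|hp] := pselect p.
  by apply: eq_sous (h hp) => a t; split=> // /(_ hp).
by apply: eq_sous sous_true => a t; split.
Qed.

(** Stands in for joint measurability in [(a, t)], without a sigma-algebra on the sequences [a]. *)
Definition adm d' (M : measurableType d') (q : baire -> T -> M) :=
  forall C, measurable C -> sous (fun a t => C (q a t)).

(* Sets whose preimage is Souslin together with that of their complement form a sigma-algebra. *)
Lemma adm_generator d' (M : measurableType d') (G : set (set M))
    (q : baire -> T -> M) : measurable = <<s G >> ->
  (forall C, G C -> sous (fun a t => C (q a t)) /\ sous (fun a t => ~ C (q a t))) ->
  adm q.
Proof.
move=> mG HG.
suff H : <<s G >> `<=` [set C | sous (fun a t => C (q a t)) /\ sous (fun a t => ~ C (q a t))].
  by move=> C mC; have [] : [set C | sous (fun a t => C (q a t)) /\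
    sous (fun a t => ~ C (q a t))] C by apply: H; rewrite -mG.
apply: smallest_sub => //; split.
- split; first by apply: sous_finitary; exists 0%N.
  by apply: eq_sous sous_true => a t; split=> // _ [].
- move=> C [s1 s2]; split.
    by apply: eq_sous s2 => a t; split=> [|[]].
  by apply: eq_sous s1 => a t; split=> [h [_ /(_ h)]//|nC]; apply: contrapT => h; exact: nC.
- move=> F HF; split.
    apply: (@eq_sous (fun a t => exists i, F i (q a t))).
      by move=> a t; split=> [[i]|[i _]]; exists i.
    by apply: sous_ex => i; have [] := HF i.
  apply: (@eq_sous (fun a t => forall i, ~ F i (q a t))).
    by move=> a t; split=> [H [i _]|H i Fi]; [exact: H|apply: H; exists i].
  by apply: sous_all => i; have [] := HF i.
Qed.

Lemma adm_comp d' (M : measurableType d') d'' (M' : measurableType d'')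
  (q : baire -> T -> M) (f : M -> M') : measurable_fun setT f ->
  adm q -> adm (fun a t => f (q a t)).
Proof.
move=> mf aq C mC; apply: (aq (f @^-1` C)).
by have := mf measurableT C mC; rewrite setTI.
Qed.

Lemma adm_subst d' (M : measurableType d') (q : baire -> T -> M) phi :
  locally_finitary phi -> adm q -> adm (fun a => q (phi a)).
Proof. by move=> lphi aq C mC; apply: (sous_subst lphi (aq C mC)). Qed.

Lemma adm_meas d' (M : measurableType d') (q : T -> M) :
  measurable_fun setT q -> adm (fun _ => q).
Proof.
move=> mq C mC; apply: (sous_measurable (C := q @^-1` C)).
by have := mq measurableT C mC; rewrite setTI.
Qed.

Lemma adm_pair d1 (M1 : measurableType d1) d2 (M2 : measurableType d2)
    (q1 : baire -> T -> M1) (q2 : baire -> T -> M2) :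
  adm q1 -> adm q2 -> adm (fun a t => (q1 a t, q2 a t)).
Proof.
move=> a1 a2; apply: (@adm_generator _ (M1 * M2)%type
  (preimage_set_system setT fst measurable `|` preimage_set_system setT snd measurable)).
  by [].
move=> C [] [A mA <-]; rewrite setTI; split=> /=.
- exact: a1.
- exact: (a1 (~` A) (measurableC mA)).
- exact: a2.
- exact: (a2 (~` A) (measurableC mA)).
Qed.

Lemma prefix_sous (S : seq nat -> Prop) phi m : locally_finitary phi ->
  sous (fun a _ => S [seq phi a i | i <- iota 0 m]).
Proof.
move=> lphi; apply: sous_finitary; have [m' Hm'] := lphi m.
exists m' => a a' /Hm' aa; rewrite (_ : map (phi a) _ = map (phi a') (iota 0 m))//.
by apply/eq_in_map => i; rewrite mem_iota => /andP[_ im]; exact: aa.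
Qed.

End souslin.

(** * Universal measurability of Souslin sets *)

Section outer_probability.
Context {R : realType} {d : measure_display} {T : measurableType d}.
Variable P : probability T R.
Implicit Types A C : set T.
Local Open Scope ereal_scope.

Lemma hat_le A C : A `<=` C -> hat P A <= hat P C.
Proof.
move=> AC; apply: le_ereal_inf_tmp => _ [B [mB CB] <-].
by apply: ereal_inf_lbound; exists B => //; split => //; exact: subset_trans CB.
Qed.

Lemma hat_ge0' A : 0 <= hat P A.
Proof. by apply: le_ereal_inf_tmp => _ [B _ <-]. Qed.

Lemma hat_fin A : hat P A \is a fin_num.
Proof.
rewrite ge0_fin_numE ?hat_ge0'//; apply: (@le_lt_trans _ _ 1); last exact: ltry.
apply: ereal_inf_lbound; exists setT; last exact: probability_setT.
by split.
Qed.

Lemma hull A : exists H, [/\ measurable H, A `<=` H & P H = hat P A].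
Proof.
have /choice[B HB] (n : nat) : exists B, [/\ measurable B, A `<=` B &
    P B < hat P A + (n.+1%:R^-1)%:E].
  have [|_ [B [mB AB] <-] PB] := @lb_ereal_inf_adherent R
    [set P B | B in [set B : set T | measurable B /\ A `<=` B]] n.+1%:R^-1 _ (hat_fin A).
    by rewrite invr_gt0.
  by exists B.
have mH : measurable (\bigcap_n B n) by apply: bigcapT_measurable => n; have [] := HB n.
exists (\bigcap_n B n); split => //.
- by move=> t At n _; have [_ AB _] := HB n; exact: AB.
apply/eqP; rewrite eq_le; apply/andP; split; last first.
  apply: ereal_inf_lbound; exists (\bigcap_n B n) => //; split => //.
  by move=> t At n _; have [_ AB _] := HB n; exact: AB.
apply/lee_addgt0Pr => e e0.
have [n ne] : exists n, (n.+1%:R^-1 < e)%R.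
  exists (Num.truncn e^-1); rewrite invf_plt ?posrE//.
  by rewrite truncnS_gt.
have [mB AB PB] := HB n.
apply: (@le_trans _ _ (P (B n))).
  by apply: le_measure; rewrite ?inE//; exact: bigcap_inf.
by apply: (le_trans (ltW PB)); rewrite leeD2l// lee_fin ltW.
Qed.

(** Measurable hulls of the [C n] need not increase; intersecting each with all later ones makes
    them do so, and the result still contains [C n] without exceeding its outer measure. *)
Lemma hat_continuous (C : nat -> set T) (r : \bar R) :
  (forall n, C n `<=` C n.+1) -> r < hat P (\bigcup_n C n) ->
  exists n, r < hat P (C n).
Proof.
move=> incC rC; apply: contrapT => /forallNP H.
have {}H n : hat P (C n) <= r by rewrite leNgt; apply/negP/H.
have /choice[K HK] n := hull (C n).
pose G n := \bigcap_(j in [set j | (n <= j)%N]) K j.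
have mK n : measurable (K n) by have [] := HK n.
have mG n : measurable (G n) by apply: bigcap_measurable => //; exists n => /=.
have incC' m n : (m <= n)%N -> C m `<=` C n.
  elim: n => [|n IH]; first by rewrite leqn0 => /eqP ->.
  rewrite leq_eqVlt => /predU1P[->//|mn]; apply: subset_trans (incC n); exact: IH.
have CG n : C n `<=` G n.
  by move=> t Ct j /= nj; have [_ + _] := HK j; apply; exact: (incC' n).
have PG n : P (G n) <= r.
  apply: le_trans (H n); have [_ _ <-] := HK n.
  by apply: le_measure; rewrite ?inE//; apply: bigcap_inf => /=.
have mUG : measurable (\bigcup_n G n) by exact: bigcupT_measurable.
have cvgG : (P \o G) @ \oo --> P (\bigcup_n G n).
  apply: nondecreasing_cvg_mu => //.
  by move=> m n mn; apply/subsetPset => t Gt j /= nj; apply: Gt; exact: leq_trans nj.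
have : hat P (\bigcup_n C n) <= r.
  apply: (@le_trans _ _ (P (\bigcup_n G n))).
    apply: ereal_inf_lbound; exists (\bigcup_n G n) => //; split => //.
    by move=> t [n _ Ct]; exists n => //; exact: CG.
  by rewrite -(cvg_lim _ cvgG)//; apply: lime_le; [apply/cvg_ex; eexists; exact: cvgG|exact: nearW].
by rewrite leNgt rC.
Qed.

Section souslin_inner.
Variable E : nat -> baire -> set T.
Hypothesis fE : forall n, exists m, forall b b', agree m b b' -> E n b = E n b'.
Hypothesis mE : forall n b, measurable (E n b).
Let A := [set t | exists b, forall n, E n b t].

Let below (s : seq nat) (b : baire) := forall i, (i < size s)%N -> (b i <= nth 0%N s i)%N.
Let As s := [set t | exists b, below s b /\ forall n, E n b t].

Let As_rcons s : As s = \bigcup_k As (rcons s k).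
Proof.
apply/seteqP; split=> t.
  move=> [b [bs Eb]]; exists (b (size s)) => //; exists b; split => // i.
  rewrite size_rcons ltnS nth_rcons leq_eqVlt => /predU1P[->|is_].
    by rewrite ltnn eqxx.
  by rewrite is_; exact: bs.
move=> [k _ [b [bs Eb]]]; exists b; split => // i is_.
have := bs i; rewrite size_rcons nth_rcons is_; apply; exact: ltnW.
Qed.

Let As_mono s k : As (rcons s k) `<=` As (rcons s k.+1).
Proof.
move=> t [b [bs Eb]]; exists b; split => // i is_.
have := bs i; move: is_; rewrite !size_rcons !nth_rcons => is_ /(_ is_).
case: ifP => // _; case: ifP => // _ /leq_trans; exact.
Qed.

(** The sequences below [b] form a compact set; [beta n] obeys the bound only on its first [n]
    entries, which is enough for a limit point. *)
Let konig (b : baire) (beta : nat -> baire) :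
  (forall n i, (i < n)%N -> (beta n i <= b i)%N) ->
  exists g : baire, forall m N, exists2 n, (N <= n)%N & agree m (beta n) g.
Proof.
move=> Hb.
pose good s := forall N, exists2 n, (N <= n)%N & forall i, (i < size s)%N -> beta n i = nth 0%N s i.
have good0 : good [::] by move=> N; exists N.
have goodS s : good s -> exists k, good (rcons s k).
  move=> gs; apply: contrapT => /forallNP nk.
  have /choice[M HM] k : exists N, forall n, (N <= n)%N ->
      ~ forall i, (i < (size s).+1)%N -> beta n i = nth 0%N (rcons s k) i.
    have /existsNP[N HN] := nk k; exists N => n Nn H; apply: HN; exists n => //.
    by rewrite size_rcons.
  have [n] := gs (maxn (size s).+1 (\max_(k < (b (size s)).+1) M k)).
  rewrite geq_max => /andP[sn Mn] ns.
  have kb : (beta n (size s) < (b (size s)).+1)%N by rewrite ltnS; exact: Hb.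
  apply: (HM (beta n (size s)) n).
    by apply: leq_trans Mn; exact: (leq_bigmax (F := fun k : 'I__ => M k) (Ordinal kb)).
  move=> i; rewrite nth_rcons ltnS leq_eqVlt => /predU1P[->|is_].
    by rewrite ltnn eqxx.
  by rewrite is_; exact: ns.
have /choice[f Hf] : forall s, exists k, good s -> good (rcons s k).
  by move=> s; have [/goodS[k gk]|?] := pselect (good s); [exists k|exists 0%N].
pose S := fix S n := if n is n'.+1 then rcons (S n') (f (S n')) else [::].
have gS n : good (S n) by elim: n => //= n; exact: Hf.
have sS n : size (S n) = n by elim: n => //= n IH; rewrite size_rcons IH.
have nS m i : (i < m)%N -> nth 0%N (S m) i = f (S i).
  elim: m => //= m IH; rewrite nth_rcons sS ltnS leq_eqVlt => /predU1P[->|im].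
    by rewrite ltnn eqxx.
  by rewrite im; exact: IH.
exists (fun i => f (S i)) => m N; have [n Nn Hn] := gS m N; exists n => //.
by move=> i im; rewrite Hn ?sS// nS.
Qed.

(** Choquet's capacitability argument: the entries of the witness are bounded one after another
    while the outer measure stays above [r]. Under these bounds the witnesses range over a compact
    set, so the Borel sets of points with an approximate witness decrease to a subset of [A]. *)
Lemma souslin_inner (r : \bar R) : r < hat P A ->
  exists F, [/\ measurable F, F `<=` A & r <= P F].
Proof.
move=> rA; have /choice[md Hmd] := fE.
have As0 : As [::] = A.
  by apply/seteqP; split=> t [b]; [move=> [_ ?]; exists b|exists b].
have /choice[f Hf] : forall s, exists k, r < hat P (As s) -> r < hat P (As (rcons s k)).
  move=> s; have [|?] := pselect (r < hat P (As s)); last by exists 0%N.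
  by rewrite {1}As_rcons => /(hat_continuous (fun k => @As_mono s k))[k rk]; exists k.
pose S := fix S n := if n is n'.+1 then rcons (S n') (f (S n')) else [::].
have rS n : r < hat P (As (S n)) by elim: n => [|n] /=; [rewrite As0|exact: Hf].
have sS n : size (S n) = n by elim: n => //= n IH; rewrite size_rcons IH.
pose b i := f (S i).
have nS m i : (i < m)%N -> nth 0%N (S m) i = b i.
  elim: m => //= m IH; rewrite nth_rcons sS ltnS leq_eqVlt => /predU1P[->|im].
    by rewrite ltnn eqxx.
  by rewrite im; exact: IH.
(* Approximate witnesses are finite lists, hence countably many; condition [k] is consulted only if
   [md k <= n], that is when the first [n] entries decide it. *)
pose F n := [set t | exists s : seq nat, (forall i, (i < n)%N -> (nth 0%N s i <= b i)%N) /\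
   forall k, (k < n)%N -> (md k <= n)%N -> E k (nth 0%N s) t].
have mF n : measurable (F n).
  pose G (j : nat) := if unpickle j is Some s then
     [set t | (forall i, (i < n)%N -> (nth 0%N s i <= b i)%N) /\
      forall k, (k < n)%N -> (md k <= n)%N -> E k (nth 0%N s) t] else set0.
  rewrite (_ : F n = \bigcup_j G j); last first.
    apply/seteqP; split=> t.
      by move=> [s Hs]; exists (pickle s) => //; rewrite /G pickleK.
    by move=> [j _]; rewrite /G; case: unpickle => // s Hs; exists s.
  apply: bigcupT_measurable => j; rewrite /G; case: unpickle => // s.
  have [h|h] := pselect (forall i, (i < n)%N -> (nth 0%N s i <= b i)%N); last first.
    by rewrite (_ : mkset _ = set0)//; apply/seteqP; split=> // t [].
  rewrite (_ : mkset _ = \bigcap_k (if (k < n)%N && (md k <= n)%N then E k (nth 0%N s) else setT)).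
    by apply: bigcapT_measurable => k; case: ifP.
  apply/seteqP; split=> t.
    by move=> [_ H] k _; case: ifP => // /andP[]; exact: H.
  by move=> H; split => // k kn mk; have := H k I; rewrite kn mk.
have decF n : F n.+1 `<=` F n.
  move=> t [s [Hs Es]]; exists s; split=> [i ni|k kn mk]; first by apply: Hs; exact: ltnW.
  by apply: Es; exact: ltnW.
have decF' m n : (m <= n)%N -> F n `<=` F m.
  elim: n => [|n IH]; first by rewrite leqn0 => /eqP ->.
  rewrite leq_eqVlt => /predU1P[->//|mn]; apply: subset_trans (decF n) _; exact: IH.
have AF n : As (S n) `<=` F n.
  move=> t [g [gS Eg]]; exists [seq g i | i <- iota 0 n].
  have ng i : (i < n)%N -> nth 0%N [seq g i | i <- iota 0 n] i = g i.
    by move=> ni; rewrite (nth_map 0%N) ?size_iota// nth_iota.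
  split=> [i ni|k kn mk].
    by rewrite ng// -(nS n)//; apply: gS; rewrite sS.
  rewrite (Hmd k _ g) => // i im; rewrite ng//; exact: leq_trans mk.
have rF n : r <= P (F n).
  by rewrite -hat_measurable//; apply: le_trans (hat_le (AF n)); exact: ltW.
have mI : measurable (\bigcap_n F n) by exact: bigcapT_measurable.
exists (\bigcap_n F n); split => //.
- move=> t Ft.
  have /choice[s Hs] n : exists s : seq nat, (forall i, (i < n)%N -> (nth 0%N s i <= b i)%N) /\
    forall k, (k < n)%N -> (md k <= n)%N -> E k (nth 0%N s) t by exact: Ft.
  have [g Hg] := @konig b (fun n => nth 0%N (s n)) (fun n => (Hs n).1).
  exists g => k; have [n Nn ag] := Hg (md k) (maxn k.+1 (md k)).
  rewrite -(Hmd k _ _ ag); apply: (Hs n).2.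
    by apply: leq_trans Nn; exact: leq_maxl.
  by apply: leq_trans Nn; exact: leq_maxr.
have cvgF : (P \o F) @ \oo --> P (\bigcap_n F n).
  apply: nonincreasing_cvg_mu => //.
    by apply: (@le_lt_trans _ _ 1); [exact: probability_le1|exact: ltry].
  by move=> m n mn; apply/subsetPset; exact: decF'.
rewrite -(cvg_lim _ cvgF)//; apply: lime_ge; [apply/cvg_ex; eexists; exact: cvgF|exact: nearW].
Qed.

End souslin_inner.

End outer_probability.

(** Borel subsets of [B a] come arbitrarily close to its outer measure, so countably many of them
    fill its measurable hull up to a null set. *)
Theorem sous_univ_measurable (R : realType) d (T : measurableType d)
    (B : baire -> T -> Prop) a : sous B -> univ_measurable_set R (B a).
Proof.
move=> [E [fE mE HE]]; apply/univ_measurableP => P.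
pose E' n b := E n a b.
have BE : B a = [set t | exists b, forall n, E' n b t].
  by apply/seteqP; split=> t; rewrite /= HE.
have fE' n : exists m, forall b b', agree m b b' -> E' n b = E' n b'.
  by have [m Hm] := fE n; exists m => b b' bb; apply: Hm.
have mE' n b : measurable (E' n b) by exact: mE.
have fin := hat_fin P (B a).
have /choice[F HF] n : exists F, [/\ measurable F, F `<=` B a &
    (hat P (B a) - (n.+1%:R^-1)%:E <= P F)%E].
  rewrite BE; apply: souslin_inner => //.
  by rewrite -BE lteBlDr// lteDl// lte_fin.
have [H [mH BH PH]] := hull P (B a).
have mU : measurable (\bigcup_n F n) by apply: bigcupT_measurable => n; have [] := HF n.
have UB : \bigcup_n F n `<=` B a by move=> t [n _ Ft]; have [_ + _] := HF n; exact.
exists (\bigcup_n F n), (H `\` \bigcup_n F n); split => //.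
- exact: measurableD.
- rewrite measureD//; last first.
    by rewrite (le_lt_trans (probability_le1 P mH))// ltry.
  rewrite setIidr; last exact: subset_trans BH.
  apply/eqP; rewrite eq_le; apply/andP; split; last first.
    by rewrite sube_ge0 ?fin_num_measure//; apply: le_measure; rewrite ?inE//; exact: subset_trans BH.
  apply/lee_addgt0Pr => e e0; rewrite add0e [leLHS](_ : _ = hat P (B a) - P (\bigcup_n F n))%E; last by rewrite -PH.
  have [n ne] : exists n, (n.+1%:R^-1 < e)%R.
    by exists (Num.truncn e^-1); rewrite invf_plt ?posrE// truncnS_gt.
  rewrite leeBlDr ?fin_num_measure//.
  have [mF _] := HF n; rewrite leeBlDr// => /le_trans; apply.
  rewrite addeC; apply: leeD; first by rewrite lee_fin ltW.
  by apply: le_measure; rewrite ?inE//; exact: bigcup_sup.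
- move=> t nN; split=> [Bt|]; last exact: UB.
  by apply: contrapT => nU; apply: nN; split => //; exact: BH.
Qed.

(** * Polish spaces as continuous images of Baire space *)

Section baire_surjection.
Context (R : realType) (X : ptopologicalType).

Lemma polish_dense (d : X -> X -> R) (D : set X) :
  (forall x y, d x y = d y x) -> (forall x y z, d x z <= d x y + d y z) ->
  (forall x, d x x = 0) ->
  (forall A : set X, open A <->
     (forall x, A x -> exists2 e : R, 0 < e & [set y | d x y < e] `<=` A)) ->
  countable D -> closure D = setT ->
  exists q : nat -> X, forall x e, 0 < e -> exists n, d (q n) x < e.
Proof.
move=> dC dT d0 dO cD clD.
have dense x e : 0 < e -> exists y, D y /\ d x y < e.
  move=> e0; have : closure D x by rewrite clD.
  move=> /(_ [set y | d x y < e])[].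
    apply: open_nbhs_nbhs; split; last by rewrite /= d0.
    apply/dO => y /= xy; exists (e - d x y); first by rewrite subr_gt0.
    by move=> z /= yz; apply: le_lt_trans (dT x y z) _; rewrite -ltrBrDl.
  by move=> y [Dy xy]; exists y.
have /countable_injP[f /= finj] := cD.
have /choice[q Hq] n : exists x, (exists2 y, D y & f y = n) -> D x /\ f x = n.
  have [[y Dy fy]|?] := pselect (exists2 y, D y & f y = n); last by exists point.
  by exists y.
exists q => x e /(dense x)[y [Dy xy]]; exists (f y).
have [|Dq fq] := Hq (f y); first by exists y.
by rewrite (finj (q (f y)) y) ?inE// dC.
Qed.

Let h n : R := ((2 ^ n)%N%:R)^-1.
Let hS n : h n = h n.+1 + h n.+1.
Proof.
rewrite /h expnS natrM invfM; have : (2 ^ n)%N%:R != 0 :> R by rewrite pnatr_eq0 expn_eq0.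
by move=> ?; field.
Qed.
Let h0 n : 0 < h n. Proof. by rewrite invr_gt0 ltr0n expn_gt0. Qed.
Let h_lt e : 0 < e -> exists n, h n < e.
Proof.
move=> e0; exists (Num.truncn e^-1); rewrite invf_plt ?posrE// ?ltr0n ?expn_gt0//.
apply: (lt_le_trans (truncnS_gt _)); rewrite ler_nat; exact: ltn_expl.
Qed.

Lemma polish_baire : polish R X -> exists pi : baire -> X,
  (forall x, exists a, pi a = x) /\
  forall U a, open U -> U (pi a) ->
    exists m, forall a', agree m a a' -> U (pi a').
Proof.
move=> [[D [cD clD]] [d [d_ge0 [d_eq0 [dC [dT [dO dcomplete]]]]]]].
have d0 x : d x x = 0 by apply/d_eq0.
have [q Hq] := polish_dense dC dT d0 dO cD clD.
(* Entry [a n.+1] names a dense point, accepted only within [h n] of the current one. Every [a] thus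
   yields a Cauchy sequence, and its limit depends continuously on [a]. *)
pose p := fix p (a : baire) n := if n is n'.+1 then
  (if d (q (a n)) (p a n') < h n' then q (a n) else p a n') else q (a 0%N).
have pS a n : d (p a n.+1) (p a n) <= h n.
  by rewrite /=; case: ifPn => [/ltW//|_]; rewrite d0 ltW.
have pk a n k : d (p a (n + k)%N) (p a n) <= (h n + h n) - (h (n + k)%N + h (n + k)%N).
  elim: k => [|k IH]; first by rewrite addn0 d0 subrr.
  rewrite addnS; apply: (le_trans (dT _ (p a (n + k)%N) _)).
  by have := pS a (n + k)%N; have := hS (n + k)%N; lra.
have pn a n m : (n <= m)%N -> d (p a m) (p a n) <= h n + h n.
  by move=> /subnKC <-; have := pk a n (m - n)%N; have := h0 (n + (m - n))%N; lra.
have /choice[pi Hpi] a : exists x, forall e : R, 0 < e ->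
    exists N, forall n, (N <= n)%N -> d (p a n) x < e.
  apply: dcomplete => e e0; have [N hN] : exists N, h N < e / 4 by apply: h_lt; lra.
  exists N => m n Nm Nn; apply: le_lt_trans (dT _ (p a N) _) _.
  by have := pn a N m Nm; have := pn a N n Nn; rewrite (dC (p a N)); lra.
have ppi a n : d (p a n) (pi a) <= h n + h n.
  apply/ler_addgt0Pr => e /(Hpi a)[N HN].
  have := HN (maxn n N) (leq_maxr _ _); have := pn a n (maxn n N) (leq_maxl _ _).
  by have := dT (p a n) (p a (maxn n N)) (pi a); rewrite (dC (p a n) (p a _)); lra.
exists pi; split=> [x|U a oU Ua].
  (* If the [n]-th dense point is within [h n.+2] of [x], successive ones are within [h n] of each
     other and all of them are accepted. *)
  have /choice[a Ha] n : exists k, d (q k) x < h n.+2 by exact: Hq.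
  have pa n : p a n = q (a n).
    elim: n => //= n ->; rewrite ifT//.
    have := dT (q (a n.+1)) x (q (a n)); rewrite (dC x).
    have := Ha n; have := Ha n.+1; have := hS n; have := hS n.+1; have := hS n.+2.
    by have := h0 n.+3; lra.
  exists a; apply/d_eq0/eqP; rewrite eq_le d_ge0 andbT; apply/ler_addgt0Pr => e e0.
  have [n hn] : exists n, h n < e / 4 by apply: h_lt; lra.
  have := dT (pi a) (p a n) x; rewrite (dC (pi a) (p a n)); have := ppi a n; rewrite pa.
  by have := Ha n; have := hS n; have := hS n.+1; have := h0 n.+2; lra.
have [e e0 He] := (dO U).1 oU _ Ua.
have [n hn] : exists n, h n < e / 4 by apply: h_lt; lra.
exists n.+1 => a' aa; apply: He => /=.
have pp k : (k <= n)%N -> p a k = p a' k.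
  elim: k => [_|k IH kn] /=; first by rewrite aa.
  by rewrite aa// IH// ltnW.
have := dT (pi a) (p a n) (pi a'); rewrite (dC (pi a) (p a n)).
by have := ppi a n; have := ppi a' n; rewrite pp//; lra.
Qed.

(** Membership of [pi a] in an open set is forced by a prefix of [a], so both the set and its
    complement come from countably many finitary conditions. *)
Lemma adm_continuous (pi : baire -> X) d (T : measurableType d) phi :
  (forall U a, open U -> U (pi a) -> exists m, forall a', agree m a a' -> U (pi a')) ->
  locally_finitary phi ->
  adm (fun (a : baire) (_ : T) => (pi (phi a) : borel X)).
Proof.
move=> cpi lphi; have H : measurable = <<s @open X >> :> set (set (borel X)) by [].
apply: (@adm_generator _ T _ (borel X) (@open X) _ H) => U oU.
pose S m s := forall a, [seq a i | i <- iota 0 m] = s -> U (pi a).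
have UE a : U (pi a) <-> exists m, S m [seq a i | i <- iota 0 m].
  split=> [Ua|[m]]; last exact.
  have [m Hm] := cpi U a oU Ua; exists m => a' aa; apply: Hm => i im.
  have : nth 0%N [seq a i | i <- iota 0 m] i = nth 0%N [seq a' i | i <- iota 0 m] i by rewrite aa.
  by rewrite !(nth_map 0%N) ?size_iota// nth_iota.
split.
  apply: (@eq_sous _ _ (fun a _ => exists m, S m [seq phi a i | i <- iota 0 m])).
    by move=> a t; rewrite UE.
  by apply: sous_ex => m; exact: prefix_sous.
apply: (@eq_sous _ _ (fun a _ => forall m, ~ S m [seq phi a i | i <- iota 0 m])).
  by move=> a t; rewrite UE; split=> [nS [m]|nS m Sm]; [exact: nS|apply: nS; exists m].
by apply: sous_all => m; apply: (prefix_sous (fun s => ~ S m s)).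
Qed.

Lemma borel_set1 (x : X) : polish R X -> measurable ([set x] : set (borel X)).
Proof.
move=> [_ [d [d_ge0 [d_eq0 [dC [dT [dO _]]]]]]].
rewrite -[X in measurable X]setCK; apply: measurableC.
apply: (@sub_sigma_algebra X setT (@open X) (~` [set x])).
apply/dO => y /= yx; exists (d y x).
  rewrite lt_neqAle d_ge0 andbT eq_sym; apply/eqP => /d_eq0; exact: yx.
by move=> z /=; apply: contraPnot => ->; rewrite ltxx.
Qed.

End baire_surjection.

(** * The game *)

(* Well-founded codes replace the countable ordinals in the rank of the game: every quantification over positions stays at the level of Souslin sets. *)
Inductive code := Base | Step of code | Inter of (nat -> code).

Section pigeonhole.
(** Here [a] lists the rows of an object under construction; [Good c n a] is meant to say that its
    first [n] rows are not refuted by [c], and [E n] is a Souslin condition on these rows with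
    witness [b]. *)
Variables (Good : code -> nat -> (nat -> baire) -> Prop)
  (E : nat -> nat -> (nat -> baire) -> baire -> Prop).

Let agm n (a a' : nat -> baire) := forall i j, (i < n)%N -> (j < n)%N -> a i j = a' i j.

Hypothesis Efin : forall n j, exists m, forall a a' b b',
  agm m a a' -> agree m b b' -> E n j a b -> E n j a' b'.
Hypothesis Edep : forall n j a a' b, (forall i, (i < n)%N -> a i = a' i) ->
  E n j a b -> E n j a' b.
Hypothesis Good0 : forall c, exists a, Good c 0%N a.
Hypothesis GoodS : forall c n a, Good (Step c) n a ->
  exists a', (forall i, (i < n)%N -> a i = a' i) /\ Good c n.+1 a'.
Hypothesis GoodI : forall f n a, Good (Inter f) n a -> forall i, Good (f i) n a.
Hypothesis GoodE : forall c n a, Good c n a -> exists b, forall j, E n j a b.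

Let state := ((nat -> baire) * (nat -> baire))%type.
Let wit c n (s : state) (a b : nat -> baire) :=
  [/\ agm n a s.1, agm n b s.2,
      forall i j, (i <= n)%N -> E i j a (b i) & Good c n a].
(** The extension may depend on the code; only the finitely many entries recorded in [s] are common
    to all codes. *)
Let Inv n s := forall c, exists a b, wit c n s a b.

Let tomat n (a : nat -> baire) := [seq [seq a i j | j <- iota 0 n] | i <- iota 0 n].
Let ofmat (M : seq (seq nat)) : nat -> baire := fun i j => nth 0%N (nth [::] M i) j.

Let tomatK n a : agm n a (ofmat (tomat n a)).
Proof.
move=> i j ni nj; rewrite /ofmat /tomat (nth_map 0%N) ?size_iota// nth_iota//.
by rewrite (nth_map 0%N) ?size_iota// nth_iota.
Qed.

(* If each of the countably many candidate extensions failed for some code, all would fail for the intersection of these codes. *)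
Let Inv_step n s : Inv n s ->
  exists s' : state, [/\ agm n s.1 s'.1, agm n s.2 s'.2 & Inv n.+1 s'].
Proof.
move=> Is; apply: contrapT => H.
pose st (p : nat) : state :=
  if unpickle p is Some (A, B) then (ofmat A, ofmat B) else ((fun=> id), (fun=> id)).
have /choice[c Hc] p : exists c, agm n s.1 (st p).1 -> agm n s.2 (st p).2 ->
    ~ exists a b, wit c n.+1 (st p) a b.
  apply: contrapT => /forallNP Hc; apply: H; exists (st p).
  have {}Hc c : [/\ agm n s.1 (st p).1, agm n s.2 (st p).2 &
      exists a b, wit c n.+1 (st p) a b].
    have := Hc c; rewrite not_implyP => -[? ]; rewrite not_implyP => -[? /contrapT ?].
    by split.
  by have [? ? _] := Hc Base; split => // c'; have [] := Hc c'.
(* [Step] buys the next row, and [Inter c] one extension good for all the codes [c p] at once,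
   including the [p] that codes this very extension. *)
have [a [b [as_ bs Eab]]] := Is (Step (Inter c)).
move=> /GoodS[a' [aa' Ga']]; have [b1 Hb1] := GoodE Ga'.
pose b' i := if i == n.+1 then b1 else b i.
pose p := pickle (tomat n.+1 a', tomat n.+1 b').
have pa : agm n.+1 a' (st p).1 by rewrite /st pickleK; exact: tomatK.
have pb : agm n.+1 b' (st p).2 by rewrite /st pickleK; exact: tomatK.
apply: (Hc p).
- move=> i j ni nj; rewrite -pa ?ltnS 1?ltnW// -aa'// as_//.
- move=> i j ni nj; rewrite -pb ?ltnS 1?ltnW// -bs// /b' ifF//; apply/negbTE; lia.
exists a', b'; split => //; last exact: GoodI.
move=> i j; rewrite leq_eqVlt => /predU1P[->|]; first by rewrite /b' eqxx; exact: Hb1.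
rewrite ltnS => ni; rewrite /b' ifF; last by apply/negbTE; lia.
by apply: Edep (Eab i j ni) => i' i'i; apply: aa'; lia.
Qed.

(* If for each code some [a] is good, one [a] works for all stages at once: build it entrywise, keeping at each step finitely many entries extendable for every code. *)
Lemma code_pigeonhole : exists a, forall n, exists b, forall j, E n j a b.
Proof.
pose z : state := ((fun=> id), (fun=> id)).
have I0 : Inv 0%N z.
  move=> c; have [a Ga] := Good0 c; have [b Hb] := GoodE Ga.
  exists a, (fun=> b); split => // i j; rewrite leqn0 => /eqP ->; exact: Hb.
have /choice[f Hf] : forall ns : nat * state, exists s' : state, Inv ns.1 ns.2 ->
    [/\ agm ns.1 ns.2.1 s'.1, agm ns.1 ns.2.2 s'.2 & Inv ns.1.+1 s'].
  move=> [n s]; have [/Inv_step[s' Hs']|?] := pselect (Inv n s); last by exists z.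
  by exists s'.
pose S := fix S n := if n is n'.+1 then f (n', S n') else z.
have IS n : Inv n (S n).
  by elim: n => //= n IH; have [] := Hf (n, S n) IH.
have aS m n : (m <= n)%N -> agm m (S m).1 (S n).1 /\ agm m (S m).2 (S n).2.
  elim: n => [|n IH]; first by rewrite leqn0 => /eqP ->.
  rewrite leq_eqVlt => /predU1P[->//|]; rewrite ltnS => mn.
  have [/= h1 h2 _] := Hf (n, S n) (IS n); have [h3 h4] := IH mn.
  split=> i j im jm /=; [rewrite h3// h1//|rewrite h4// h2//]; exact: leq_trans mn.
pose A i j := (S (maxn i j).+1).1 i j; pose B i j := (S (maxn i j).+1).2 i j.
have SA N : agm N (S N).1 A.
  move=> i j iN jN; have le : ((maxn i j).+1 <= N)%N by rewrite gtn_max iN.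
  by have [h _] := aS _ _ le; rewrite /A h// ltnS ?leq_maxl ?leq_maxr.
have SB N : agm N (S N).2 B.
  move=> i j iN jN; have le : ((maxn i j).+1 <= N)%N by rewrite gtn_max iN.
  by have [_ h] := aS _ _ le; rewrite /B h// ltnS ?leq_maxl ?leq_maxr.
exists A => n; exists (B n) => j.
have [m Hm] := Efin n j; pose N := maxn m n.+1.
have mN : (m <= N)%N by exact: leq_maxl.
have nN : (n < N)%N by exact: leq_maxr.
have [a [b [as_ bs Eab _]]] := IS N Base.
apply: (Hm a A (b n)) (Eab n j (ltnW nN)).
  by move=> i' j' im jm; rewrite as_ ?SA//; apply: leq_trans mN.
by move=> j' jm; rewrite bs ?SB//; apply: leq_trans mN.
Qed.

End pigeonhole.

Section game.
Context (X : choiceType) (H : set (X -> bool)) (k : nat -> nat).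
Implicit Types (v : seq (X * bool)) (c : code).

Definition consistent v := exists2 h, H h & all (fun z => h z.1 == z.2) v.

(* [Dc c t v] says that the examples [v], shown during the first [t] rounds, are not refuted by [c]; a [v] with [~ Dc (Step c) t v] lets the learner exclude, for any [k t] points, a labeling after which [c] refutes. *)
Fixpoint Dc c t v : Prop :=
  match c with
  | Base => consistent v
  | Step c' => exists2 xs, size xs = k t &
      forall ys, size ys = k t -> Dc c' t.+1 (v ++ zip xs ys)
  | Inter f => forall i, Dc (f i) t v
  end.

Definition labels (bs : seq (seq bool)) :=
  forall i, (i < size bs)%N -> size (nth [::] bs i) = k i.

Definition branch (tr : seq (seq bool) -> seq X) (bs : seq (seq bool)) :=
  flatten [seq zip (tr (take i bs)) (nth [::] bs i) | i <- iota 0 (size bs)].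

(* A Littlestone tree when [k] is constantly 1 and a VCL tree when [k t = t.+1]. *)
Definition inf_tree := exists tr : seq (seq bool) -> seq X,
  forall bs, labels bs -> size (tr bs) = k (size bs) /\ consistent (branch tr bs).

Lemma consistent_cat v w : consistent (v ++ w) -> consistent v.
Proof. by move=> [h Hh]; rewrite all_cat => /andP[]; exists h. Qed.

Lemma Dc_consistent c t v : Dc c t v -> consistent v.
Proof.
elim: c t v => [//|c IH|f IH] t v /=; last by move/(_ 0%N)/IH.
move=> [xs sx /(_ (nseq (k t) true))]; rewrite size_nseq => /(_ erefl) /IH.
exact: consistent_cat.
Qed.

Lemma branch_rcons tr bs y :
  branch tr (rcons bs y) = branch tr bs ++ zip (tr bs) y.
Proof.
rewrite /branch size_rcons -addn1 iotaD map_cat flatten_cat/= add0n cats0.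
rewrite nth_rcons ltnn eqxx -cats1 take_size_cat//; congr (_ ++ _).
congr flatten; apply/eq_in_map => i; rewrite mem_iota add0n => /andP[_ ib].
by rewrite nth_cat ib takel_cat// ltnW.
Qed.

End game.

Lemma eq_branch (X : choiceType) (tr tr' : seq (seq bool) -> seq X) bs :
  (forall cs, (size cs < size bs)%N -> tr cs = tr' cs) ->
  branch tr bs = branch tr' bs.
Proof.
move=> e; rewrite /branch; congr flatten; apply/eq_in_map => i.
rewrite mem_iota add0n => /andP[_ ib]; rewrite e// size_take ib//.
Qed.

Section alist.
Context {d : measure_display} {T : measurableType d}.
Context {dz : measure_display} {Z : measurableType dz}.

Definition alist (l : baire -> T -> seq Z) :=
  (exists n, forall a t, size (l a t) = n) /\
  forall i, adm (fun a t => nth point (l a t) i).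

Lemma alist_cat (l1 l2 : baire -> T -> seq Z) : alist l1 -> alist l2 ->
  alist (fun a t => l1 a t ++ l2 a t).
Proof.
move=> [[n ln] al] [[m lm] al']; split.
  by exists (n + m)%N => a t; rewrite size_cat ln lm.
move=> i; rewrite (_ : (fun _ => _) = (fun a t => if (i < n)%N then nth point (l1 a t) i
    else nth point (l2 a t) (i - n))).
  by case: (i < n)%N.
by apply/funext => a; apply/funext => t; rewrite nth_cat ln.
Qed.

Lemma alist_subst phi (l : baire -> T -> seq Z) : locally_finitary phi ->
  alist l -> alist (fun a => l (phi a)).
Proof.
move=> lphi [[n ln] al]; split; first by exists n => a t.
by move=> i; exact: (adm_subst lphi (al i)).
Qed.

Lemma mlist_alist (l : T -> seq Z) : mlist l -> alist (fun _ => l).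
Proof.
by move=> [[n ln] ml]; split=> [|i]; [exists n => _ t|exact: adm_meas].
Qed.

Lemma alist_nil : alist (fun _ _ => [::]).
Proof.
split=> [|i]; first by exists 0%N.
by apply: adm_meas; under eq_fun do rewrite nth_nil; exact: measurable_cst.
Qed.

End alist.

(** * Souslin complexity of the game *)

Section game_measurability.
Context (R : realType) (X : ptopologicalType) (H : set (X -> bool)) (k : nat -> nat).
Hypotheses (pX : polish R X) (mH : measurable_concept_class R H).
Local Notation Z := (borel X * bool)%type.

(** The parameter of the concept ranges over a continuous image of Baire space, so the existential
    over concepts is a projection; the joint Borel measurability of the parametrization makes the
    rest Souslin. *)
Lemma sous_consistent d (T : measurableType d) (l : baire -> T -> seq Z) :
  alist l -> sous (fun a t => consistent H (l a t)).
Proof.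
have [Th [h [pT [mh ->]]]] := mH.
have [pi [spi cpi]] := polish_baire pT.
move=> [[n ln] al].
pose B (a : baire) t := forall i, (i < n)%N ->
  h (pi (odn a), (nth point (l (evn a) t) i).1) = (nth point (l (evn a) t) i).2.
suff sB : sous B.
  apply: eq_sous (sous_proj sB) => a t; split.
    move=> [c Bc]; exists (fun x => h (pi c, x)); first by exists (pi c).
    apply/(all_nthP point) => i; rewrite ln => /Bc; rewrite odn_mrg evn_mrg => <-.
    by rewrite eqxx.
  move=> [_ [theta _ <-] /(all_nthP point) Hl]; have [c pc] := spi theta.
  exists c => i ni; rewrite odn_mrg evn_mrg pc; apply/eqP; apply: Hl.
  by rewrite ln.
apply: sous_all => i; apply: sous_imp => _.
pose g (w : borel Th * Z) : bool := h (w.1, w.2.1) == w.2.2.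
have mg : measurable_fun setT g.
  apply: (measurable_fun_bool true); rewrite setTI.
  rewrite (_ : _ @^-1` _ = [set w : borel Th * Z | h (w.1, w.2.1) /\ w.2.2] `|`
     [set w : borel Th * Z | ~ h (w.1, w.2.1) /\ ~ w.2.2]); last first.
    apply/seteqP; split=> w /=; rewrite /g; case: (h _); case: w.2.2 => //.
    - by left.
    - by right; split.
    - by move=> [[]|[]].
    - by move=> [[]|[]].
  have mh' : measurable_fun setT (fun w : borel Th * Z => h (w.1, w.2.1)).
    apply: (measurableT_comp mh); apply: measurable_fun_pair => //.
    exact: measurableT_comp.
  have m2 : measurable_fun setT (fun w : borel Th * Z => w.2.2).
    exact: measurableT_comp.
  have mt (f : borel Th * Z -> bool) b : measurable_fun setT f -> measurable [set w | f w = b].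
    by move=> mf; have := mf measurableT [set b]; rewrite setTI; exact.
  apply: measurableU; apply: measurableI.
  - exact: (mt _ true mh').
  - exact: (mt _ true m2).
  - by apply: measurableC; exact: (mt _ true mh').
  - by apply: measurableC; exact: (mt _ true m2).
have aq : adm (fun a t => ((pi (odn a) : borel Th), nth point (l (evn a) t) i)).
  apply: adm_pair; first exact: (adm_continuous T cpi lf_odn).
  exact: (adm_subst lf_evn (al i)).
have mtrue : measurable [set true] by [].
have s := adm_comp mg aq mtrue.
by apply: eq_sous s => a t /=; rewrite /g/=; split=> /eqP.
Qed.

Lemma alist_zip d (T : measurableType d) (pi : baire -> X) (n : nat)
    (ph : nat -> baire -> baire) (ys : seq bool) : size ys = n ->
  (forall U a, open U -> U (pi a) -> exists m, forall a', agree m a a' -> U (pi a')) ->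
  (forall i, locally_finitary (ph i)) ->
  alist (fun (a : baire) (_ : T) => zip [seq pi (ph i a) | i <- iota 0 n] ys : seq Z).
Proof.
move=> sy cpi lph.
have sz a : size (zip [seq pi (ph i a) | i <- iota 0 n] ys) = n.
  by rewrite size_zip size_map size_iota sy minnn.
split=> [|i]; first by exists n => a _; exact: sz.
have [ni|ni] := ltnP i n; last first.
  rewrite (_ : (fun _ => _) = (fun a t => point)); first by apply: adm_meas.
  by apply/funext => a; apply/funext => t; rewrite nth_default ?sz.
rewrite (_ : (fun _ => _) = (fun a t => (pi (ph i a), nth false ys i) : Z)).
  apply: adm_pair; first exact: (adm_continuous T cpi (lph i)).
  by apply: adm_meas; exact: measurable_cst.
apply/funext => a; apply/funext => t.
rewrite (_ : point = (point, false) :> Z)//.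
rewrite nth_zip ?size_map ?size_iota//.
by rewrite (nth_map 0%N) ?size_iota// nth_iota.
Qed.

(** The points shown are projected along Baire space, the labelings are countable and [Inter] is a
    countable intersection: no step leaves the Souslin sets. *)
Lemma sous_Dc c n d (T : measurableType d) (l : baire -> T -> seq Z) :
  alist l -> sous (fun a t => Dc H k c n (l a t)).
Proof.
have [pi [spi cpi]] := polish_baire pX.
elim: c n l => [|c IH|f IH] n l al.
- exact: sous_consistent.
- pose xs (a : baire) := [seq pi (sub (odn a) i) | i <- iota 0 (k n)].
  apply: (@eq_sous _ _ (fun a t => exists b, forall ys : seq bool, size ys = k n ->
      Dc H k c n.+1 (l (evn (mrg a b)) t ++ zip (xs (mrg a b)) ys))).
    move=> a t; split=> [[b Hb]|[ys sy Hys]].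
      exists (xs (mrg a b)); first by rewrite size_map size_iota.
      by move=> ys /Hb; rewrite evn_mrg.
    have /choice[f Hf] x := spi x.
    exists (join (fun i => f (nth point ys i))) => zs /Hys; rewrite evn_mrg.
    rewrite (_ : xs _ = ys)//; apply: (@eq_from_nth _ point).
      by rewrite size_map size_iota sy.
    move=> i; rewrite size_map size_iota => ik.
    by rewrite (nth_map 0%N) ?size_iota// nth_iota// odn_mrg sub_join Hf.
  apply: (@sous_proj _ _ (fun a t => forall ys : seq bool, size ys = k n ->
      Dc H k c n.+1 (l (evn a) t ++ zip (xs a) ys))).
  apply: sous_all_count => ys; apply: sous_imp => sy; apply: IH.
  apply: alist_cat; first exact: (alist_subst lf_evn al).
  apply: (alist_zip T (ph := fun i a => sub (odn a) i)) => // i.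
  exact: lf_comp (lf_sub i) lf_odn.
- by apply: sous_all => i; exact: IH.
Qed.

Lemma nices_Dc c n : nices (R := R) (Z := Z) (Dc H k c n).
Proof.
move=> d T l ml; apply: (@sous_univ_measurable R _ _ (fun _ t => Dc H k c n (l t)) (fun=> 0%N)).
by apply: sous_Dc; exact: mlist_alist.
Qed.

Lemma join_agree m : exists M, forall a a' : nat -> baire,
  (forall i j, (i < M)%N -> (j < M)%N -> a i j = a' i j) -> agree m (join a) (join a').
Proof.
elim: m => [|m [M HM]]; first by exists 0%N.
pose N := if @unpickle (nat * nat)%type m is Some (i, j) then maxn i j else 0%N.
exists (maxn M N.+1) => a a' aa i; rewrite ltnS leq_eqVlt => /predU1P[->|im]; last first.
  by apply: (HM a a') => // i' j' iM jM; apply: aa; rewrite leq_max ?iM ?jM.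
rewrite /join; case E : unpickle => [[i' j']|//]; apply: aa; rewrite leq_max ltnS /N E.
  by rewrite leq_maxl orbT.
by rewrite leq_maxr orbT.
Qed.

(** Row [n] codes the points at all nodes of depth [n] simultaneously. For each code separately,
    unrefuted positions extend by one row; [code_pigeonhole] finds rows that serve all depths. *)
Lemma game_tree : (forall c, Dc H k c 0%N [::]) -> inf_tree H k.
Proof.
move=> root; have [pi [spi cpi]] := polish_baire pX.
pose tr (a : nat -> baire) (bs : seq (seq bool)) :=
  [seq pi (sub (a (size bs)) (pickle (bs, i))) | i <- iota 0 (k (size bs))].
pose good n c a := forall bs, labels k bs -> size bs = n -> Dc H k c n (branch (tr a) bs).
pose B n (a : baire) (_ : bool) := forall bs : seq (seq bool), labels k bs -> size bs = n ->
  consistent H (branch (tr (sub a)) bs).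
have alb bs : labels k bs -> alist (fun a (_ : bool) => branch (tr (sub a)) bs : seq Z).
  elim/last_ind: bs => [_|bs y IH lb]; first exact: alist_nil.
  rewrite (_ : (fun _ => _) = (fun a _ => branch (tr (sub a)) bs ++ zip (tr (sub a) bs) y)).
    apply: alist_cat.
      apply: IH => i ib; have := lb i; rewrite size_rcons nth_rcons ib; apply.
      exact: ltnW.
    apply: (alist_zip bool (ph := fun i a => sub (sub a (size bs)) (pickle (bs, i)))) => //.
      by have := lb (size bs); rewrite size_rcons nth_rcons ltnn eqxx; apply.
    by move=> i; exact: lf_comp (lf_sub _) (lf_sub _).
  by apply/funext => a; apply/funext => t; rewrite branch_rcons.
have /choice[E HE] n : sous (B n).
  apply: sous_all_count => bs; apply: sous_imp => lb; apply: sous_imp => _.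
  exact: (sous_consistent (alb bs lb)).
(* Consistency at depth [n] involves only the rows before [n]; zeroing the others makes this
   dependence literal, as [code_pigeonhole] demands. *)
pose trunc n (a : nat -> baire) i := if (i < n)%N then a i else (fun=> 0%N).
pose EE n j a b := E n j (join (trunc n a)) b true.
have subj n a : sub (join (trunc n a)) = trunc n a.
  by apply/funext => i; rewrite sub_join.
have trE n a bs : size bs = n -> branch (tr (trunc n a)) bs = branch (tr a) bs.
  by move=> <-; apply: eq_branch => cs sc; rewrite /tr /trunc sc.
have [||||||a Ha] := @code_pigeonhole (fun c n => good n c) EE.
- move=> n j; have [/(_ j)[m Hm] _ _] := HE n; have [M HM] := join_agree m.
  exists (maxn m M) => a a' b b' aa bb; rewrite /EE (Hm _ (join (trunc n a')) _ b')//.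
    apply: HM => i j' iM jM; rewrite /trunc; case: ifP => // _; apply: aa.
      by rewrite leq_max iM orbT.
    by rewrite leq_max jM orbT.
  by apply: agree_leq bb; exact: leq_maxl.
- move=> n j a a' b aa; rewrite /EE (_ : trunc n a = trunc n a')//.
  by apply/funext => i; rewrite /trunc; case: ifP => // /aa.
- move=> c; exists (fun=> id) => bs _ /size0nil ->; exact: root.
- move=> c n a ga.
  have /choice[xs Hxs] bs : exists xs, labels k bs -> size bs = n -> size xs = k n /\
      forall ys, size ys = k n -> Dc H k c n.+1 (branch (tr a) bs ++ zip xs ys).
    have [[lb sb]|nb] := pselect (labels k bs /\ size bs = n).
      by have [xs sx Hx] := ga bs lb sb; exists xs.
    by exists [::] => lb sb; case: nb.
  have /choice[f Hf] x := spi x.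
  pose row : baire := join (fun p => if @unpickle (seq (seq bool) * nat)%type p is Some (bs, i)
     then f (nth point (xs bs) i) else id).
  exists (fun i => if (i < n)%N then a i else row); split=> [i ->//|bs lb sb].
  have [cs [y bsE]] : exists cs y, bs = rcons cs y.
    by case/lastP: bs sb {lb} => // cs y _; exists cs, y.
  subst bs; have sc : size cs = n by move: sb; rewrite size_rcons => -[].
  have lc : labels k cs.
    by move=> i ic; have := lb i; rewrite size_rcons nth_rcons ic; apply; exact: ltnW.
  have sy : size y = k n.
    by have := lb (size cs); rewrite size_rcons nth_rcons ltnn eqxx sc; apply.
  rewrite branch_rcons; have [sx Hx] := Hxs cs lc sc.
  rewrite (_ : tr _ cs = xs cs).
    rewrite (@eq_branch _ _ (tr a)); first exact: Hx.
    by move=> cs'; rewrite sc /tr => ->.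
  apply: (@eq_from_nth _ point); first by rewrite size_map size_iota sx sc.
  move=> i; rewrite size_map size_iota => ik.
  rewrite (nth_map 0%N) ?size_iota// nth_iota// sc ltnn /row sub_join pickleK.
  by rewrite Hf.
- by move=> f n a ga i bs lb sb; exact: (ga bs lb sb i).
- move=> c n a ga; have [_ _ HB] := HE n; apply/HB => bs lb sb.
  rewrite subj trE//; exact: Dc_consistent (ga bs lb sb).
exists (tr a) => bs lb; split; first by rewrite size_map size_iota.
have [_ _ HB] := HE (size bs); have := (HB (join (trunc (size bs) a)) true).2.
move=> /(_ (Ha (size bs))) /(_ bs lb erefl).
by rewrite subj trE.
Qed.

End game_measurability.

(** * Playing against i.i.d. examples *)

Lemma ufunP (R : realType) d (T : measurableType d) (f : T -> \bar R) :
  (forall a : R, uset (R := R) [set t | (a%:E < f t)%E]) -> ufun R f.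
Proof.
move=> H; apply: (measurability _ (ErealGenOInfty.measurableE R)).
by move=> _ [_ [a ->] <-]; rewrite setTI preimage_itvoy; exact: H.
Qed.

Lemma uset_table (R : realType) d (T : measurableType d) (I : finType)
    (A : I -> T -> Prop) (S : {set I}) : (forall i, uset (R := R) [set t | A i t]) ->
  uset (R := R) [set t | [set i | `[< A i t >]]%SET = S].
Proof.
move=> mA.
rewrite (_ : mkset _ = [set t | forall i, (if i \in S then A i else ~` A i) t]).
  by apply: uset_all => i; case: ifP => _; [exact: mA|exact: usetC (mA i)].
apply/seteqP; split=> t /=.
  by move=> <- i; rewrite inE; case: asboolP.
move=> H; apply/setP => i; rewrite inE; have := H i.
by case: ifP => _ h; apply/asboolP.
Qed.

Section machine.
Context (R : realType) (X : ptopologicalType) (H : set (X -> bool)) (k : nat -> nat).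
Hypotheses (pX : polish R X) (mH : measurable_concept_class R H).
Local Notation Z := (borel X * bool)%type.
Local Notation Dc := (Dc H k).
Implicit Types (c : code) (v b s : seq (X * bool)).

Definition first_open (f : nat -> code) t v : nat :=
  xget 0%N [set i | ~ Dc (f i) t v /\ forall j, (j < i)%N -> Dc (f j) t v].

(* The code is unfolded down to its first [Step] whose set does not contain [v]. *)
Fixpoint next_code c t v : option code :=
  match c with
  | Base => None
  | Step c' => Some c'
  | Inter f => next_code (f (first_open f t v)) t v
  end.

Lemma first_openP f t v : ~ (forall i, Dc (f i) t v) -> ~ Dc (f (first_open f t v)) t v.
Proof.
move=> /existsNP[i Hi]; rewrite /first_open; case: xgetP => [j _ []//|nP] /= _.
have /ex_minnP[m /asboolP nm mmin] : exists i, `[< ~ Dc (f i) t v >] by exists i; exact/asboolP.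
apply: (nP m); split=> // j jm; apply: contrapT => nj.
by have := mmin j; rewrite asboolT// => /(_ isT); rewrite leqNgt jm.
Qed.

Lemma next_codeP c t v : ~ Dc c t v ->
  if next_code c t v is Some c' then ~ Dc (Step c') t v else ~ consistent H v.
Proof. by elim: c => [//|//|f IH] /= /first_openP /IH. Qed.

(** The successors of an [Inter] are found inside one of its branches, so the structural induction
    must carry the claim for the successors along with the claim for the code. *)
Lemma next_code_ind (S : code -> Prop) :
  (forall c, (forall c' t v, next_code c t v = Some c' -> S c') -> S c) -> forall c, S c.
Proof.
move=> step c; suff [] : S c /\ (forall c' t v, next_code c t v = Some c' -> S c') by [].
elim: c => [|c [IH1 IH2]|f IH].
- by split=> //; apply: step.
- have h c' t v : next_code (Step c) t v = Some c' -> S c' by move=> [<-].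
  by split=> //; apply: step.
- have h c' t v : next_code (Inter f) t v = Some c' -> S c'.
    by have [_] := IH (first_open f t v); exact.
  by split=> //; apply: step.
Qed.

Definition table c t v (xs : seq X) : {set (k t).-tuple bool} :=
  [set y : (k t).-tuple bool | `[< ~ Dc c t.+1 (v ++ zip xs y) >]]%SET.

Definition first_label n (S : {set n.-tuple bool}) : seq bool :=
  if [pick y in S] is Some y then y else nseq n false.

Definition step_pattern c t v xs : seq bool := first_label (table c t v xs).

Definition pattern c t v xs : seq bool :=
  if next_code c t v is Some c' then step_pattern c' t v xs else nseq (k t) false.

Lemma size_first_label n (S : {set n.-tuple bool}) : size (first_label S) = n.
Proof.
by rewrite /first_label; case: pickP => [y _|_]; [rewrite size_tuple|rewrite size_nseq].
Qed.

Lemma size_pattern c t v xs : size (pattern c t v xs) = k t.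
Proof. by rewrite /pattern; case: next_code => [c'|]; rewrite ?size_first_label ?size_nseq. Qed.

Lemma step_patternP c t v xs : ~ Dc (Step c) t v -> size xs = k t ->
  ~ Dc c t.+1 (v ++ zip xs (step_pattern c t v xs)).
Proof.
move=> nD sx; rewrite /step_pattern /first_label; case: pickP => [y|H0].
  by rewrite inE => /asboolP.
exfalso; apply: nD; exists xs => // ys sy; apply: contrapT => nD.
have := H0 (Tuple (introT eqP sy)); rewrite inE; move/asboolP; exact.
Qed.

Definition state := (code * nat * seq (X * bool))%type.
Implicit Type st : state.
Definition lvl st := st.1.2.
Definition state_code st := next_code st.1.1 st.1.2 st.2.
Definition state_pattern st := pattern st.1.1 st.1.2 st.2.

Definition hit st b : bool := unzip2 b == state_pattern st (unzip1 b).

Definition next st b : state :=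
  if state_code st is Some c' then (if hit st b then (c', (lvl st).+1, st.2 ++ b) else st)
  else st.

(** A step consumes its block whether or not the pattern occurs in it, so successive steps see
    independent examples. *)
Fixpoint run j st s : state :=
  if j is j'.+1 then run j' (next st (take (k (lvl st)) s)) (drop (k (lvl st)) s)
  else st.

Section measurability_lemmas.
Context d (T : measurableType d).
Local Notation US := (uset (R := R) (T := T)).
Local Notation ml := (mlist (Z := Z) (T := T)).

Lemma next_code_meas (F : option code -> T -> Prop) c t (l : T -> seq Z) : ml l ->
  (forall o, US [set x | F o x]) -> US [set x | F (next_code c t (l x)) x].
Proof.
move=> mll mF; elim: c => [|c _|f IH] /=; [exact: mF|exact: mF|].
apply: (uset_case (h := fun x => first_open f t (l x))
  (F := fun i => [set x | F (next_code (f i) t (l x)) x])) => // i.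
have mI j : US [set x | Dc (f j) t (l x)] by exact: (nices_Dc _ pX mH _ _ mll).
pose P j := [set x | ~ Dc (f j) t (l x) /\ forall j', (j' < j)%N -> Dc (f j') t (l x)].
have mP j : US (P j).
  apply: (@usetI _ _ _ (~` [set x | Dc (f j) t (l x)])); first exact: usetC (mI j).
  apply: (@uset_all _ _ _ nat (fun j' => [set x | (j' < j)%N -> Dc (f j') t (l x)])) => j'.
  by apply: uset_imp => _; exact: mI.
rewrite (_ : mkset _ = P i `|` ([set _ | i = 0%N] `&` ~` [set x | exists j, P j x])).
  apply: usetU => //; apply: usetI; first exact: uset_cst.
  by apply: usetC; exact: uset_ex.
apply/seteqP; split=> x /=; rewrite /first_open.
  case: xgetP => [j _ Pj <-|nP <-]; first by left.
  by right; split=> // -[j Pj]; exact: (nP j).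
case: xgetP => [j _ [nj Pj] [[ni Pi]|[_]]|nP [Pi|[->]//]].
- have [ij|ji|//] := ltngtP i j; first by have := Pj _ ij.
  by have := Pi _ ji.
- by case; exists j.
- by have := nP i Pi.
Qed.

Lemma uset_and2 (A B : T -> Prop) : US [set x | A x] -> US [set x | B x] ->
  US [set x | A x /\ B x].
Proof. exact: usetI. Qed.

Lemma uset_bool_eq (h : T -> bool) (u : bool) : US [set x | h x] ->
  US [set x | h x = u].
Proof.
case: u => // mh; rewrite (_ : mkset _ = ~` [set x | h x]); first exact: usetC.
by apply/seteqP; split=> x /=; case: (h x).
Qed.

Lemma labels_meas (l : T -> seq Z) (ys : seq bool) : ml l ->
  US [set x | unzip2 (l x) = ys].
Proof.
move=> [[n ln] mll].
rewrite (_ : mkset _ = [set x | size ys = n /\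
    forall i, (nth point (l x) i).2 = nth false ys i]).
  apply: uset_and => _; apply: (@uset_all _ _ _ nat (fun i =>
    [set x | (nth point (l x) i).2 = nth false ys i])) => i.
  apply: measurable_univ.
  have m2 : measurable_fun setT (fun x => (nth point (l x) i).2).
    by apply: measurableT_comp; [exact: measurable_snd|exact: mll].
  by have := m2 measurableT [set nth false ys i]; rewrite setTI; exact.
have nl x i : nth false (unzip2 (l x)) i = (nth point (l x) i).2.
  have [il|il] := ltnP i (size (l x)); first by rewrite (nth_map point).
  by rewrite !nth_default// size_map.
apply/seteqP; split=> x /=.
  by move=> <-; split=> [|i]; [rewrite size_map ln|rewrite nl].
move=> [sy H']; apply: (@eq_from_nth _ false); first by rewrite size_map ln.
by move=> i _; rewrite nl H'.
Qed.

Lemma mlist_relabel (l : T -> seq Z) (ys : seq bool) : ml l ->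
  ml (fun x => zip (unzip1 (l x)) ys).
Proof.
move=> [[n ln] mll]; split.
  by exists (minn n (size ys)) => x; rewrite size_zip size_map ln.
move=> i; have [im|im] := ltnP i (minn n (size ys)).
  have E x : nth point (zip (unzip1 (l x)) ys) i = ((nth point (l x) i).1, nth false ys i).
    rewrite -[point]/((point, false) : X * bool) nth_zip_cond size_zip size_map ln im.
    by rewrite (nth_map point)// ln; apply: leq_trans im (geq_minl _ _).
  under eq_fun do rewrite E.
  apply: measurable_fun_pair; last exact: measurable_cst.
  by apply: measurableT_comp; [exact: measurable_fst|exact: mll].
have E x : nth point (zip (unzip1 (l x)) ys) i = point.
  by rewrite nth_default// size_zip size_map ln.
by under eq_fun do rewrite E; exact: measurable_cst.
Qed.

Lemma step_pattern_meas c t (l b : T -> seq Z) (ys : seq bool) : ml l -> ml b ->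
  US [set x | step_pattern c t (l x) (unzip1 (b x)) = ys].
Proof.
move=> mll mb; rewrite /step_pattern.
apply: (uset_case (h := fun x => table c t (l x) (unzip1 (b x)))
  (F := fun S => [set _ | first_label S = ys])) => S; last exact: uset_cst.
apply: (@uset_table R _ T _ (fun (y : (k t).-tuple bool) x =>
  ~ Dc c t.+1 (l x ++ zip (unzip1 (b x)) y))) => y.
apply: usetC; apply: (nices_Dc _ pX mH); apply: mlist_cat => //.
exact: mlist_relabel.
Qed.

Lemma pattern_meas c t (l b : T -> seq Z) (ys : seq bool) : ml l -> ml b ->
  US [set x | pattern c t (l x) (unzip1 (b x)) = ys].
Proof.
move=> mll mb; rewrite /pattern.
apply: (@next_code_meas (fun o x => (if o is Some c' then step_pattern c' t (l x) (unzip1 (b x))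
  else nseq (k t) false) = ys)) => // -[c'|]; first exact: step_pattern_meas.
exact: uset_cst.
Qed.

Lemma hit_meas c t (l b : T -> seq Z) : ml l -> ml b ->
  US [set x | hit (c, t, l x) (b x)].
Proof.
move=> mll mb.
rewrite (_ : mkset _ = [set x | exists ys : seq bool,
    unzip2 (b x) = ys /\ pattern c t (l x) (unzip1 (b x)) = ys]).
  apply: (uset_ex (F := fun ys : seq bool => [set x | unzip2 (b x) = ys /\
     pattern c t (l x) (unzip1 (b x)) = ys])) => ys.
  by apply: uset_and2; [exact: labels_meas|exact: pattern_meas].
apply/seteqP; split=> x /=; rewrite /hit.
  by move=> /eqP E; exists (unzip2 (b x)).
by move=> [ys [-> <-]]; exact: eqxx.
Qed.

Lemma next_meas (F : state -> T -> Prop) c t (l b : T -> seq Z) :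
  (forall c t l, ml l -> US [set x | F (c, t, l x) x]) -> ml l -> ml b ->
  US [set x | F (next (c, t, l x) (b x)) x].
Proof.
move=> mF mll mb; rewrite /next /state_code/=.
apply: (@next_code_meas (fun o x => F (if o is Some c' then
  (if hit (c, t, l x) (b x) then (c', t.+1, l x ++ b x) else (c, t, l x))
  else (c, t, l x)) x)) => // -[c'|]; last exact: mF.
apply: (uset_case (h := fun x => hit (c, t, l x) (b x))
  (F := fun i : bool => [set x | F (if i then (c', t.+1, l x ++ b x) else (c, t, l x)) x])) => i.
  by apply: uset_bool_eq; exact: hit_meas.
by case: i; apply: mF => //; exact: mlist_cat.
Qed.

End measurability_lemmas.

Lemma run_meas d (T : measurableType d) j (F : state -> T -> Prop) c t (l s : T -> seq Z) :
  (forall c t (l : T -> seq Z), mlist l -> uset (R := R) [set x | F (c, t, l x) x]) ->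
  mlist l -> mlist s -> uset (R := R) [set x | F (run j (c, t, l x) (s x)) x].
Proof.
elim: j c t l s => [|j IH] c t l s mF ml ms /=; first exact: mF.
apply: (@next_meas _ _ (fun st x => F (run j st (drop (k t) (s x))) x) c t l
  (fun x => take (k t) (s x))) => //; last exact: mlist_take.
by move=> c' t' l' ml'; apply: IH => //; exact: mlist_drop.
Qed.

End machine.

Lemma geometric_cvg0 (R : realType) (x a : nat -> R) (q : R) :
  0 <= q < 1 -> (forall j, 0 <= x j <= 1) -> (forall j, x j.+1 <= a j + q * x j) ->
  a @ \oo --> 0 -> x @ \oo --> 0.
Proof.
move=> /andP[q0 q1] x01 xa /cvgrPdist_le a0; apply/cvgrPdist_le => e e0.
have e1 : 0 < e * (1 - q) / 2 by rewrite divr_gt0// mulr_gt0// subr_gt0.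
have [N _ HN] := a0 _ e1.
have xN i : x (N + i)%N <= e / 2 + q ^+ i.
  elim: i => [|i IH]; first by rewrite addn0 expr0; have /andP[_] := x01 N; lra.
  rewrite addnS; apply: le_trans (xa _) _.
  have := HN (N + i)%N (leq_addr _ _); rewrite sub0r normrN => /(le_trans (ler_norm _)) h.
  have qi : q * x (N + i)%N <= q * (e / 2 + q ^+ i) by apply: ler_wpM2l.
  by rewrite exprS; lra.
have /cvgrPdist_le/(_ (e / 2))[|M _ HM] : q ^+ n @[n --> \oo] --> (0 : R).
- by apply: cvg_expr; rewrite ger0_norm.
- by rewrite divr_gt0.
exists (N + M)%N => // n /= NMn; rewrite sub0r normrN ger0_norm; last by have /andP[] := x01 n.
have Nn : (N <= n)%N by lia.
rewrite -(subnKC Nn); apply: le_trans (xN _) _.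
have Mn : (M <= n - N)%N by lia.
have := HM _ Mn; rewrite sub0r normrN ger0_norm ?exprn_ge0//; lra.
Qed.

Section nice_algebra.
Context {R : realType} {dz : measure_display} {Z : measurableType dz}.
Implicit Types F G : seq Z -> \bar R.
Local Open Scope ereal_scope.

Lemma nice_mul F G : nice F -> nice G -> nice (fun s => F s * G s).
Proof. by move=> nF nG d T l ml; apply: ufun_mul; [exact: nF|exact: nG]. Qed.

Lemma nice_add F G : nice F -> nice G -> nice (fun s => F s + G s).
Proof. by move=> nF nG d T l ml; apply: ufun_add; [exact: nF|exact: nG]. Qed.

Lemma nice_cst (c : \bar R) : nice (fun _ : seq Z => c).
Proof. by move=> d T l ml; exact: ufun_cst. Qed.

End nice_algebra.

Section machine_probability.
Context (R : realType) (X : ptopologicalType) (H : set (X -> bool)) (k : nat -> nat).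
Hypotheses (pX : polish R X) (mH : measurable_concept_class R H).
Local Notation Z := (borel X * bool)%type.
Variable P : probability Z R.
Local Notation state := (state X).
Local Notation next := (next H k).
Local Notation hit := (hit H k).
Local Notation state_code := (state_code H k).
Implicit Types (c : code) (v b s : seq (X * bool)) (st : state).
Local Open Scope ereal_scope.

Definition hit_prob st : \bar R := E P (k (lvl st)) (fun b => ind (hit st b)).
(* A state is good when almost surely the excluded pattern never occurs again. *)
Definition bad st : Prop := state_code st <> None /\ 0 < hit_prob st.

Fixpoint bad_prob j st : \bar R :=
  if j is j'.+1 then E P (k (lvl st)) (fun b => bad_prob j' (next st b)) else ind (bad st).

Lemma bad_prob_ge0 j st : 0 <= bad_prob j st.
Proof. by elim: j st => [|j IH] st /=; [exact: ind_ge0|exact: E_ge0]. Qed.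

Lemma bad_prob_le1 j st : bad_prob j st <= 1.
Proof.
elim: j st => [|j IH] st /=; first exact: ind_le1.
by apply: E_le1 => // s; exact: bad_prob_ge0.
Qed.

Lemma hit_prob_ge0 st : 0 <= hit_prob st. Proof. by apply: E_ge0 => s; exact: ind_ge0. Qed.
Lemma hit_prob_le1 st : hit_prob st <= 1.
Proof. by apply: E_le1 => s; [exact: ind_ge0|exact: ind_le1]. Qed.

Lemma hit_prob_ufun d (T : measurableType d) c t (l : T -> seq Z) : mlist l ->
  ufun R (fun x => hit_prob (c, t, l x)).
Proof.
move=> ml; apply: (ufun_E P (k t) (F := fun x b => ind (hit (c, t, l x) b))).
  by move=> *; exact: ind_ge0.
move=> d' T' phi l' mphi ml'.
apply: (@ufun_ind _ _ _ (fun x => hit (c, t, l (phi x)) (l' x))).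
by apply: (hit_meas _ pX mH) => //; exact: mlist_comp.
Qed.

Lemma state_code_meas d (T : measurableType d) c t (l : T -> seq Z) : mlist l ->
  uset (R := R) [set x | state_code (c, t, l x) <> None].
Proof.
move=> ml; apply: (@next_code_meas R X H k pX mH _ T (fun o _ => o <> None)) => // o.
exact: uset_cst.
Qed.

Lemma bad_meas d (T : measurableType d) c t (l : T -> seq Z) : mlist l ->
  uset (R := R) [set x | bad (c, t, l x)].
Proof.
move=> ml; apply: uset_and2; first exact: state_code_meas.
by apply: uset_lt; exact: hit_prob_ufun.
Qed.

Lemma bad_prob_ufun j d (T : measurableType d) c t (l : T -> seq Z) : mlist l ->
  ufun R (fun x => bad_prob j (c, t, l x)).
Proof.
elim: j d T c t l => [|j IH] d T c t l ml /=.
  by apply: (@ufun_ind _ _ _ (fun x => bad (c, t, l x))); exact: bad_meas.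
apply: (ufun_E P (k t) (F := fun x b => bad_prob j (next (c, t, l x) b))).
  by move=> *; exact: bad_prob_ge0.
move=> d' T' phi l' mphi ml'; apply: ufunP => a.
apply: (@next_meas R X H k pX mH _ T' (fun st _ => a%:E < bad_prob j st) c t
  (fun x => l (phi x)) l') => //; last exact: mlist_comp.
by move=> c' t' l'' ml''; apply: uset_lt; exact: IH.
Qed.

Lemma nices_hit st : nices (R := R) (Z := Z) (fun b => hit st b).
Proof.
case: st => -[c t] v d T l ml; apply: (@hit_meas R X H k pX mH _ T c t (fun=> v) l) => //.
by split=> [|i]; [exists (size v)|exact: measurable_cst].
Qed.

Lemma mlist_cst d (T : measurableType d) v : mlist (fun _ : T => (v : seq Z)).
Proof. by split=> [|i]; [exists (size v)|exact: measurable_cst]. Qed.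

Lemma nice_bad_prob_cat j c t v : nice (R := R) (Z := Z) (fun b => bad_prob j (c, t, v ++ b)).
Proof.
move=> d T l ml; apply: (@bad_prob_ufun j _ T c t (fun x => v ++ l x)).
by apply: mlist_cat => //; exact: mlist_cst.
Qed.

Lemma nices_nhit st : nices (R := R) (Z := Z) (fun b => ~ hit st b).
Proof. by move=> d T l ml; apply: usetC; exact: nices_hit. Qed.

Lemma E_nhit st : E P (k (lvl st)) (fun b => ind (~ hit st b)) = 1 - hit_prob st.
Proof.
have fper : hit_prob st \is a fin_num.
  by rewrite ge0_fin_numE ?hit_prob_ge0//; apply: le_lt_trans (hit_prob_le1 st) _; exact: ltry.
suff <- : E P (k (lvl st)) (fun b => ind (~ hit st b)) + hit_prob st = 1 by rewrite addeK.
rewrite -E_add.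
- rewrite -[RHS](@E_cst R _ Z P (k (lvl st)) 1)//; apply: eq_E => s _.
  have [h|h] := pselect (is_true (hit st s)).
    by rewrite (indT h) indF ?add0e.
  by rewrite (indF h) (indT h) adde0.
- by move=> s; exact: ind_ge0.
- by move=> s; exact: ind_ge0.
- exact: nice_ind (nices_nhit st).
- exact: nice_ind (nices_hit st).
Qed.

(* By induction on codes: a state that keeps being bad has a positive hitting probability at every visit, hence moves on to a smaller code with probability tending to 1. *)
Lemma bad_prob_cvg0 c t v : bad_prob j (c, t, v) @[j --> \oo] --> 0.
Proof.
elim/(next_code_ind (H := H) (k := k)) : c t v => c IH t v.
set st := (c, t, v).
case E0 : (state_code st) => [c'|]; last first.
  have D0 j : bad_prob j st = 0.
    elim: j => [|j IHj] /=; first by rewrite indF// => -[]; rewrite E0.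
    rewrite (@eq_E _ _ Z P _ _ (fun=> 0)) ?E_cst// => b _.
    by rewrite /next E0.
  by under eq_fun do rewrite D0; exact: cvg_cst.
have nextE b : next st b = if hit st b then (c', t.+1, v ++ b) else st.
  by rewrite /next E0.
have fDel j st' : bad_prob j st' \is a fin_num.
  by rewrite ge0_fin_numE ?bad_prob_ge0//; apply: le_lt_trans (bad_prob_le1 j st') _; exact: ltry.
pose A j := E P (k t) (fun b => ind (hit st b) * bad_prob j (c', t.+1, v ++ b)).
have A0 j : 0 <= A j.
  by apply: E_ge0 => s; apply: mule_ge0; [exact: ind_ge0|exact: bad_prob_ge0].
have nA j : nice (R := R) (Z := Z) (fun b => ind (hit st b) * bad_prob j (c', t.+1, v ++ b)).
  by apply: nice_mul; [exact: nice_ind (nices_hit st)|exact: nice_bad_prob_cat].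
have A1' j s : ind (hit st s) * bad_prob j (c', t.+1, v ++ s) <= 1.
  rewrite -[leRHS]mule1; apply: lee_pmul; rewrite ?ind_ge0 ?bad_prob_ge0 ?ind_le1 ?bad_prob_le1//.
have A1 j : A j <= 1.
  by apply: E_le1 => s //; apply: mule_ge0; [exact: ind_ge0|exact: bad_prob_ge0].
have fA j : A j \is a fin_num.
  by rewrite ge0_fin_numE//; apply: le_lt_trans (A1 j) _; exact: ltry.
have cvgA : A j @[j --> \oo] --> 0.
  apply: E_cvg0 => // [j s|s].
    by apply: mule_ge0; [exact: ind_ge0|exact: bad_prob_ge0].
  have [h|h] := pselect (is_true (hit st s)).
    under eq_fun do rewrite (indT h) mul1e.
    exact: (IH _ _ _ E0).
  under eq_fun do rewrite (indF h) mul0e.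
  exact: cvg_cst.
(* After one step either the pattern occurred and the code is smaller, where the induction
   hypothesis applies, or the state is unchanged. *)
have DelS j : bad_prob j.+1 st = A j + bad_prob j st * (1 - hit_prob st).
  rewrite [LHS]/= (@eq_E _ _ Z P _ _ (fun b => ind (hit st b) * bad_prob j (c', t.+1, v ++ b) +
     (fine (bad_prob j st))%:E * ind (~ hit st b))); last first.
    move=> b _; have [h|h] := pselect (is_true (hit st b)).
      rewrite (indT h) (_ : ind (~ _) = 0) ?mule0 ?adde0 ?mul1e; last exact: indF.
      by rewrite nextE h.
    rewrite (indF h) (indT h) mul0e add0e mule1 fineK//.
    by rewrite nextE (negbTE (introN idP h)).
  rewrite E_add.
  - congr (_ + _); rewrite E_scale.
    + by rewrite fineK// -E_nhit.
    + by apply: fine_ge0; exact: bad_prob_ge0.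
    + by move=> s; exact: ind_ge0.
    + exact: nice_ind (nices_nhit st).
  - by move=> s; apply: mule_ge0; [exact: ind_ge0|exact: bad_prob_ge0].
  - move=> s; apply: mule_ge0; last exact: ind_ge0.
    by rewrite lee_fin; apply: fine_ge0; exact: bad_prob_ge0.
  - exact: nA.
  - apply: nice_mul; last exact: nice_ind (nices_nhit st).
    exact: nice_cst.
have fper : hit_prob st \is a fin_num.
  by rewrite ge0_fin_numE ?hit_prob_ge0//; apply: le_lt_trans (hit_prob_le1 st) _; exact: ltry.
(* If the pattern has probability zero, the state is good from the start; otherwise the recursion
   contracts by the factor [1 - hit_prob st]. *)
have [p0|p0] := leP (hit_prob st) 0.
  have per0 : hit_prob st = 0 by apply/eqP; rewrite eq_le p0 hit_prob_ge0.
  have AZ j : A j = 0.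
    apply/eqP; rewrite eq_le A0 andbT; apply: le_trans p0; apply: E_le => s.
      by apply: mule_ge0; [exact: ind_ge0|exact: bad_prob_ge0].
    move=> _; rewrite -[leRHS]mule1; apply: lee_wpmul2l; [exact: ind_ge0|exact: bad_prob_le1].
  have D0 j : bad_prob j st = 0.
    elim: j => [|j IHj]; first by rewrite /= indF// => -[_]; rewrite per0 ltxx.
    by rewrite DelS IHj mul0e adde0.
  by under eq_fun do rewrite D0; exact: cvg_cst.
pose x j := fine (bad_prob j st); pose a j := fine (A j).
have xcvg : x @ \oo --> 0%R.
  apply: (@geometric_cvg0 R x a (1 - fine (hit_prob st))).
  - have p1 := hit_prob_le1 st; rewrite -(fineK fper) lee_fin in p1.
    have p2 := p0; rewrite -(fineK fper) lte_fin in p2.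
    by rewrite subr_ge0 p1/= ltrBlDr ltrDl.
  - move=> j; have := bad_prob_ge0 j st; have := bad_prob_le1 j st.
    by rewrite -(fineK (fDel j st)) !lee_fin => -> ->.
  - move=> j; rewrite -lee_fin /x /a fineK// DelS EFinD EFinM EFinB !fineK//.
    by rewrite [X in _ <= _ + X]muleC.
  - by have /fine_cvgP[_] := cvgA.
rewrite (_ : (fun j => bad_prob j st) = (fun j => (x j)%:E)).
  by apply: cvg_EFin => //; exact: nearW.
by apply/funext => j; rewrite /x fineK.
Qed.

End machine_probability.

Section run_properties.
Context (R : realType) (X : ptopologicalType) (H : set (X -> bool)) (k : nat -> nat).
Hypotheses (pX : polish R X) (mH : measurable_concept_class R H).
Local Notation Z := (borel X * bool)%type.
Variable P : probability Z R.
Local Notation Dc := (Dc H k).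
Local Notation state := (state X).
Local Notation next := (next H k).
Local Notation run := (run H k).
Local Notation state_code := (state_code H k).
Local Notation hit_prob := (hit_prob H k P).
Local Notation bad := (bad H k P).
Local Notation bad_prob := (bad_prob H k P).
Implicit Types (c : code) (v b s : seq (X * bool)) (st : state).
Local Open Scope ereal_scope.

Definition valid st := ~ Dc st.1.1 st.1.2 st.2.

Lemma zip_unzip' (s : seq (X * bool)) : zip (unzip1 s) (unzip2 s) = s.
Proof. by elim: s => //= -[x y] s ->. Qed.

Lemma next_valid st b : valid st -> valid (next st b).
Proof.
case: st => -[c t] v vst; rewrite /next.
case E0 : (state_code _) => [c'|//]; case: ifPn => // /eqP hb.
have := next_codeP vst; rewrite -/(state_code (c, t, v)) E0 => nS.
have sb : size (unzip1 b) = k t.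
  have := congr1 size hb; rewrite /state_pattern size_pattern/= => <-.
  by rewrite !size_map.
have := step_patternP nS sb; rewrite /valid/=.
have -> : step_pattern H k c' t v (unzip1 b) = unzip2 b.
  by rewrite hb /state_pattern /pattern/=; move: E0; rewrite /state_code/= => ->.
by rewrite zip_unzip'.
Qed.

Lemma lvl_next st b : (lvl st <= lvl (next st b) <= (lvl st).+1)%N.
Proof.
rewrite /next; case: state_code => [c'|]; last by rewrite leqnn leqnSn.
by case: ifP => _; rewrite /lvl/= leqnn leqnSn.
Qed.

Lemma lvl_run j st s : (lvl (run j st s) <= lvl st + j)%N.
Proof.
elim: j st s => [|j IH] st s /=; first by rewrite addn0.
apply: leq_trans (IH _ _) _; rewrite addnS -addSn leq_add2r.
by have /andP[] := lvl_next st (take (k (lvl st)) s).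
Qed.

Lemma next_sub st b : {subset (next st b).2 <= st.2 ++ b}.
Proof.
move=> z; rewrite /next; case: state_code => [c'|]; last by rewrite mem_cat => ->.
by case: ifP => _ //=; rewrite mem_cat => ->.
Qed.

Lemma run_valid j st s : valid st -> valid (run j st s).
Proof.
by elim: j st s => [//|j IH] st s vst /=; apply: IH; exact: next_valid.
Qed.

Lemma run_sub j st s : {subset (run j st s).2 <= st.2 ++ s}.
Proof.
elim: j st s => [|j IH] st s z /=; first by rewrite mem_cat => ->.
move=> /IH; rewrite mem_cat => /orP[/next_sub|]; rewrite !mem_cat.
  by case/orP => [->//|/mem_take ->]; rewrite orbT.
by move/mem_drop ->; rewrite orbT.
Qed.

(** A code without successor unfolds to [Base], and refuting [Base] means that the examples absorbed
    so far are inconsistent; these all come from the start and the sample. *)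
Lemma run_stuck j st s : valid st -> state_code (run j st s) = None ->
  ~ consistent H (st.2 ++ s).
Proof.
move=> vst E0; have := next_codeP (run_valid (j := j) (s := s) vst).
rewrite -/(state_code (run j st s)) E0; apply: contra_not => -[h Hh /allP hs].
by exists h => //; apply/allP => z /run_sub; exact: hs.
Qed.

Lemma E_run K N j st : (forall t, (t <= lvl st + j)%N -> (k t <= K)%N) ->
  (j * K <= N)%N -> E P N (fun s => ind (bad (run j st s))) = bad_prob j st.
Proof.
elim: j N st => [|j IH] N st kK jN /=; first by rewrite E_cst// ind_ge0.
have kN : (k (lvl st) <= N)%N.
  have := kK (lvl st) (leq_addr _ _); move: jN; rewrite mulSn; lia.
rewrite -(subnKC kN) E_cat; apply: eq_E => b sb.
rewrite -(IH (N - k (lvl st))%N).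
- by apply: eq_E => s _; rewrite take_size_cat// drop_size_cat.
- move=> t tl; apply: kK; apply: leq_trans tl _; rewrite addnS -addSn leq_add2r.
  by have /andP[] := lvl_next st b.
- by have := kK (lvl st) (leq_addr _ _); move: jN; rewrite mulSn; lia.
Qed.

Lemma E_inconsistent_le h n : measurable_fun setT (h : borel X -> bool) ->
  E P n (fun s => ind (~ all (fun z => h z.1 == z.2) s)) <= n%:R%:E * er P h.
Proof.
move=> mh; elim: n => [|n IH] /=; first by rewrite mul0e indF//; apply.
have mA : measurable [set z : Z | h z.1 != z.2].
  have m1 : measurable_fun setT (fun z : Z => h z.1) by exact: measurableT_comp.
  have m2 : measurable_fun setT (fun z : Z => z.2) by exact: measurable_snd.
  have mt (f : Z -> bool) u : measurable_fun setT f -> measurable [set z | f z = u].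
    by move=> mf; have := mf measurableT [set u]; rewrite setTI; apply.
  rewrite (_ : mkset _ = ([set z | h z.1 = true] `&` [set z | z.2 = false]) `|`
     ([set z | h z.1 = false] `&` [set z | z.2 = true])).
    by apply: measurableU; apply: measurableI; apply: (mt _ _) => //.
  apply/seteqP; split=> z /=; case: (h z.1); case: z.2 => //.
  - by left.
  - by right.
  - by case=> -[].
  - by case=> -[].
have c0 : 0 <= E P n (fun s => ind (~ all (fun z => h z.1 == z.2) s)).
  by apply: E_ge0 => s; exact: ind_ge0.
set c := E P n _ in IH c0.
apply: (@le_trans _ _ (\int[hat P]_z (ind (h z.1 != z.2) + c))).
  apply: le_nonmeas_integral => z; first by apply: E_ge0 => s; exact: ind_ge0.
  have [hz|hz] := pselect (is_true (h z.1 != z.2)).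
    rewrite (indT hz); apply: (@le_trans _ _ 1); last by rewrite leeDl.
    by apply: E_le1 => s; [exact: ind_ge0|exact: ind_le1].
  rewrite (indF hz) add0e; apply: E_le => s; first exact: ind_ge0.
  move=> _; apply: le_ind; apply: contra_not => /= ->; rewrite andbT.
  by move/negP: hz; rewrite negbK.
rewrite ge0_integralD//; last 2 first.
- by move=> z _; exact: ind_ge0.
- apply: (@ufun_ind _ _ _ (fun z : Z => h z.1 != z.2)); exact: measurable_univ.
rewrite integral_cst// [X in _ + _ * X](@probability_setT _ (ut R Z) R (hat P)) mule1.
rewrite -natr1 EFinD ge0_muleDl ?lee_fin// mul1e addeC; apply: leeD => //.
rewrite (eq_integral (fun z => (\1_[set z : ut R Z | h z.1 != z.2] z)%:E)).
  by rewrite integral_indic ?setIT//; exact: measurable_univ.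
move=> z _; rewrite indicE; have [hz|hz] := pselect (is_true (h z.1 != z.2)).
  by rewrite (indT hz) mem_set.
by rewrite (indF hz) memNset.
Qed.

(** The infimum in realizability need not be attained: a concept of error below [e / n.+1] disagrees
    with the sample with probability at most [e], for every [e]. *)
Lemma E_inconsistent n : realizable H P -> E P n (fun s => ind (~ consistent H s)) = 0.
Proof.
move=> rP; apply/eqP; rewrite eq_le; apply/andP; split; last first.
  by apply: E_ge0 => s; exact: ind_ge0.
have [Th [hh [pT [mh HE]]]] := mH.
have mhH h : H h -> measurable_fun setT (h : borel X -> bool).
  rewrite HE => -[theta _ <-].
  have mp : measurable_fun setT (fun x : borel X => ((theta : borel Th), x)).
    by apply: measurable_fun_pair => //; exact: measurable_cst.
  exact: (measurableT_comp mh mp).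
apply/lee_addgt0Pr => e e0; rewrite add0e.
have en : (0 < e / n.+1%:R)%R by rewrite divr_gt0.
have [|_ [h Hh <-] he] := @lb_ereal_inf_adherent R [set er P h | h in H] _ en.
  by rewrite rP.
rewrite rP add0e in he.
apply: (@le_trans _ _ (E P n (fun s => ind (~ all (fun z => h z.1 == z.2) s)))).
  apply: E_le => s; first exact: ind_ge0.
  by move=> _; apply: le_ind; apply: contra_not => ?; exists h.
apply: le_trans (E_inconsistent_le n (mhH h Hh)) _.
apply: (@le_trans _ _ (n.+1%:R%:E * (e / n.+1%:R)%:E)).
  apply: lee_pmul; rewrite ?lee_fin ?ler_nat//; last exact: ltW.
  by apply: le_ereal_inf_tmp => _ [B _ <-].
by rewrite -EFinM lee_fin mulrC divfK// pnatr_eq0.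
Qed.

Lemma E_stuck N j st : realizable H P -> valid st -> st.2 = [::] ->
  E P N (fun s => ind (state_code (run j st s) = None)) = 0.
Proof.
move=> rP vst s0; apply/eqP; rewrite eq_le; apply/andP; split; last first.
  by apply: E_ge0 => s; exact: ind_ge0.
rewrite -(E_inconsistent N rP); apply: E_le => s; first exact: ind_ge0.
move=> _; apply: le_ind => /(run_stuck vst); rewrite s0; exact.
Qed.

Definition small (e : R) st : Prop := bad st /\ hit_prob st < e%:E.

Lemma small_meas e d (T : measurableType d) c t (l : T -> seq Z) : mlist l ->
  uset (R := R) [set x | small e (c, t, l x)].
Proof.
move=> ml; apply: uset_and2; first exact: bad_meas.
by apply: uset_gt; exact: hit_prob_ufun.
Qed.

Lemma nices_run (F : state -> Prop) j st :
  (forall d (T : measurableType d) c t (l : T -> seq Z), mlist l ->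
     uset (R := R) [set x | F (c, t, l x)]) ->
  nices (R := R) (Z := Z) (fun s => F (run j st s)).
Proof.
move=> mF d T l ml; case: st => -[c t] v.
apply: (@run_meas R X H k pX mH _ T j (fun st _ => F st) c t (fun=> v) l) => //.
  by move=> c' t' l'; exact: mF.
exact: mlist_cst.
Qed.

(** A bad state has positive hit probability, but with no lower bound uniform in the sample. At a
    fixed time the states bad with hit probability below [1 / j] form events that shrink to nothing,
    and only finitely many times are concerned. *)
Lemma exists_threshold (st : state) (len : nat -> nat) (n : nat) (delta : R) :
  (0 < delta)%R -> exists2 e : R, (0 < e)%R & forall t, (t < n)%N ->
  E P (len t) (fun s => ind (small e (run t st s))) <= delta%:E.
Proof.
move=> d0; elim: n => [|n [e e0 He]]; first by exists 1%R.
have : E P (len n) (fun s => ind (small j.+1%:R^-1 (run n st s))) @[j --> \oo] --> 0.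
  apply: E_cvg0.
  - by move=> j s; exact: ind_ge0.
  - by move=> j s; exact: ind_le1.
  - move=> j; apply: nice_ind; apply: nices_run => d T c t l ml; exact: small_meas.
  - move=> s; have [bs|bs] := pselect (bad (run n st s)); last first.
      rewrite (_ : (fun _ => _) = (fun=> 0)); first exact: cvg_cst.
      by apply/funext => j; rewrite indF// => -[].
    have [_ p0] := bs; have p1 := hit_prob_le1 H k P (run n st s).
    have fp : hit_prob (run n st s) \is a fin_num.
      by rewrite ge0_fin_numE ?(ltW p0)//; apply: le_lt_trans p1 _; exact: ltry.
    apply: (cvg_near_cst); exists (Num.truncn (fine (hit_prob (run n st s)))^-1) => // j /= tj.
    apply/eqP; rewrite indF// => -[_]; rewrite -(fineK fp) lte_fin.
    have fp0 : (0 < fine (hit_prob (run n st s)))%R by rewrite -lte_fin fineK.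
    apply/negP; rewrite -leNgt invf_ple ?posrE//.
    apply: ltW; apply: lt_le_trans (truncnS_gt _) _.
    by rewrite ler_nat ltnS.
move/fine_cvgP => [_ /cvgrPdist_le/(_ _ d0)[J _ /(_ J (leqnn _))]].
rewrite sub0r normrN => /(le_trans (ler_norm _)) hJ.
have fE : E P (len n) (fun s => ind (small J.+1%:R^-1 (run n st s))) \is a fin_num.
  rewrite ge0_fin_numE; last by apply: E_ge0 => s; exact: ind_ge0.
  apply: (@le_lt_trans _ _ 1); last exact: ltry.
  by apply: E_le1 => s; [exact: ind_ge0|exact: ind_le1].
exists (Num.min e J.+1%:R^-1)%R; first by rewrite lt_min e0 invr_gt0/=.
move=> t; rewrite ltnS leq_eqVlt => /predU1P[->|tn].
  apply: (@le_trans _ _ (E P (len n) (fun s => ind (small J.+1%:R^-1 (run n st s))))).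
    apply: E_le => s; first exact: ind_ge0.
    move=> _; apply: le_ind => -[bs pe]; split=> //; apply: lt_le_trans pe _.
    by rewrite lee_fin ge_min lexx orbT.
  by rewrite -(fineK fE) lee_fin.
apply: le_trans (He t tn); apply: E_le => s; first exact: ind_ge0.
move=> _; apply: le_ind => -[bs pe]; split=> //; apply: lt_le_trans pe _.
by rewrite lee_fin ge_min lexx.
Qed.

End run_properties.

(** * The one-inclusion predictor *)

Section marginals.
Context {R : realType} {dz : measure_display} {Z : measurableType dz}.
Variable P : probability Z R.
Local Open Scope ereal_scope.

Lemma E_insert a b (F : seq Z -> \bar R) : (forall s, 0 <= F s) -> nice F ->
  \int[hat P]_z E P (a + b) (fun l => F (take a l ++ z :: drop a l)) = E P (a + b.+1) F.
Proof.
move=> F0 nF; rewrite E_cat.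
transitivity (\int[hat P]_z E P a (fun l1 => E P b (fun l2 => F (l1 ++ z :: l2)))).
  apply: eq_integral => z _; rewrite E_cat; apply: eq_E => l1 s1; apply: eq_E => l2 _.
  by rewrite take_size_cat// drop_size_cat.
rewrite (integral_E_exchange P a (G := fun z l1 => E P b (fun l2 => F (l1 ++ z :: l2)))) //.
  by move=> z l1; exact: E_ge0.
apply: (@nicep_E R _ Z P b _ Z (fun z l1 l2 => F (l1 ++ z :: l2))) => //.
move=> d T phi l l' mphi ml ml'; apply: nF; apply: mlist_cat => //.
exact: mlist_cons.
Qed.

(** The first sample point either is not selected and integrates out, or is put in its place in [J]
    by [E_insert]. Distinctness of the indices is what makes the selection i.i.d. *)
Lemma E_marginal n (J : seq nat) (F : seq Z -> \bar R) :
  uniq J -> all (fun j => (j < n)%N) J -> (forall s, 0 <= F s) -> nice F ->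
  E P n (fun w => F [seq nth point w j | j <- J]) = E P (size J) F.
Proof.
elim: n J F => [|n IH] J F uJ Jn F0 nF; first by case: J Jn uJ.
have [J0|J0] := boolP (0%N \in J); last first.
  pose J' := map predn J.
  have pos j : j \in J -> (0 < j)%N by move=> jJ; rewrite lt0n; apply: contraNneq J0 => <-.
  have JE : J = map succn J'.
    by rewrite -map_comp -[LHS]map_id; apply/eq_in_map => j /pos j0; rewrite /= prednK.
  rewrite [LHS]/= (eq_integral (fun=> E P (size J) F)); last first.
    move=> z _; rewrite [in RHS](_ : size J = size J'); last by rewrite size_map.
    rewrite -IH//.
    - by apply: eq_E => w _; rewrite JE -map_comp.
    - by rewrite (map_inj_in_uniq _)// => i j /pos i0 /pos j0 ij; rewrite -(prednK i0) ij prednK.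
    - apply/allP => _ /mapP[j jJ ->]; have := allP Jn _ jJ; have := pos _ jJ; lia.
  by rewrite integral_cst// [X in _ * X](@probability_setT _ (ut R Z) R (hat P)) mule1.
have [J1 [J2 JE]] : exists J1 J2, J = J1 ++ 0%N :: J2.
  by have /path.splitPr[J1 J2] := J0; exists J1, J2.
move: uJ Jn; rewrite JE -cat1s uniq_catCA/= => /andP[n0 uJ].
rewrite all_cat/= => /andP[a1 a2].
have pos j : j \in J1 ++ J2 -> (0 < j)%N.
  by move=> jJ; rewrite lt0n; apply: contraNneq n0 => <-.
pose J1' := map predn J1; pose J2' := map predn J2.
have E1 : J1 = map succn J1'.
  rewrite -map_comp -[LHS]map_id; apply/eq_in_map => j jJ.
  by rewrite /= prednK// pos// mem_cat jJ.
have E2 : J2 = map succn J2'.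
  rewrite -map_comp -[LHS]map_id; apply/eq_in_map => j jJ.
  by rewrite /= prednK// pos// mem_cat jJ orbT.
have sE : size (J1 ++ 0%N :: J2) = (size J1' + (size J2').+1)%N.
  by rewrite size_cat/= !size_map.
rewrite sE -E_insert//.
suff HH (z : Z) : E P n (fun s => F [seq nth point (z :: s) j | j <- J1 ++ 0%N :: J2]) =
  E P (size J1' + size J2') (fun l => F (take (size J1') l ++ z :: drop (size J1') l)).
  by apply: eq_integral => z _; exact: HH.
pose G (l : seq Z) := F (take (size J1') l ++ z :: drop (size J1') l).
have nG : nice (R := R) (Z := Z) G.
  move=> d T l ml; apply: nF; apply: mlist_cat; first exact: mlist_take.
  by apply: mlist_cons; [exact: measurable_cst|exact: mlist_drop].
rewrite -size_cat -[RHS](IH (J1' ++ J2') G)//.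
- apply: eq_E => w _; rewrite /G [in RHS]map_cat take_size_cat ?size_map//.
  rewrite drop_size_cat ?size_map//; congr F.
  by rewrite map_cat/= E1 E2 -!map_comp.
- rewrite -map_cat (map_inj_in_uniq _)// => i j /pos i0 /pos j0 ij.
  by rewrite -(prednK i0) ij prednK.
- rewrite -map_cat; apply/allP => _ /mapP[j jJ ->].
  have jn : (j < n.+1)%N.
    by move: jJ; rewrite mem_cat => /orP[/(allP a1)|/(allP a2)].
  by have := pos _ jJ; lia.
- by move=> s; exact: F0.
Qed.

Lemma E_perm m (p : 'S_m) (F : seq Z -> \bar R) : (forall s, 0 <= F s) -> nice F ->
  E P m (fun w => F [seq nth point w (p a) | a <- enum 'I_m]) = E P m F.
Proof.
move=> F0 nF; pose J := [seq (p a : nat) | a <- enum 'I_m].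
have sJ : size J = m by rewrite size_map size_enum_ord.
rewrite -[in RHS]sJ -(@E_marginal m J)//.
- by apply: eq_E => w _; rewrite /J -map_comp.
- by rewrite map_inj_uniq ?enum_uniq// => i j /val_inj /perm_inj.
- by apply/allP => _ /mapP[a _ ->]; exact: ltn_ord.
Qed.

End marginals.

Section one_inclusion.
Context (R : realType) (X : ptopologicalType) (H : set (X -> bool)) (k : nat -> nat).
Hypotheses (pX : polish R X) (mH : measurable_concept_class R H).
Local Notation Z := (borel X * bool)%type.
Variable P : probability Z R.
Local Notation state := (state X).
Local Notation hit := (hit H k).
Local Notation state_pattern := (state_pattern H k).
Implicit Types (c : code) (v b s w : seq (X * bool)) (st : state).

Definition subl n m (J : {ffun 'I_n -> 'I_m}) w : seq (X * bool) :=
  [seq nth point w (J a) | a <- enum 'I_n].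

(* The labelings of the sample that realize the forbidden pattern on no tuple of distinct points. *)
Definition avoiding st m w : {set {set 'I_m}} :=
  [set A : {set 'I_m} | [forall J : {ffun 'I_(k (lvl st)) -> 'I_m}, injectiveb J ==>
    (state_pattern st (unzip1 (subl J w)) != [seq (J a \in A) | a <- enum 'I_(k (lvl st))])]]%SET.

Definition positives m w : {set 'I_m} := [set i : 'I_m | (nth point w i).2]%SET.

(* The label written on the new point is irrelevant: only the pattern-avoiding labelings and the labels of the old points matter. *)
Definition oig m st s (x : X) : bool :=
  orient (2 * (k (lvl st)).-1) (avoiding st m.+1 (rcons s (x, false))) ord_max
    (positives m.+1 (rcons s (x, false))).

(** The enumeration of a shattered set of that size is an injective tuple on which some labeling of
    the family realizes the forbidden pattern. *)
Lemma avoiding_shatters st m w (S : {set 'I_m}) : #|S| = k (lvl st) ->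
  ~ shatters (avoiding st m w) S.
Proof.
set n := k (lvl st) => cS sh.
pose J : {ffun 'I_n -> 'I_m} := [ffun a => enum_val (cast_ord (esym cS) a)].
pose u := state_pattern st (unzip1 (subl J w)).
have su : size u = n by rewrite size_pattern.
pose B := [set J a | a in [set a : 'I_n | nth false u a]%SET]%SET.
have Ji : injective J by move=> a a'; rewrite !ffunE => /enum_val_inj/cast_ord_inj.
have [|A] := sh B.
  by apply/fintype.subsetP => _ /imsetP[a _ ->]; rewrite ffunE; exact: enum_valP.
rewrite inE => /forallP/(_ J)/implyP/(_ _)/negP AV AS.
apply: AV; first exact/injectiveP.
apply/eqP; rewrite -/u; apply: (@eq_from_nth _ false).
  by rewrite su size_map size_enum_ord.
rewrite su => i ni; rewrite (nth_map (Ordinal ni)) ?size_enum_ord//.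
rewrite (_ : nth _ (enum 'I_n) i = Ordinal ni); last first.
  by apply: val_inj; rewrite /= nth_enum_ord.
have : (J (Ordinal ni) \in A :&: S) = (J (Ordinal ni) \in B) by rewrite AS.
rewrite inE [X in _ && X](_ : _ = true) ?andbT; last by rewrite ffunE; exact: enum_valP.
move=> ->; apply/idP/imsetP => [ui|[a ain /Ji ea]]; last by move: ain; rewrite inE -ea.
by exists (Ordinal ni); rewrite ?inE.
Qed.

Lemma card_err_avoiding st m w A : (0 < k (lvl st))%N -> A \in avoiding st m w ->
  (#|[set i | err (2 * (k (lvl st)).-1) (avoiding st m w) A i]%SET| <= 2 * (k (lvl st)).-1)%N.
Proof.
move=> k0 AV; apply: card_err => // W WV W0; apply: low_degree => // S cS sh.
apply: (@avoiding_shatters st m w S); first by rewrite cS prednK.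
by move=> B /sh[A' A'W ?]; exists A' => //; exact: (fintype.subsetP WV).
Qed.

Definition permute m (p : 'S_m) w : seq (X * bool) := [seq nth point w (p a) | a <- enum 'I_m].

Lemma nth_permute m (p : 'S_m) w (i : 'I_m) : nth point (permute p w) i = nth point w (p i).
Proof.
rewrite (nth_map i) ?size_enum_ord// (_ : nth _ _ _ = i)//.
by apply: val_inj; rewrite /= nth_enum_ord.
Qed.

Lemma avoiding_permute st m (p : 'S_m) w A :
  (act p A \in avoiding st m (permute p w)) = (A \in avoiding st m w).
Proof.
set n := k (lvl st).
have sublE (J : {ffun 'I_n -> 'I_m}) : subl J (permute p w) = subl [ffun a => p (J a)] w.
  by apply: eq_map => a; rewrite nth_permute ffunE.
have labE (J : {ffun 'I_n -> 'I_m}) : [seq (J a \in act p A) | a <- enum 'I_n] =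
    [seq ([ffun a => p (J a)] a \in A) | a <- enum 'I_n].
  by apply: eq_map => a; rewrite ffunE inE.
rewrite !inE; apply/forallP/forallP => HJ J; apply/implyP => /injectiveP Ji.
  pose J' : {ffun 'I_n -> 'I_m} := [ffun a => perm_inv p (J a)].
  have JE : [ffun a => p (J' a)] = J by apply/ffunP => a; rewrite !ffunE permKV.
  have := HJ J'; rewrite sublE labE JE => /implyP; apply; apply/injectiveP => a a'.
  by rewrite !ffunE => /perm_inj/Ji.
rewrite sublE labE; have /implyP := HJ [ffun a => p (J a)]; apply; apply/injectiveP => a a'.
by rewrite !ffunE => /perm_inj/Ji.
Qed.

Lemma positives_permute m (p : 'S_m) w : positives m (permute p w) = act p (positives m w).
Proof. by apply/setP => i; rewrite !inE nth_permute. Qed.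

Definition errf st m w : bool :=
  (positives m.+1 w \in avoiding st m.+1 w) &&
  err (2 * (k (lvl st)).-1) (avoiding st m.+1 w) (positives m.+1 w) ord_max.

Lemma errf_permute st m (p : 'S_m.+1) w : errf st m (permute p w) =
  (positives m.+1 w \in avoiding st m.+1 w) &&
  err (2 * (k (lvl st)).-1) (avoiding st m.+1 w) (positives m.+1 w) (p ord_max).
Proof.
rewrite /errf positives_permute avoiding_permute; congr (_ && _).
by apply: err_act; exact: avoiding_permute.
Qed.

Lemma oig_err st m s z : size s = m -> oig m st s z.1 != z.2 ->
  positives m.+1 (rcons s z) \notin avoiding st m.+1 (rcons s z) \/ errf st m (rcons s z).
Proof.
move=> sm; set w := rcons s z.
have VE : avoiding st m.+1 (rcons s (z.1, false)) = avoiding st m.+1 w.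
  apply/setP => A; rewrite !inE; apply: eq_forallb => J.
  rewrite (_ : unzip1 (subl J _) = unzip1 (subl J w))// /unzip1 /subl -!map_comp.
  apply: eq_map => a /=; rewrite /w !nth_rcons sm; case: ifP => // _; case: ifP => //.
have pE : positives m.+1 (rcons s (z.1, false)) = positives m.+1 w :\ ord_max.
  apply/setP => i; rewrite !inE /w !nth_rcons sm -(inj_eq val_inj)/=.
  have := ltn_ord i; rewrite ltnS leq_eqVlt => /predU1P[->|im]; first by rewrite ltnn eqxx.
  by rewrite im (ltn_eqF im).
rewrite /oig VE pE orient_setD1 => ne.
have [AV|] := boolP (positives m.+1 w \in avoiding st m.+1 w); [right|by left].
rewrite /errf AV/=; apply: orient_err => //; rewrite inE /w nth_rcons sm ltnn eqxx.
exact: ne.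
Qed.

Section measurability.
Context d (T : measurableType d).
Local Notation US := (uset (R := R) (T := T)).
Local Notation ml := (mlist (Z := Z) (T := T)).

Lemma mlist_subl n m (J : {ffun 'I_n -> 'I_m}) (w : T -> seq Z) : ml w ->
  ml (fun x => subl J (w x)).
Proof.
move=> [_ mw]; split; first by exists n => x; rewrite size_map size_enum_ord.
move=> i; have [ni|ni] := ltnP i n.
  under eq_fun do rewrite (nth_map (Ordinal ni)) ?size_enum_ord//.
  exact: mw.
rewrite (_ : (fun _ => _) = cst point); first exact: measurable_cst.
by apply/funext => x; rewrite nth_default// size_map size_enum_ord.
Qed.

Lemma avoiding_meas c t m (l w : T -> seq Z) S : ml l -> ml w ->
  US [set x | avoiding (c, t, l x) m (w x) = S].
Proof.
move=> mll mw.
pose G (A : {set 'I_m}) x := forall J : {ffun 'I_(k t) -> 'I_m}, injectiveb J ->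
  ~ pattern H k c t (l x) (unzip1 (subl J (w x))) = [seq (J a \in A) | a <- enum 'I_(k t)].
have E0 x : avoiding (c, t, l x) m (w x) = [set A | `[< G A x >]]%SET.
  apply/setP => A; rewrite !inE; apply/forallP/asboolP => [HJ J Ji|HG J].
    by apply/eqP; have /implyP := HJ J; apply.
  by apply/implyP => /HG /eqP.
rewrite (_ : mkset _ = [set x | [set A | `[< G A x >]]%SET = S]).
  apply: (@uset_table R _ T _ G) => A.
  apply: (uset_all (F := fun J : {ffun 'I_(k t) -> 'I_m} => [set x | injectiveb J ->
    ~ pattern H k c t (l x) (unzip1 (subl J (w x))) = [seq (J a \in A) | a <- enum 'I_(k t)]])) => J.
  apply: uset_imp => _; apply: usetC; apply: (@pattern_meas R X H k pX mH _ T c t l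
    (fun x => subl J (w x))) => //; exact: mlist_subl.
by apply/seteqP; split=> x /=; rewrite E0.
Qed.

Lemma positives_meas m (w : T -> seq Z) S : ml w -> US [set x | positives m (w x) = S].
Proof.
move=> [_ mw].
rewrite (_ : mkset _ = [set x | [set i : 'I_m | `[< (nth point (w x) i).2 >]]%SET = S]).
  apply: (@uset_table R _ T _ (fun (i : 'I_m) x => (nth point (w x) i).2)) => i.
  apply: measurable_univ.
  have m2 : measurable_fun setT (fun x => (nth point (w x) i).2).
    by apply: measurableT_comp; [exact: measurable_snd|exact: mw].
  by have := m2 measurableT [set true]; rewrite setTI; apply.
apply/seteqP; split=> x /= <-; apply/setP => i; rewrite !inE; first exact: asboolb.
by rewrite asboolb.
Qed.

Lemma avoiding_positives_meas m c t (F : {set {set 'I_m}} -> {set 'I_m} -> Prop)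
    (l w : T -> seq Z) : ml l -> ml w ->
  US [set x | F (avoiding (c, t, l x) m (w x)) (positives m (w x))].
Proof.
move=> mll mw; apply: (uset_case (h := fun x => avoiding (c, t, l x) m (w x))
  (F := fun V => [set x | F V (positives m (w x))])) => V.
  exact: avoiding_meas.
apply: (uset_case (h := fun x => positives m (w x)) (F := fun A => [set _ | F V A])) => A.
  exact: positives_meas.
exact: uset_cst.
Qed.

Lemma oig_meas m c t (l w : T -> seq Z) (q : T -> Z) : ml l -> ml w ->
  measurable_fun setT q -> US [set x | oig m (c, t, l x) (w x) (q x).1].
Proof.
move=> mll mw mq; apply: (@avoiding_positives_meas m.+1 c t (fun V A =>
  orient (2 * (k t).-1) V ord_max A) l (fun x => rcons (w x) ((q x).1, false))) => //.
apply: mlist_rcons => //; apply: measurable_fun_pair; last exact: measurable_cst.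
exact: measurableT_comp.
Qed.

End measurability.

Local Open Scope ereal_scope.

Lemma nices_errf st m : nices (R := R) (Z := Z) (errf st m).
Proof.
case: st => -[c t] v d T w mw.
apply: (@avoiding_positives_meas _ T m.+1 c t (fun V A => (A \in V) &&
  err (2 * (k t).-1) V A ord_max) (fun=> v) w) => //; exact: mlist_cst.
Qed.

(** Leave-one-out: by exchangeability all [m.+1] positions are charged with equal probability, and
    for any given sample at most [2 * (k (lvl st)).-1] of them are. *)
Lemma E_errf st m : (0 < k (lvl st))%N ->
  E P m.+1 (fun w => ind (errf st m w)) <= (((2 * (k (lvl st)).-1)%N%:R) / m.+1%:R)%:E.
Proof.
move=> k0; set c := (2 * _)%N.
have nF : nice (R := R) (Z := Z) (fun w => ind (errf st m w)) by apply: nice_ind; exact: nices_errf.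
have E0 : 0 <= E P m.+1 (fun w => ind (errf st m w)) by apply: E_ge0 => s; exact: ind_ge0.
have fE : E P m.+1 (fun w => ind (errf st m w)) \is a fin_num.
  rewrite ge0_fin_numE//; apply: (@le_lt_trans _ _ 1); last exact: ltry.
  by apply: E_le1 => s; [exact: ind_ge0|exact: ind_le1].
have : \sum_(i < m.+1) E P m.+1 (fun w => ind (errf st m w)) <= c%:R%:E.
  pose Fi (i : 'I_m.+1) w := ind (errf st m (permute (tperm i ord_max) w)) : \bar R.
  rewrite (eq_bigr (fun i => E P m.+1 (Fi i))); last first.
    by move=> i _; rewrite -(E_perm P (tperm i ord_max))// => s; exact: ind_ge0.
  rewrite -E_sum; last 2 first.
  - by move=> i s; exact: ind_ge0.
  - move=> i d T w mw; apply: (nF _ _ (fun x => permute (tperm i ord_max) (w x))).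
    have [_ mw2] := mw; split; first by exists m.+1 => x; rewrite size_map size_enum_ord.
    move=> j; have [mj|mj] := ltnP j m.+1.
      under eq_fun do rewrite (nth_map (Ordinal mj)) ?size_enum_ord//.
      exact: mw2.
    rewrite (_ : (fun _ => _) = cst point); first exact: measurable_cst.
    by apply/funext => x; rewrite nth_default// size_map size_enum_ord.
  rewrite -[leRHS](@E_cst R _ Z P m.+1)//; apply: E_le => w.
    by apply: sume_ge0 => i _; exact: ind_ge0.
  move=> _; have [AV|AV] := boolP (positives m.+1 w \in avoiding st m.+1 w); last first.
    rewrite big1 => [|i _]; first by rewrite lee_fin.
    by rewrite /Fi indF// errf_permute (negbTE AV).
  rewrite (eq_bigr (fun i : 'I_m.+1 => (err c (avoiding st m.+1 w) (positives m.+1 w) i)%:R%:E)).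
    rewrite sumEFin -natr_sum lee_fin ler_nat; apply: leq_trans (card_err_avoiding k0 AV).
    by rewrite -sum1dep_card [leqRHS]big_mkcond; apply: leq_sum => i _; case: ifP.
  move=> i _; rewrite /Fi errf_permute AV/= tpermR -/c.
  by case: (err _ _ _ _); [rewrite indT|rewrite indF].
move: fE; case: (E P m.+1 _) => //= r _.
rewrite sumEFin sumr_const card_ord !lee_fin => h.
by rewrite ler_pdivlMr // mulr_natr.
Qed.

(** Union bound over the injective index tuples: each selects an i.i.d. block, on which the pattern
    has probability zero. *)
Lemma E_not_avoiding st m : hit_prob H k P st = 0 ->
  E P m (fun w => ind (positives m w \notin avoiding st m w)) = 0.
Proof.
move=> per0; apply/eqP; rewrite eq_le; apply/andP; split; last first.
  by apply: E_ge0 => s; exact: ind_ge0.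
set n := k (lvl st).
pose F (J : {ffun 'I_n -> 'I_m}) w : \bar R :=
  if injectiveb J then ind (hit st (subl J w)) else 0.
have F0 J w : 0 <= F J w by rewrite /F; case: ifP => // _; exact: ind_ge0.
apply: (@le_trans _ _ (E P m (fun w => \sum_J F J w))).
  apply: E_le => w; first exact: ind_ge0.
  move=> sw; have [AV|AV] := pselect (is_true (positives m w \in avoiding st m w)).
    have -> : ind (positives m w \notin avoiding st m w) = 0 :> \bar R.
      by apply: indF; rewrite AV.
    exact: sume_ge0.
  rewrite indT; last exact/negP.
  move/negP: AV; rewrite inE => /forallPn[J]; rewrite negb_imply negbK.
  move=> /andP[Ji /eqP HJ]; rewrite (bigD1 J)//= -[leLHS]adde0; apply: leeD; last exact: sume_ge0.
  rewrite /F Ji indT// /hit HJ /unzip2 /subl -map_comp; apply/eqP; apply: eq_map => a /=.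
  by rewrite inE.
rewrite E_sum//; last first.
  move=> J; rewrite /F; case: (injectiveb J); last exact: nice_cst.
  apply: nice_ind => d T l mll; apply: (@nices_hit R X H k pX mH st _ T (fun x => subl J (l x))).
  exact: mlist_subl.
rewrite big1// => J _; rewrite /F; have [Ji|_] := boolP (injectiveb J); last by rewrite E_cst.
pose Js := [seq (J a : nat) | a <- enum 'I_n].
rewrite (@eq_E _ _ _ P _ _ (fun w => ind (hit st [seq nth point w j | j <- Js]))); last first.
  by move=> w _; rewrite /Js -map_comp.
rewrite (@E_marginal _ _ _ P m Js (fun b => ind (hit st b))).
- by rewrite size_map size_enum_ord.
- rewrite map_inj_uniq ?enum_uniq// => i j /val_inj; exact: (injectiveP _ Ji).
- by apply/allP => _ /mapP[a _ ->]; exact: ltn_ord.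
- by move=> s; exact: ind_ge0.
- by apply: nice_ind; exact: (@nices_hit R X H k pX mH).
Qed.

Theorem oig_error st m : (0 < k (lvl st))%N -> hit_prob H k P st = 0 ->
  E P m.+1 (fun w => ind (oig m st (take m w) (nth point w m).1 != (nth point w m).2)) <=
  (((2 * (k (lvl st)).-1)%N%:R) / m.+1%:R)%:E.
Proof.
move=> k0 per0; apply: le_trans (E_errf m k0).
rewrite -[leRHS]add0e -(E_not_avoiding m.+1 per0) -E_add.
- apply: E_le => w; first exact: ind_ge0.
  move=> sw; have wE : w = rcons (take m w) (nth point w m).
    by rewrite -take_nth ?sw// take_oversize// sw.
  have sm : size (take m w) = m by rewrite size_takel// sw.
  have [ne|ne] := pselect (is_true (oig m st (take m w) (nth point w m).1 != (nth point w m).2)); last first.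
    by rewrite (indF ne) adde_ge0// ind_ge0.
  rewrite (indT ne); have := oig_err sm ne; rewrite -wE => -[h|h].
    by rewrite (indT h) leeDl// ind_ge0.
  by rewrite (indT h) leeDr// ind_ge0.
- by move=> s; exact: ind_ge0.
- by move=> s; exact: ind_ge0.
- apply: nice_ind; case: (st) => -[c t] v d T w mw.
  by apply: (@avoiding_positives_meas _ T m.+1 c t (fun V A => A \notin V) (fun=> v) w) => //; exact: mlist_cst.
- by apply: nice_ind; exact: nices_errf.
Qed.

End one_inclusion.

(** * Voting *)

Lemma uset_bools (R : realType) d (T : measurableType d) (p : nat -> T -> bool)
    (F : seq bool -> Prop) (r : seq nat) : (forall i, uset (R := R) [set x | p i x]) ->
  uset (R := R) [set x | F [seq p i x | i <- r]].
Proof.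
move=> mp; apply: (uset_case (h := fun x => [seq p i x | i <- r])
  (F := fun bs => [set _ | F bs])) => bs; last exact: uset_cst.
elim: r bs => [|i r IH] bs /=; first exact: uset_cst.
case: bs => [|b bs].
  by rewrite (_ : mkset _ = set0); [exact: measurable_univ|apply/seteqP; split].
rewrite (_ : mkset _ = [set x | p i x = b /\ [seq p j x | j <- r] = bs]).
  by apply: uset_and2; [exact: uset_bool_eq|exact: IH].
by apply/seteqP; split=> x /= [-> ->].
Qed.

Section learner.
Context (R : realType) (X : ptopologicalType) (H : set (X -> bool)) (k : nat -> nat).
Hypotheses (pX : polish R X) (mH : measurable_concept_class R H).
Local Notation Z := (borel X * bool)%type.
Local Notation state := (state X).
Local Notation hit := (hit H k).
Local Notation run := (run H k).
Local Notation state_code := (state_code H k).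
Local Notation oig := (oig H k).
Variable st0 : state.
Implicit Types (b s w : seq (X * bool)) (st : state).

(** Enough examples for [t] steps from level 0 when [k] is nondecreasing, since only levels below
    [t] are played. *)
Definition len t := (t * k t)%N.
Definition nblocks N t := (N %/ len t)%N.
Definition block_state s t i : state := run t st0 (take (len t) (drop (i * len t) s)).
Definition fails N st s : bool :=
  has (fun j => hit st (take (k (lvl st)) (drop (j * k (lvl st)) s)))
    (iota 0 (N %/ k (lvl st))).
(* The first batch trains one state per block, the second one rejects the times [t] at which an eighth of the states still see their pattern, the third feeds the one-inclusion predictors. *)
Definition accept N s1 s2 t : bool :=
  (0 < nblocks N t)%N &&
  (8 * count id [seq fails N (block_state s1 t i) s2 | i <- iota 0 (nblocks N t)] < nblocks N t)%N.
Definition select N s1 s2 : nat :=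
  nth 0%N (iota 1 N) (find id [seq accept N s1 s2 t | t <- iota 1 N]).
Definition vote N M s1 s2 s3 x t : bool :=
  (nblocks N t < 2 * count id [seq oig M (block_state s1 t i) s3 x | i <- iota 0 (nblocks N t)])%N.
Definition predict n s x : bool :=
  let N := (n %/ 3)%N in
  let s1 := take N s in let s2 := take N (drop N s) in let s3 := drop (N + N) s in
  vote N (n - (N + N)) s1 s2 s3 x (select N s1 s2).

Section measurability.
Context d (T : measurableType d).
Local Notation US := (uset (R := R) (T := T)).
Local Notation ml := (mlist (Z := Z) (T := T)).

Lemma block_state_meas (F : state -> T -> Prop) (s : T -> seq Z) t i :
  (forall c u (l : T -> seq Z), ml l -> US [set x | F (c, u, l x) x]) -> ml s ->
  US [set x | F (block_state (s x) t i) x].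
Proof.
move=> mF ms; rewrite /block_state; case: st0 => -[c u] v.
apply: (@run_meas R X H k pX mH _ T t F c u (fun=> v)
  (fun x => take (len t) (drop (i * len t) (s x)))) => //.
  exact: mlist_cst.
by apply: mlist_take; exact: mlist_drop.
Qed.

Lemma fails_meas N c u (l s : T -> seq Z) : ml l -> ml s ->
  US [set x | fails N (c, u, l x) (s x)].
Proof.
move=> mll ms; rewrite /fails/=.
rewrite (_ : mkset _ = [set x | has id [seq
    hit (c, u, l x) (take (k u) (drop (j * k u) (s x))) | j <- iota 0 (N %/ k u)]]).
  apply: (@uset_bools R _ T (fun j x => hit (c, u, l x) (take (k u) (drop (j * k u) (s x))))
    (fun bs => has id bs)) => j.
  apply: (@hit_meas R X H k pX mH _ T c u l (fun x => take (k u) (drop (j * k u) (s x)))) => //.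
  by apply: mlist_take; exact: mlist_drop.
by apply/seteqP; split=> x /=; rewrite has_map.
Qed.

Lemma accept_meas N t (s1 s2 : T -> seq Z) : ml s1 -> ml s2 ->
  US [set x | accept N (s1 x) (s2 x) t].
Proof.
move=> m1 m2.
apply: (@uset_bools R _ T (fun i x => fails N (block_state (s1 x) t i) (s2 x)) (fun bs =>
  (0 < nblocks N t)%N && (8 * count id bs < nblocks N t)%N)) => i.
apply: (@block_state_meas (fun st x => fails N st (s2 x))) => // c u l ml'.
exact: fails_meas.
Qed.

Lemma predict_meas n (s : T -> seq Z) (q : T -> Z) : ml s -> measurable_fun setT q ->
  US [set x | predict n (s x) (q x).1].
Proof.
move=> ms mq; rewrite /predict/=; set N := (n %/ 3)%N.
set M := (n - (N + N))%N.
have m1 : ml (fun x => take N (s x)) by exact: mlist_take.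
have m2 : ml (fun x => take N (drop N (s x))) by apply: mlist_take; exact: mlist_drop.
have m3 : ml (fun x => drop (N + N) (s x)) by exact: mlist_drop.
apply: (uset_case (h := fun x => select N (take N (s x)) (take N (drop N (s x))))
  (F := fun t => [set x | vote N M (take N (s x)) (take N (drop N (s x)))
     (drop (N + N) (s x)) (q x).1 t])) => t.
  apply: (@uset_bools R _ T (fun t x => accept N (take N (s x)) (take N (drop N (s x))) t)
    (fun bs => nth 0%N (iota 1 N) (find id bs) = t)) => i.
  exact: accept_meas.
apply: (@uset_bools R _ T (fun i x => oig M (block_state (take N (s x)) t i)
    (drop (N + N) (s x)) (q x).1) (fun bs => (nblocks N t < 2 * count id bs)%N)) => i.
apply: (@block_state_meas (fun st x => oig M st (drop (N + N) (s x)) (q x).1)) => // c u l ml'.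
exact: (@oig_meas R X H k pX mH _ T M c u l (fun x => drop (N + N) (s x)) q).
Qed.

End measurability.

Variable P : probability Z R.
Local Notation hit_prob := (hit_prob H k P).
Local Notation bad := (bad H k P).
Variables (ts : nat) (eps : R).
Local Open Scope ereal_scope.

(** At the target time [ts] every bad state counts; at other times only one whose hit probability is
    below [eps], which the second batch may fail to notice. *)
Definition deficient t st : Prop := bad st /\ (t = ts \/ hit_prob st < eps%:E).
Definition many_deficient N s1 t : Prop :=
  (nblocks N t <= 8 * count id [seq `[< deficient t (block_state s1 t i) >] | i <- iota 0 (nblocks N t)])%N.
Definition missed_fail N st s2 : Prop := eps%:E <= hit_prob st /\ ~ fails N st s2.
Definition stuck st : Prop := state_code st = None.
Definition spurious_fail N st s2 : Prop := hit_prob st = 0 /\ fails N st s2.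
Definition oig_wrong M st s3 z : Prop := hit_prob st = 0 /\ oig M st s3 z.1 != z.2.

Lemma count_split (r : seq nat) (a b c : nat -> bool) :
  (forall i, i \in r -> a i -> b i || c i) ->
  (count a r <= count b r + count c r)%N.
Proof.
elim: r => //= i r IH h; have := h i (mem_head _ _).
have /IH : forall j, j \in r -> a j -> b j || c j.
  by move=> j jr; apply: h; rewrite inE jr orbT.
by case: (a i); case: (b i); case: (c i) => //= ? ; try lia; move/(_ isT).
Qed.

Lemma count_sub (r : seq nat) (a b : nat -> bool) :
  (forall i, i \in r -> a i -> b i) -> (count a r <= count b r)%N.
Proof.
elim: r => //= i r IH h; have := h i (mem_head _ _).
have /IH : forall j, j \in r -> a j -> b j.
  by move=> j jr; apply: h; rewrite inE jr orbT.
by case: (a i); case: (b i) => //= ? ; try lia; move/(_ isT).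
Qed.

Lemma nblocks_gt0 N t : (0 < k t)%N -> (0 < t)%N -> (len t <= N)%N -> (0 < nblocks N t)%N.
Proof. by move=> k0 t0 lN; rewrite divn_gt0// muln_gt0 t0. Qed.

(* Less than an eighth of the states are deficient and less than an eighth fail, so if the majority errs then at least a quarter of the states are good and err. *)
Lemma vote_wrong N M s1 s2 s3 z :
  (forall t, 0 < k t)%N -> (forall t u, (t <= u)%N -> (k t <= k u)%N) ->
  (0 < ts)%N -> (len ts <= N)%N ->
  vote N M s1 s2 s3 z.1 (select N s1 s2) != z.2 ->
  exists2 t, (0 < t <= ts)%N & [\/ many_deficient N s1 t,
    exists2 i, (i < nblocks N t)%N & [\/ missed_fail N (block_state s1 t i) s2, stuck (block_state s1 t i) |
        spurious_fail N (block_state s1 t i) s2] |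
    (nblocks N t <= 4 * count id [seq `[< oig_wrong M (block_state s1 t i) s3 z >] | i <- iota 0 (nblocks N t)])%N].
Proof.
move=> k0 kmono ts0 lN wrong; apply: contrapT => none.
have len_mono t : (t <= ts)%N -> (len t <= len ts)%N by move=> h; rewrite leq_mul// kmono.
have nb0 t : (0 < t <= ts)%N -> (0 < nblocks N t)%N.
  by move=> /andP[t0 th]; apply: nblocks_gt0 => //; apply: leq_trans (len_mono t th) lN.
have ne1 t : (0 < t <= ts)%N -> ~ many_deficient N s1 t.
  by move=> th h; apply: none; exists t => //; constructor 1.
have ne t i : (0 < t <= ts)%N -> (i < nblocks N t)%N ->
    ~ [\/ missed_fail N (block_state s1 t i) s2, stuck (block_state s1 t i) | spurious_fail N (block_state s1 t i) s2].
  by move=> th im h; apply: none; exists t => //; constructor 2; exists i.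
(* At time [ts] a failing state that is neither stuck nor spurious is bad, hence deficient, and
   these are few; so the search stops no later than [ts]. *)
have acc_ts : accept N s1 s2 ts.
  have th : (0 < ts <= ts)%N by rewrite ts0 leqnn.
  rewrite /accept nb0//=; apply: contra_notT (ne1 _ th); rewrite -leqNgt => h.
  apply: leq_trans h _; rewrite leq_mul2l/= !count_map.
  apply: count_sub => i; rewrite mem_iota add0n => /andP[_ im] /= fi.
  apply/asboolP; split; last by left.
  have nei := ne _ _ th im; split; first by move=> h; apply: nei; constructor 2.
  by rewrite lt_neqAle hit_prob_ge0 andbT eq_sym; apply/eqP => p0; apply: nei; constructor 3.
have tsN : (ts <= N)%N by apply: leq_trans lN; rewrite leq_pmulr.
set t := select N s1 s2 in wrong.
have [th acct] : (0 < t <= ts)%N /\ accept N s1 s2 t.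
  have hs : has id [seq accept N s1 s2 t | t <- iota 1 N].
    by apply/hasP; exists (accept N s1 s2 ts) => //; apply: map_f; rewrite mem_iota ts0 add1n ltnS.
  have fN : (find id [seq accept N s1 s2 t | t <- iota 1 N] < N)%N.
    by move: hs; rewrite has_find size_map size_iota.
  have tE : t = (find id [seq accept N s1 s2 t | t <- iota 1 N]).+1.
    by rewrite /t /select nth_iota.
  split; last first.
    by have := nth_find false hs; rewrite (nth_map 0%N) ?size_iota// nth_iota// add1n -tE.
  rewrite tE/= ltnNge; apply/negP => h.
  have := @before_find _ false id [seq accept N s1 s2 t | t <- iota 1 N] ts.-1.
  rewrite prednK// => /(_ h); rewrite (nth_map 0%N) ?size_iota; last by lia.
  by rewrite nth_iota; [rewrite add1n prednK// acc_ts|lia].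
have m0 := nb0 _ th; set m := nblocks N t in m0.
pose notgood i := ~~ `[< hit_prob (block_state s1 t i) = 0 >].
(* A state of nonzero hit probability is bad, as it is not stuck. Below [eps] it is deficient; from
   [eps] on it fails on the second batch. Two eighths make a quarter. *)
have bad_few : (4 * count notgood (iota 0 m) < m)%N.
  have c1 : (8 * count (fun i => `[< deficient t (block_state s1 t i) >]) (iota 0 m) < m)%N.
    by rewrite ltnNge; apply/negP => h; apply: (ne1 _ th); rewrite /many_deficient count_map.
  have c2 : (8 * count (fun i => fails N (block_state s1 t i) s2) (iota 0 m) < m)%N.
    by have := acct; rewrite /accept => /andP[_]; rewrite count_map.
  suff : (count notgood (iota 0 m) <= count (fun i => `[< deficient t (block_state s1 t i) >]) (iota 0 m) +
     count (fun i => fails N (block_state s1 t i) s2) (iota 0 m))%N by lia.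
  apply: count_split => i; rewrite mem_iota add0n => /andP[_ im] /asboolPn pi.
  have nei := ne _ _ th im.
  have bi : bad (block_state s1 t i).
    split; first by move=> h; apply: nei; constructor 2.
    by rewrite lt_neqAle hit_prob_ge0 andbT eq_sym; apply/eqP.
  have [lt_e|le_e] := ltP (hit_prob (block_state s1 t i)) eps%:E.
    by apply/orP; left; apply/asboolP; split=> //; right.
  apply/orP; right; apply: contrapT => nf; apply: nei; constructor 1.
  by split.
pose f i := oig M (block_state s1 t i) s3 z.1.
have cf : (count f (iota 0 m) + count (predC f) (iota 0 m) = m)%N.
  by rewrite count_predC size_iota.
have wr : (m <= 2 * count (fun i => f i != z.2) (iota 0 m))%N.
  have {wrong} : (m < 2 * count f (iota 0 m))%N != z.2 by move: wrong; rewrite /vote count_map.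
  have -> : count (fun i => f i != z.2) (iota 0 m) =
      if z.2 then count (predC f) (iota 0 m) else count f (iota 0 m).
    by case: z.2; apply: eq_count => i /=; case: (f i).
  by case: z.2 => /=; case: ltnP => //; lia.
have c5 : (count (fun i => f i != z.2) (iota 0 m) <=
   count notgood (iota 0 m) + count (fun i => `[< oig_wrong M (block_state s1 t i) s3 z >]) (iota 0 m))%N.
  apply: count_split => i _ wi; rewrite /notgood; case: asboolP => //= p0.
  by apply/asboolP.
have c6 : (m <= 4 * count (fun i => `[< oig_wrong M (block_state s1 t i) s3 z >]) (iota 0 m))%N by lia.
by apply: none; exists t => //; constructor 3; rewrite count_map.
Qed.

End learner.

(** * Probabilities of the failure events *)

Section block_expectation.
Context {R : realType} {dz : measure_display} {Z : measurableType dz}.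
Variable P : probability Z R.
Local Open Scope ereal_scope.

Lemma E_block N l i (F : seq Z -> \bar R) : (i < N %/ l)%N -> (forall s, 0 <= F s) ->
  E P N (fun s => F (take l (drop (i * l) s))) = E P l F.
Proof.
move=> iN F0.
have h : (i * l + l <= N)%N.
  by rewrite addnC -mulSn; apply: leq_trans (leq_divM N l); rewrite leq_mul2r iN orbT.
rewrite -(subnKC h) -addnA (E_drop P (i * l) _ (F := fun s => F (take l s)))//.
by rewrite E_take.
Qed.

(** Independence of the three batches: the first is frozen while the other two are integrated
    out. *)
Lemma E_stages N M (F : seq Z -> seq Z -> seq Z -> \bar R) (c : seq Z -> \bar R) :
  (forall s1 s2 s3, 0 <= F s1 s2 s3) ->
  (forall s1, size s1 = N -> E P N (fun s2 => E P M (F s1 s2)) <= c s1) ->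
  E P (N + (N + M)) (fun w => F (take N w) (take N (drop N w)) (drop (N + N) w)) <= E P N c.
Proof.
move=> F0 Fc; rewrite E_cat; apply: E_le.
  by move=> s1; apply: E_ge0.
move=> s1 z1; apply: le_trans (Fc s1 z1); rewrite E_cat.
apply: E_le; first by move=> s2; apply: E_ge0.
move=> s2 z2; apply: E_le => // s3 _.
rewrite take_size_cat// drop_size_cat// take_size_cat// -drop_drop.
by rewrite drop_size_cat// drop_size_cat.
Qed.

Lemma prod_if_count (r : seq nat) (b : nat -> bool) (c : R) :
  (\prod_(i <- r) (if b i then c else 1) = c ^+ count b r)%R.
Proof.
elim: r => [|i r IH] /=; first by rewrite big_nil expr0.
by rewrite big_cons IH; case: (b i); rewrite ?mul1r// add1n exprS.
Qed.

End block_expectation.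

Section event_probabilities.
Context (R : realType) (X : ptopologicalType) (H : set (X -> bool)) (k : nat -> nat).
Hypotheses (pX : polish R X) (mH : measurable_concept_class R H).
Local Notation Z := (borel X * bool)%type.
Local Notation state := (state X).
Local Notation hit := (hit H k).
Local Notation run := (run H k).
Variable P : probability Z R.
Local Notation hit_prob := (hit_prob H k P).
Variables (st0 : state) (ts : nat) (eps : R).
Local Notation len := (len k).
Local Notation nblocks := (nblocks k).
Local Notation deficient := (deficient H k P ts eps).
Local Notation many_deficient := (many_deficient H k st0 P ts eps).
Local Notation missed_fail := (missed_fail H k P eps).
Local Notation spurious_fail := (spurious_fail H k P).
Hypotheses (k0 : forall t, (0 < k t)%N)
  (kmono : forall t u, (t <= u)%N -> (k t <= k u)%N).
Hypotheses (eps0 : 0 < eps) (eps1 : eps <= 1) (ts0 : (0 < ts)%N).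
Hypotheses (rP : realizable H P) (vst0 : valid H k st0) (st0nil : st0.2 = [::])
  (lvl0 : lvl st0 = 0%N).
Hypothesis deficient_small : forall t, (0 < t <= ts)%N ->
  (E P (len t) (fun s => ind (deficient t (run t st0 s))) <= (510^-1)%:E)%E.
Implicit Types (b s w : seq (X * bool)) (st : state).
Local Open Scope ereal_scope.

Lemma deficient_meas t d (T : measurableType d) c u (l : T -> seq Z) : mlist l ->
  uset (R := R) [set x | deficient t (c, u, l x)].
Proof.
move=> ml; apply: uset_and2; first exact: bad_meas.
apply: (@usetU R _ T [set _ | t = ts] [set x | hit_prob (c, u, l x) < eps%:E]); first exact: uset_cst.
by apply: uset_gt; exact: hit_prob_ufun.
Qed.

(* Chernoff: a deficient block weighs [2 ^ 8], any other one 1; the mean weight is at most 3/2, while the event makes the product at least [2 ^ m]. *)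
Lemma E_many_deficient N t : (0 < t <= ts)%N ->
  E P N (fun s => ind (many_deficient N s t)) <= ((3 / 4) ^+ nblocks N t)%:E.
Proof.
move=> th; set m := nblocks N t.
(* The bound 1/510 on the probability of a deficient block is tuned to this weight:
   [1 + 255 / 510 = 3 / 2], and half of that is the ratio [3 / 4]. *)
have [K KE] : exists K : R, (K + 1 = 2 ^+ 8)%R by exists (2 ^+ 8 - 1)%R; rewrite subrK.
have K255 : (K = 255)%R by move: KE; rewrite -natrX; lra.
have K0 : (0 <= K)%R by rewrite K255.
pose w s : R := (if `[< deficient t (run t st0 s) >] then K + 1 else 1)%R.
have w0 s : (0 <= w s)%R by rewrite /w; case: ifP => // _; rewrite addr_ge0.
have nlow : nices (R := R) (Z := Z) (fun s => deficient t (run t st0 s)).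
  by apply: (@nices_run R X H k pX mH (deficient t)) => d T c u l; exact: deficient_meas.
have wE s : (w s)%:E = 1 + K%:E * ind (deficient t (run t st0 s)) :> \bar R.
  rewrite /w /ind; case: ifP => _; last by rewrite mule0 adde0.
  by rewrite mule1 -EFinD addrC.
have nw : nice (R := R) (Z := Z) (fun s => (w s)%:E).
  move=> d T l ml; under eq_fun do rewrite wE.
  apply: ufun_add; first exact: ufun_cst.
  by apply: ufun_mul; [exact: ufun_cst|exact: (nice_ind nlow)].
have Ew : E P (len t) (fun s => (w s)%:E) <= (3 / 2)%:E.
  under eq_E do rewrite wE.
  rewrite E_add//.
  - rewrite E_cst// E_scale//; last exact: nice_ind.
      apply: (@le_trans _ _ (1 + K%:E * (510^-1)%:E)).
        by apply: leeD => //; apply: lee_wpmul2l => //; exact: deficient_small.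
      by rewrite -EFinM -EFinD lee_fin K255; lra.
    by move=> s; exact: ind_ge0.
  - by move=> s; apply: mule_ge0 => //; exact: ind_ge0.
  - exact: nice_cst.
  - by apply: nice_mul; [exact: nice_cst|exact: nice_ind].
have c0 : (0 <= 3 / 2 :> R)%R by lra.
have := @E_blocks R _ Z P (len t) m (N %% len t) w _ c0 w0 nw Ew.
rewrite -divn_eq => Eb.
have half0 : (0 <= (2^-1) ^+ m :> R)%R by rewrite exprn_ge0.
apply: (@le_trans _ _ (E P N (fun s => ((2^-1) ^+ m)%:E *
    (\prod_(i < m) w (take (len t) (drop (i * len t) s)))%:E))).
  apply: E_le => s; first exact: ind_ge0.
  move=> _; have [h|h] := pselect (many_deficient N s t); last first.
    rewrite (indF h) mule_ge0 ?lee_fin//; by apply: prodr_ge0.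
  rewrite (indT h) -EFinM lee_fin exprVn mulrC ler_pdivlMr ?exprn_gt0// mul1r.
  rewrite -(big_mkord xpredT (fun i => w (take (len t) (drop (i * len t) s)))).
  rewrite /index_iota subn0 /w prod_if_count.
  rewrite KE -exprM; apply: ler_weXn2l; first by lra.
  by move: h; rewrite /many_deficient count_map.
rewrite E_scale//; last 2 first.
- by move=> s; rewrite lee_fin; apply: prodr_ge0.
- move=> d T l ml; apply/measurable_EFinP.
  apply: (@measurable_prod _ (ut R T)) => i _; apply/measurable_EFinP.
  by apply: nw; apply: mlist_take; exact: mlist_drop.
apply: le_trans (lee_wpmul2l _ Eb) _; first by rewrite lee_fin.
by rewrite -EFinM -exprMn lee_fin (_ : (2^-1 * (3 / 2) = 3 / 4)%R)//; lra.
Qed.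

(** Disjoint blocks are independent, and each avoids the pattern with probability at most
    [1 - eps]. *)
Lemma E_missed_fail N st : E P N (fun s => ind (missed_fail N st s)) <= ((1 - eps) ^+ (N %/ k (lvl st)))%:E.
Proof.
set J := (N %/ _)%N.
have q0 : (0 <= 1 - eps)%R by rewrite subr_ge0.
have [pe|pe] := leP eps%:E (hit_prob st); last first.
  rewrite (@eq_E _ _ _ P _ _ (fun=> 0)) ?E_cst ?lee_fin ?exprn_ge0//.
  by move=> s _; rewrite indF// => -[]; rewrite leNgt pe.
pose w s : R := (if hit st s then 0 else 1)%R.
have w0 s : (0 <= w s)%R by rewrite /w; case: ifP.
have wE s : (w s)%:E = ind (~ hit st s) :> \bar R.
  by rewrite /w; case: ifPn => h; [rewrite indF|rewrite indT//; exact/negP].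
have nw : nice (R := R) (Z := Z) (fun s => (w s)%:E).
  move=> d T l ml; under eq_fun do rewrite wE.
  by apply: (nice_ind (@nices_nhit R X H k pX mH st)).
have Ew : E P (k (lvl st)) (fun s => (w s)%:E) <= (1 - eps)%:E.
  under eq_E do rewrite wE.
  by rewrite (@E_nhit R X H k pX mH P st) EFinB; apply: leeB.
have := @E_blocks R _ Z P (k (lvl st)) J (N %% k (lvl st)) w _ q0 w0 nw Ew.
rewrite -divn_eq; apply: le_trans; apply: E_le => s; first exact: ind_ge0.
move=> _; have [[_ nf]|h] := pselect (missed_fail N st s); last first.
  by rewrite (indF h) lee_fin; apply: prodr_ge0.
rewrite (@le_trans _ _ 1)//; first exact: ind_le1.
rewrite big1// => i _; rewrite /w ifF//; apply/negbTE; apply: contra_notN nf => hi.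
by apply/hasP; exists (i : nat) => //; rewrite mem_iota add0n ltn_ord.
Qed.

Lemma nices_hit_block st a : nices (R := R) (Z := Z)
  (fun s => hit st (take (k (lvl st)) (drop a s))).
Proof.
move=> d T l ml.
apply: (@nices_hit R X H k pX mH st _ T (fun x => take (k (lvl st)) (drop a (l x)))).
by apply: mlist_take; exact: mlist_drop.
Qed.

Lemma E_spurious_fail N st : E P N (fun s => ind (spurious_fail N st s)) = 0.
Proof.
apply/eqP; rewrite eq_le; apply/andP; split; last first.
  by apply: E_ge0 => s; exact: ind_ge0.
have [p0|p0] := pselect (hit_prob st = 0); last first.
  rewrite (@eq_E _ _ _ P _ _ (fun=> 0)) ?E_cst//.
  by move=> s _; rewrite indF// => -[].
apply: (@le_trans _ _ (E P N (fun s => \sum_(j <- iota 0 (N %/ k (lvl st)))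
   ind (hit st (take (k (lvl st)) (drop (j * k (lvl st)) s)))))).
  apply: E_le => s; first exact: ind_ge0.
  move=> _; have [[_ /hasP[j jN hj]]|h] := pselect (spurious_fail N st s); last first.
    by rewrite (indF h); apply: sume_ge0 => j _; exact: ind_ge0.
  rewrite (@le_trans _ _ 1)//; first exact: ind_le1.
  rewrite (big_rem j)//= indT// leeDl//; apply: sume_ge0 => i _; exact: ind_ge0.
rewrite E_sum; last 2 first.
- by move=> *; exact: ind_ge0.
- by move=> j; apply: nice_ind; exact: nices_hit_block.
rewrite big_seq big1// => j; rewrite mem_iota add0n => /andP[_ jN].
rewrite (E_block P (F := fun b => ind (hit st b)))// => s; exact: ind_ge0.
Qed.

End event_probabilities.

Lemma iter_leq_sum (R : realType) (I : eqType) (r : seq I) (F : I -> \bar R) (c : R) :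
  (forall i, i \in r -> (F i <= c%:E)%E) ->
  (\sum_(i <- r) F i <= ((size r)%:R * c)%:E)%E.
Proof.
elim: r => [|i r IH] h; first by rewrite big_nil mul0r.
rewrite big_cons (_ : (size (i :: r))%:R * c = c + (size r)%:R * c); last first.
  by rewrite /= -natr1 mulrDl mul1r addrC.
rewrite EFinD; apply: leeD.
  by apply: h; rewrite mem_head.
by apply: IH => j jr; apply: h; rewrite inE jr orbT.
Qed.

Section sums.
Context {R : realType}.
Local Open Scope ereal_scope.

Lemma sum_mem_ge (I : eqType) (r : seq I) (F : I -> \bar R) i :
  (forall j, 0 <= F j) -> i \in r -> F i <= \sum_(j <- r) F j.
Proof. by move=> F0 ir; rewrite (big_rem i)//= leeDl//; apply: sume_ge0. Qed.

Lemma sum_ind (I : Type) (r : seq I) (A : I -> Prop) :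
  \sum_(i <- r) ind (A i) = (count (fun i => `[< A i >]) r)%:R%:E :> \bar R.
Proof.
elim: r => [|i r IH]; first by rewrite big_nil.
by rewrite big_cons IH /= natrD EFinD /ind; case: asboolP.
Qed.

End sums.

Section error_bound.
Context (R : realType) (X : ptopologicalType) (H : set (X -> bool)) (k : nat -> nat).
Hypotheses (pX : polish R X) (mH : measurable_concept_class R H).
Local Notation Z := (borel X * bool)%type.
Local Notation state := (state X).
Local Notation run := (run H k).
Local Notation state_code := (state_code H k).
Local Notation oig := (oig H k).
Variable P : probability Z R.
Local Notation hit_prob := (hit_prob H k P).
Variables (st0 : state) (ts : nat) (eps : R).
Local Notation len := (len k).
Local Notation nblocks := (nblocks k).
Local Notation block_state := (block_state H k st0).
Local Notation deficient := (deficient H k P ts eps).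
Local Notation many_deficient := (many_deficient H k st0 P ts eps).
Local Notation missed_fail := (missed_fail H k P eps).
Local Notation stuck := (stuck H k).
Local Notation spurious_fail := (spurious_fail H k P).
Local Notation oig_wrong := (oig_wrong H k P).
Hypotheses (k0 : forall t, (0 < k t)%N)
  (kmono : forall t u, (t <= u)%N -> (k t <= k u)%N).
Hypotheses (eps0 : 0 < eps) (eps1 : eps <= 1) (ts0 : (0 < ts)%N).
Hypotheses (rP : realizable H P) (vst0 : valid H k st0) (st0nil : st0.2 = [::])
  (lvl0 : lvl st0 = 0%N).
Hypothesis deficient_small : forall t, (0 < t <= ts)%N ->
  (E P (len t) (fun s => ind (deficient t (run t st0 s))) <= (510^-1)%:E)%E.
Variables (N M : nat).
Implicit Types (b s w : seq (X * bool)) (st : state).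
Local Open Scope ereal_scope.

Definition batch1 (w : seq Z) : seq Z := take N w.
Definition batch2 (w : seq Z) : seq Z := take N (drop N w).
Definition batch3 (w : seq Z) : seq Z := drop (N + N) w.

Lemma mlist_batch1 d (T : measurableType d) (l : T -> seq Z) : mlist l -> mlist (batch1 \o l).
Proof. exact: mlist_take. Qed.
Lemma mlist_batch2 d (T : measurableType d) (l : T -> seq Z) : mlist l -> mlist (batch2 \o l).
Proof. by move=> ml; apply: mlist_take; exact: mlist_drop. Qed.
Lemma mlist_batch3 d (T : measurableType d) (l : T -> seq Z) : mlist l -> mlist (batch3 \o l).
Proof. exact: mlist_drop. Qed.

Lemma lvl_block_state s t i : (t <= ts)%N -> (lvl (block_state s t i) <= ts)%N.
Proof. by move=> tts; apply: leq_trans tts; apply: leq_trans (lvl_run _ _ _ _ _) _; rewrite lvl0. Qed.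

Lemma nices_many_deficient t : nices (R := R) (Z := Z) (fun w => many_deficient N (batch1 w) t).
Proof.
move=> d T l ml.
apply: (@uset_bools R _ T (fun i x => `[< deficient t (block_state (batch1 (l x)) t i) >])
  (fun bs => (nblocks N t <= 8 * count id bs)%N)) => i.
rewrite (_ : mkset _ = [set x | deficient t (block_state (batch1 (l x)) t i)]); last first.
  by apply/seteqP; split=> x /= /asboolP.
apply: (@block_state_meas R X H k pX mH st0 _ T (fun st _ => deficient t st)) => [c u l' ml'|].
  exact: deficient_meas.
exact: mlist_batch1.
Qed.

Lemma nices_missed_fail t i : nices (R := R) (Z := Z) (fun w => missed_fail N (block_state (batch1 w) t i) (batch2 w)).
Proof.
move=> d T l ml.
apply: (@block_state_meas R X H k pX mH st0 _ T (fun st x => missed_fail N st (batch2 (l x)))); last exact: mlist_batch1.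
move=> c u l' ml'; apply: uset_and2; last first.
  by apply: usetC; apply: fails_meas => //; exact: mlist_batch2.
rewrite (_ : mkset _ = ~` [set x | hit_prob (c, u, l' x) < eps%:E]); last first.
  by apply/seteqP; split=> x /=; rewrite leNgt => /negP.
by apply: usetC; apply: uset_gt; exact: hit_prob_ufun.
Qed.

Lemma uset_hit_prob0 d (T : measurableType d) c u (l : T -> seq Z) : mlist l ->
  uset (R := R) [set x | hit_prob (c, u, l x) = 0].
Proof.
move=> ml; rewrite (_ : mkset _ = ~` [set x | 0 < hit_prob (c, u, l x)]).
  by apply: usetC; apply: uset_lt; exact: hit_prob_ufun.
apply/seteqP; split=> x /=; first by move=> ->; rewrite ltxx.
by move/negP; rewrite -leNgt => h; apply/eqP; rewrite eq_le h hit_prob_ge0.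
Qed.

Lemma nices_spurious_fail t i : nices (R := R) (Z := Z) (fun w => spurious_fail N (block_state (batch1 w) t i) (batch2 w)).
Proof.
move=> d T l ml.
apply: (@block_state_meas R X H k pX mH st0 _ T (fun st x => spurious_fail N st (batch2 (l x)))); last exact: mlist_batch1.
move=> c u l' ml'; apply: uset_and2; first exact: uset_hit_prob0.
by apply: fails_meas => //; exact: mlist_batch2.
Qed.

Lemma nices_stuck t i : nices (R := R) (Z := Z) (fun w => stuck (block_state (batch1 w) t i)).
Proof.
move=> d T l ml.
apply: (@block_state_meas R X H k pX mH st0 _ T (fun st x => stuck st)); last exact: mlist_batch1.
move=> c u l' ml'; rewrite (_ : mkset _ = ~` [set x | state_code (c, u, l' x) <> None]).
  by apply: usetC; exact: state_code_meas.
by apply/seteqP; split=> x /=; [move=> h; apply|exact: contrapT].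
Qed.

Lemma nices_oig_wrong t i : nices (R := R) (Z := Z)
  (fun w => oig_wrong M (block_state (batch1 w) t i) (take M (batch3 w)) (nth point (batch3 w) M)).
Proof.
move=> d T l ml.
apply: (@block_state_meas R X H k pX mH st0 _ T (fun st x =>
  oig_wrong M st (take M (batch3 (l x))) (nth point (batch3 (l x)) M))); last exact: mlist_batch1.
have m3 := mlist_batch3 ml; have mz : measurable_fun setT (fun x => nth point (batch3 (l x)) M).
  by case: m3 => _; exact.
move=> c u l' ml'; apply: uset_and2; first exact: uset_hit_prob0.
have mo : uset (R := R) [set x | oig M (c, u, l' x) (take M (batch3 (l x))) (nth point (batch3 (l x)) M).1].
  apply: (@oig_meas R X H k pX mH _ T M c u l' (fun x => take M (batch3 (l x)))) => //.
  exact: mlist_take.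
have mz2 : uset (R := R) [set x | (nth point (batch3 (l x)) M).2].
  have m2 : measurable_fun setT (fun x => (nth point (batch3 (l x)) M).2).
    exact: (measurableT_comp measurable_snd mz).
  apply: measurable_univ; rewrite (_ : mkset _ = (fun x => (nth point (batch3 (l x)) M).2) @^-1` [set true]) //.
  by rewrite -[X in measurable X]setTI; apply: m2.
rewrite (_ : mkset _ = [set x |
  (oig M (c, u, l' x) (take M (batch3 (l x))) (nth point (batch3 (l x)) M).1 = true /\
   (nth point (batch3 (l x)) M).2 = false) \/
  (oig M (c, u, l' x) (take M (batch3 (l x))) (nth point (batch3 (l x)) M).1 = false /\
   (nth point (batch3 (l x)) M).2 = true)]).
  by apply: usetU; apply: uset_and2; apply: uset_bool_eq.
apply/seteqP; split=> x /=; case: (oig _ _ _ _); case: (nth _ _ _).2 => //=.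
- by left.
- by right.
- by case=> -[].
- by case=> -[].
Qed.

Lemma E_batch1 (F : seq Z -> \bar R) : (forall s, 0 <= F s) ->
  E P (N + (N + M.+1)) (fun w => F (batch1 w)) = E P N F.
Proof. exact: (@E_take R _ Z P N (N + M.+1)). Qed.

Lemma E_stuck_block t i : (i < nblocks N t)%N ->
  E P N (fun s => ind (stuck (block_state s t i))) = 0.
Proof.
move=> iN; rewrite (E_block P (F := fun b => ind (stuck (run t st0 b))))//.
  exact: (@E_stuck R X H k mH P).
by move=> s; exact: ind_ge0.
Qed.

Lemma E_oig_wrong st : (lvl st <= ts)%N -> E P M.+1 (fun w => ind (oig_wrong M st (take M w) (nth point w M))) <=
  ((2 * (k ts).-1)%N%:R / M.+1%:R)%:E.
Proof.
move=> lts; have [p0|p0] := pselect (hit_prob st = 0); last first.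
  rewrite (@eq_E _ _ _ P _ _ (fun=> 0)) ?E_cst ?lee_fin//.
  by move=> s _; rewrite indF// => -[].
apply: (@le_trans _ _ (((2 * (k (lvl st)).-1)%N%:R / M.+1%:R)%:E)).
  apply: le_trans (oig_error pX mH M (k0 (lvl st)) p0).
  by apply: E_le => s; [exact: ind_ge0|move=> _; apply: le_ind => -[]].
rewrite lee_fin ler_pM2r ?invr_gt0 ?ltr0n// ler_nat leq_mul2l/=.
by have := kmono lts; lia.
Qed.

(** The weight prepares Markov's inequality: if a quarter of the states predict wrongly, the
    weighted indicators add up to at least 1. *)
Definition block_events t i w : \bar R :=
  ind (missed_fail N (block_state (batch1 w) t i) (batch2 w)) + (ind (stuck (block_state (batch1 w) t i)) +
   (ind (spurious_fail N (block_state (batch1 w) t i) (batch2 w)) +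
    (4 / (nblocks N t)%:R)%:E *
      ind (oig_wrong M (block_state (batch1 w) t i) (take M (batch3 w)) (nth point (batch3 w) M)))).

Definition wrong w : Prop :=
  vote H k st0 N M (batch1 w) (batch2 w) (take M (batch3 w)) (nth point (batch3 w) M).1
    (select H k st0 N (batch1 w) (batch2 w)) != (nth point (batch3 w) M).2.

Lemma coef_ge0 t : (0 <= 4 / (nblocks N t)%:R :> R)%R.
Proof. by rewrite divr_ge0. Qed.

Lemma block_events_ge0 t i w : 0 <= block_events t i w.
Proof.
do !apply: adde_ge0; rewrite ?ind_ge0//.
by apply: mule_ge0; [rewrite lee_fin coef_ge0|exact: ind_ge0].
Qed.

Lemma wrong_le w : (len ts <= N)%N -> ind (wrong w) <=
  \sum_(t <- iota 1 ts) (ind (many_deficient N (batch1 w) t) + \sum_(i <- iota 0 (nblocks N t)) block_events t i w).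
Proof.
move=> lN.
have T0 t : 0 <= ind (many_deficient N (batch1 w) t) + \sum_(i <- iota 0 (nblocks N t)) block_events t i w.
  by rewrite adde_ge0 ?ind_ge0//; apply: sume_ge0 => i _; exact: block_events_ge0.
have [h|h] := pselect (wrong w); last by rewrite (indF h) sume_ge0.
rewrite (indT h).
have [t th ht] := @vote_wrong R X H k st0 P ts eps N M (batch1 w) (batch2 w) (take M (batch3 w))
  (nth point (batch3 w) M) k0 kmono ts0 lN h.
apply: (@le_trans _ _ (ind (many_deficient N (batch1 w) t) + \sum_(i <- iota 0 (nblocks N t)) block_events t i w)).
  2: by apply: sum_mem_ge => //; rewrite mem_iota add1n ltnS.
have le_r (x y : \bar R) : 0 <= x -> 1 <= y -> 1 <= x + y.
  by move=> x0 y1; apply: le_trans y1 _; rewrite leeDr.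
have le_l (x y : \bar R) : 1 <= x -> 0 <= y -> 1 <= x + y.
  by move=> x1 y0; apply: le_trans x1 _; rewrite leeDl.
have S0 : 0 <= \sum_(i <- iota 0 (nblocks N t)) block_events t i w.
  by apply: sume_ge0 => i _; exact: block_events_ge0.
have m0 (c : Prop) : 0 <= (4 / (nblocks N t)%:R)%:E * ind c :> \bar R.
  by apply: mule_ge0; [rewrite lee_fin coef_ge0|exact: ind_ge0].
case: ht => [hh|[i im hi]|hm].
- by apply: le_l => //; rewrite indT.
- apply: (le_r); first exact: ind_ge0.
  apply: (@le_trans _ _ (block_events t i w)).
    rewrite /block_events; case: hi => hi.
    + by apply: (le_l); [rewrite indT|rewrite !adde_ge0 ?ind_ge0].
    + by apply: (le_r); [exact: ind_ge0|apply: (le_l); [rewrite indT|rewrite !adde_ge0 ?ind_ge0]].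
    + apply: (le_r); [exact: ind_ge0|apply: (le_r); [exact: ind_ge0|]].
      by apply: (le_l); [rewrite indT|rewrite ?adde_ge0 ?ind_ge0].
  by apply: (@sum_mem_ge _ _ _ (fun i => block_events t i w)) => //;
    [move=> j; exact: block_events_ge0|rewrite mem_iota add0n].
- apply: (le_r); first exact: ind_ge0.
  apply: (@le_trans _ _ (\sum_(i <- iota 0 (nblocks N t)) (4 / (nblocks N t)%:R)%:E *
      ind (oig_wrong M (block_state (batch1 w) t i) (take M (batch3 w)) (nth point (batch3 w) M)))); last first.
    apply: lee_sum => i _; rewrite /block_events.
    by do 3 (rewrite -[leLHS]add0e; apply: leeD; first exact: ind_ge0).
  rewrite -ge0_sume_distrr; last by move=> *; exact: ind_ge0.
  rewrite sum_ind -EFinM lee_fin.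
  have nb0 : (0 < nblocks N t)%N.
    apply: nblocks_gt0 => //; first by case/andP: th.
    by apply: leq_trans lN; case/andP: th => _ tts; rewrite leq_mul// kmono.
  rewrite mulrAC ler_pdivlMr ?ltr0n// mul1r -natrM ler_nat.
  by move: hm; rewrite count_map.
Qed.

Lemma nice_block_events t i : nice (R := R) (Z := Z) (block_events t i).
Proof.
apply: nice_add; first by apply: nice_ind; exact: nices_missed_fail.
apply: nice_add; first by apply: nice_ind; exact: nices_stuck.
apply: nice_add; first by apply: nice_ind; exact: nices_spurious_fail.
apply: nice_mul; first exact: nice_cst.
by apply: nice_ind; exact: nices_oig_wrong.
Qed.

Local Notation W := (N + (N + M.+1))%N.

(** Given the first batch the states are fixed and the other batches are independent of them; stuck
    states and spurious failures have probability zero and drop out. *)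
Lemma E_block_events t i : (t <= ts)%N -> (i < nblocks N t)%N ->
  E P W (block_events t i) <= ((1 - eps) ^+ (N %/ k ts) +
    4 / (nblocks N t)%:R * ((2 * (k ts).-1)%N%:R / M.+1%:R))%:E.
Proof.
move=> tts iN; have q0 : (0 <= 1 - eps)%R by rewrite subr_ge0.
rewrite /block_events E_add; last 4 first.
- by move=> s; exact: ind_ge0.
- by move=> s; rewrite !adde_ge0 ?ind_ge0// mule_ge0 ?lee_fin ?coef_ge0 ?ind_ge0.
- by apply: nice_ind; exact: nices_missed_fail.
- apply: nice_add; first by apply: nice_ind; exact: nices_stuck.
  apply: nice_add; first by apply: nice_ind; exact: nices_spurious_fail.
  apply: nice_mul; first exact: nice_cst.
  by apply: nice_ind; exact: nices_oig_wrong.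
rewrite EFinD; apply: leeD.
  have := @E_stages R _ Z P N M.+1 (fun a b _ => ind (missed_fail N (block_state a t i) b))
    (fun=> ((1 - eps) ^+ (N %/ k ts))%:E).
  rewrite E_cst ?lee_fin ?exprn_ge0//; apply=> [*|a _]; first exact: ind_ge0.
  rewrite (@eq_E _ _ _ P _ _ (fun b => ind (missed_fail N (block_state a t i) b))); last first.
    by move=> b _; rewrite E_cst ?ind_ge0.
  apply: le_trans (E_missed_fail k pX mH P eps1 N _) _.
  rewrite lee_fin; apply: ler_wiXn2l => //; first by rewrite gerBl ltW.
  by apply: leq_div2l => //; apply: kmono; exact: lvl_block_state.
rewrite E_add; last 4 first.
- by move=> s; exact: ind_ge0.
- by move=> s; rewrite !adde_ge0 ?ind_ge0// mule_ge0 ?lee_fin ?coef_ge0 ?ind_ge0.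
- by apply: nice_ind; exact: nices_stuck.
- apply: nice_add; first by apply: nice_ind; exact: nices_spurious_fail.
  apply: nice_mul; first exact: nice_cst.
  by apply: nice_ind; exact: nices_oig_wrong.
rewrite (E_batch1 (F := fun a => ind (stuck (block_state a t i)))); last by move=> s; exact: ind_ge0.
rewrite E_stuck_block// add0e E_add; last 4 first.
- by move=> s; exact: ind_ge0.
- by move=> s; rewrite mule_ge0 ?lee_fin ?coef_ge0 ?ind_ge0.
- by apply: nice_ind; exact: nices_spurious_fail.
- apply: nice_mul; first exact: nice_cst.
  by apply: nice_ind; exact: nices_oig_wrong.
rewrite -[leRHS]add0e; apply: leeD.
  have := @E_stages R _ Z P N M.+1 (fun a b _ => ind (spurious_fail N (block_state a t i) b)) (fun=> 0).
  rewrite E_cst//; apply=> [*|a _]; first exact: ind_ge0.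
  rewrite (@eq_E _ _ _ P _ _ (fun b => ind (spurious_fail N (block_state a t i) b))).
    by rewrite (E_spurious_fail k pX mH).
  by move=> b _; rewrite E_cst ?ind_ge0.
rewrite E_scale ?coef_ge0//; last 2 first.
- by move=> *; exact: ind_ge0.
- by apply: nice_ind; exact: nices_oig_wrong.
rewrite [leRHS]EFinM; apply: lee_wpmul2l; first by rewrite lee_fin coef_ge0.
have := @E_stages R _ Z P N M.+1 (fun a _ c => ind (oig_wrong M (block_state a t i) (take M c) (nth point c M)))
    (fun=> ((2 * (k ts).-1)%N%:R / M.+1%:R)%:E).
rewrite E_cst ?lee_fin//; apply=> [*|a _]; first exact: ind_ge0.
rewrite E_cst; first by apply: E_oig_wrong; exact: lvl_block_state.
by apply: E_ge0 => *; exact: ind_ge0.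
Qed.

(** The weight [4 / nblocks] cancels against the number of blocks, so the one-inclusion term is not
    multiplied by [N]; the exponentially small term is, harmlessly. *)
Lemma E_wrong : (len ts <= N)%N -> E P W (fun w => ind (wrong w)) <=
  (ts%:R * ((3 / 4) ^+ nblocks N ts + N%:R * (1 - eps) ^+ (N %/ k ts) +
    4 * ((2 * (k ts).-1)%N%:R / M.+1%:R)))%:E.
Proof.
move=> lN; have q0 : (0 <= 1 - eps)%R by rewrite subr_ge0.
apply: (@le_trans _ _ (E P W (fun w => \sum_(t <- iota 1 ts)
   (ind (many_deficient N (batch1 w) t) + \sum_(i <- iota 0 (nblocks N t)) block_events t i w)))).
  by apply: E_le => w; [exact: ind_ge0|move=> _; exact: wrong_le].
have nS t : nice (R := R) (Z := Z) (fun w => \sum_(i <- iota 0 (nblocks N t)) block_events t i w).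
  by move=> d T l ml; apply: ufun_sum => i; exact: nice_block_events.
have n1 t : nice (R := R) (Z := Z) (fun w => ind (many_deficient N (batch1 w) t)).
  by apply: nice_ind; exact: nices_many_deficient.
rewrite E_sum; last 2 first.
- by move=> t w; rewrite adde_ge0 ?ind_ge0//; apply: sume_ge0 => i _; exact: block_events_ge0.
- by move=> t; apply: nice_add.
rewrite -[X in (X%:R * _)%R](size_iota 1 ts).
apply: iter_leq_sum => t; rewrite mem_iota add1n ltnS => th.
have tts : (t <= ts)%N by case/andP: th.
have llen : (len t <= len ts)%N by rewrite leq_mul// kmono.
have nb0 : (0 < nblocks N t)%N.
  by apply: nblocks_gt0 => //; [case/andP: th|exact: leq_trans lN].
rewrite E_add//; last 2 first.
- by move=> s; exact: ind_ge0.
- by move=> s; apply: sume_ge0 => i _; exact: block_events_ge0.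
rewrite -addrA EFinD; apply: leeD.
  rewrite (E_batch1 (F := fun a => ind (many_deficient N a t))); last by move=> s; exact: ind_ge0.
  apply: le_trans (E_many_deficient pX mH deficient_small N th) _.
  rewrite lee_fin; apply: ler_wiXn2l; try lra.
  by apply: leq_div2l => //; rewrite muln_gt0 k0 andbT; case/andP: th.
rewrite E_sum; [|by move=> *; exact: block_events_ge0|by move=> *; exact: nice_block_events].
apply: le_trans.
  by apply: iter_leq_sum => i; rewrite mem_iota add0n => iN; exact: E_block_events.
rewrite size_iota lee_fin mulrDr; apply: lerD.
  by rewrite ler_wpM2r ?exprn_ge0// ler_nat leq_div.
have e (a b c : R) : (a != 0 -> a * (b / a * c) = b * c)%R by move=> a0; field.
by rewrite e// pnatr_eq0 -lt0n.
Qed.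

End error_bound.

Lemma uset_bool_neq (R : realType) d (T : measurableType d) (f g : T -> bool) :
  uset (R := R) [set x | f x] -> uset (R := R) [set x | g x] ->
  uset (R := R) [set x | f x != g x].
Proof.
move=> mf mg; rewrite (_ : mkset _ =
    [set x | (f x = true /\ g x = false) \/ (f x = false /\ g x = true)]).
  by apply: usetU; apply: uset_and2; apply: uset_bool_eq.
apply/seteqP; split=> x /=; case: (f x); case: (g x) => //=; [by left|by right|..];
  by case=> -[].
Qed.

(** * The expected error of the learner *)

Section iterated.
Context (R : realType) (X : ptopologicalType).
Local Notation Z := (borel X * bool)%type.
Variable P : probability Z R.
Local Open Scope ereal_scope.

Lemma iexp_ge0 n (f : n.-tuple Z -> \bar R) : (forall t, 0 <= f t) -> 0 <= iexp P f.
Proof. by elim: n f => //= n IH f f0; apply: integral_ge0 => z _; apply: IH. Qed.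

Lemma iexp_le_E n (f : n.-tuple Z -> \bar R) (g : seq Z -> \bar R) :
  (forall t, 0 <= f t) -> (forall s, 0 <= g s) -> (forall t, f t <= g t) -> iexp P f <= E P n g.
Proof.
elim: n f g => [|n IH] f g f0 g0 fg /=; first exact: fg.
apply: (@le_trans _ _ (\int[P]_z E P n (fun s => g (z :: s)))).
  apply: le_nonmeas_integral => z; first exact: iexp_ge0.
  by apply: IH => // t; exact: fg.
by apply: le_integral_hat => z; exact: E_ge0.
Qed.

Lemma er_ge0 h : 0 <= er P h.
Proof. exact: (measure_ge0 (hat P)). Qed.

Lemma er_le1 h : er P h <= 1.
Proof.
rewrite -(@probability_setT _ _ R P).
by apply: ereal_inf_lbound; exists setT.
Qed.

Lemma exp_error_le1 (A : forall n : nat, (n.-tuple Z * borel X)%type -> bool) n :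
  exp_error A P n <= 1.
Proof.
rewrite -[leRHS](@E_cst R _ Z P n)//.
by apply: iexp_le_E => //= t; [exact: er_ge0|exact: er_le1].
Qed.

Lemma er_E h : uset (R := R) [set z : Z | h z.1 != z.2] ->
  er P h = E P 1 (fun w => ind (h (nth point w 0).1 != (nth point w 0).2)).
Proof.
move=> mh /=; rewrite (_ : er P h = hat P [set z : ut R Z | h z.1 != z.2])//.
rewrite -(setIT (mkset _)) -(@integral_indic _ (ut R Z) R (hat P) _ measurableT)//.
apply: eq_integral => z _; rewrite indicE; have [hz|hz] := pselect (is_true (h z.1 != z.2)).
  by rewrite mem_set// indT.
by rewrite memNset// indF.
Qed.

(** The test point is appended to the sample, which makes the error one expectation over [n.+1]
    examples; the inequality absorbs the passage from [P] to its completion. *)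
Lemma exp_error_le_E (A : forall n : nat, (n.-tuple Z * borel X)%type -> bool) n
    (p : seq Z -> X -> bool) :
  (forall (t : n.-tuple Z) x, A n (t, x) = p t x) ->
  (forall s, uset (R := R) [set z : Z | p s z.1 != z.2]) ->
  exp_error A P n <= E P n.+1 (fun w => ind (p (take n w) (nth point w n).1 != (nth point w n).2)).
Proof.
move=> Ap mp; rewrite -addn1 E_cat.
apply: (@le_trans _ _ (E P n (fun s => er P (p s)))).
  apply: iexp_le_E => [t|s|t]; [exact: er_ge0..|].
  by rewrite le_eqVlt (_ : (fun x => A n (t, x)) = p t) ?eqxx//; apply/funext.
apply: E_le => [s|s ss]; first exact: er_ge0.
rewrite er_E//; apply: E_le => [w|w sw]; first exact: ind_ge0.
by rewrite take_size_cat// nth_cat ss ltnn subnn.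
Qed.

End iterated.

Section learner_bound.
Context (R : realType) (X : ptopologicalType) (H : set (X -> bool)) (k : nat -> nat).
Hypotheses (pX : polish R X) (mH : measurable_concept_class R H).
Local Notation Z := (borel X * bool)%type.
Variable st0 : state X.
Hypotheses (k0 : forall t, (0 < k t)%N)
  (kmono : forall t u, (t <= u)%N -> (k t <= k u)%N).
Hypotheses (vst0 : valid H k st0) (st0nil : st0.2 = [::]) (lvl0 : lvl st0 = 0%N).
Local Open Scope ereal_scope.

Definition learner n (sx : (n.-tuple Z * borel X)%type) : bool :=
  predict H k st0 n sx.1 sx.2.

Lemma learner_algorithm : learning_algorithm R learner.
Proof.
move=> n; rewrite /univ_measurable_fun => B _.
suff m1 : univ_measurable_set R [set sx | learner (n := n) sx].
  have m2 : univ_measurable_set R [set sx | ~~ learner (n := n) sx].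
    rewrite (_ : mkset _ = ~` [set sx | learner (n := n) sx]); first exact: univ_measurableC.
    by apply/seteqP; split=> x /= /negP.
  rewrite (_ : _ @^-1` _ = (if `[< B true >] then [set sx | learner (n := n) sx] else set0) `|`
    (if `[< B false >] then [set sx | ~~ learner (n := n) sx] else set0)).
    by apply: usetU; case: ifP => // _; exact: univ_measurable0.
  apply/seteqP; split=> x /=; rewrite /preimage/=.
    case E0 : (learner x) => Bx; [left|right]; rewrite asboolT//=.
      by rewrite E0.
  by case=> []; case: asboolP => //= Bx; [move=> ->|move=> /negbTE ->].
apply: (@predict_meas R X H k pX mH st0 _ _ n (fun sx => tval sx.1) (fun sx => (sx.2, false))).
  split; first by exists n => t; rewrite size_tuple.
  move=> i; have [im|im] := ltnP i n.
    rewrite (_ : (fun _ => _) = (fun sx => tnth sx.1 (Ordinal im))).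
      exact: (measurableT_comp (measurable_tnth _) measurable_fst).
    by apply/funext => sx; rewrite (tnth_nth point).
  rewrite (_ : (fun _ => _) = (fun=> point)); first exact: measurable_cst.
  by apply/funext => sx; rewrite nth_default// size_tuple.
by apply: measurable_fun_pair; [exact: measurable_snd|exact: measurable_cst].
Qed.

Lemma predict_error_meas n s : uset (R := R) [set z : Z | predict H k st0 n s z.1 != z.2].
Proof.
apply: uset_bool_neq.
  apply: (@predict_meas R X H k pX mH st0 _ _ n (fun=> s) id) => //.
  exact: mlist_cst.
apply: measurable_univ; rewrite (_ : mkset _ = (snd : Z -> bool) @^-1` [set true])//.
by rewrite -[X in measurable X]setTI; exact: measurable_snd.
Qed.

Variable P : probability Z R.
Hypothesis rP : realizable H P.

(** [ts] is a time at which bad states are rare; [eps] is then chosen for the earlier times, and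
    capped by 1 to keep [1 - eps] nonnegative. *)
Lemma exists_parameters : exists ts eps, [/\ (0 < ts)%N, (0 < eps <= 1)%R &
  forall t, (0 < t <= ts)%N ->
  E P (len k t) (fun s => ind (deficient H k P ts eps t (run H k t st0 s))) <= (510^-1)%:E].
Proof.
have d0 : (0 < 510^-1 :> R)%R by rewrite invr_gt0 ltr0n.
have [ts ts0 Dts] : exists2 ts, (0 < ts)%N & bad_prob H k P ts st0 <= (510^-1)%:E.
  have : bad_prob H k P j st0 @[j --> \oo] --> 0.
    by case: (st0) => -[c u] v; apply: (@bad_prob_cvg0 R X H k pX mH P).
  move/fine_cvgP => [_ /cvgrPdist_le/(_ _ d0)[n _ /(_ n.+1 (leqnSn _))]].
  rewrite sub0r normrN => /(le_trans (ler_norm _)) hn; exists n.+1 => //.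
  rewrite -[leLHS]fineK// ge0_fin_numE ?bad_prob_ge0//.
  by apply: le_lt_trans (bad_prob_le1 _ _ _ _ _) _; exact: ltry.
have [e e0 He] := @exists_threshold R X H k pX mH P st0 (len k) ts _ d0.
exists ts, (Num.min e 1)%R; split=> //.
  by rewrite lt_min e0 ltr01 ge_min lexx orbT.
move=> t /andP[t0]; rewrite leq_eqVlt => /orP[/eqP ->|lt_t].
  rewrite -(@E_run R X H k P (k ts) (len k ts)) // in Dts.
    apply: le_trans Dts; apply: E_le => s; first exact: ind_ge0.
    by move=> _; apply: le_ind => -[].
  by move=> u; rewrite lvl0 add0n; exact: kmono.
apply: le_trans (He t lt_t); apply: E_le => s; first exact: ind_ge0.
move=> _; apply: le_ind => -[b [E0|]]; first by rewrite E0 ltnn in lt_t.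
move=> h; split=> //; apply: lt_le_trans h _.
by rewrite lee_fin ge_min lexx.
Qed.

Lemma learner_error : exists ts q, [/\ (0 < ts)%N, (0 <= q < 1)%R & forall n,
  (len k ts <= n %/ 3)%N -> exp_error learner P n <=
  (ts%:R * ((3 / 4) ^+ (n %/ 3 %/ len k ts) + (n %/ 3)%:R * q ^+ (n %/ 3 %/ k ts) +
    4 * ((2 * (k ts).-1)%N%:R / (n - (n %/ 3 + n %/ 3)).+1%:R)))%:E].
Proof.
have [ts [eps [ts0 /andP[eps0 eps1] lows]]] := exists_parameters.
exists ts, (1 - eps)%R; split=> //.
  by rewrite subr_ge0 eps1 gtrBl.
move=> n lN; set N := (n %/ 3)%N in lN *; set M := (n - (N + N))%N.
have En : (n.+1 = N + (N + M.+1))%N by rewrite addnA addnS subnKC//; rewrite /N; lia.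
apply: le_trans (exp_error_le_E (p := fun s x => predict H k st0 n s x) _ _ _) _.
- by [].
- by move=> s; exact: predict_error_meas.
rewrite En; apply: le_trans (E_wrong pX mH k0 kmono eps0 eps1 ts0 rP vst0 st0nil lvl0 lows M lN).
apply: E_le => w; first exact: ind_ge0.
move=> sw; apply: le_ind; rewrite /predict /wrong /batch1 /batch2 /batch3 -/N -/M.
have nE : (n = N + N + M)%N by rewrite subnKC// /N; lia.
rewrite take_takel; last by rewrite nE -addnA leq_addr.
have -> : take N (drop N (take n w)) = take N (drop N w).
  by rewrite !take_drop take_takel// nE leq_addr.
have -> : drop (N + N) (take n w) = take M (drop (N + N) w) by rewrite take_drop (addnC M) -nE.
by rewrite nth_drop -nE.
Qed.

End learner_bound.

(** * From the error bound to the rates *)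

Lemma le_third n : (n <= 3 * (n - (n %/ 3 + n %/ 3)).+1)%N.
Proof. by lia. Qed.

Section rates.
Context {R : realType}.

Lemma geometric_exp (q : R) (L : nat) : 0 <= q < 1 -> (0 < L)%N ->
  exists C c : R, [/\ 0 < C, 0 < c &
    forall n, n.+1%:R * q ^+ (n %/ 3 %/ L) <= C * expR (- (c * n%:R))].
Proof.
move=> /andP[q0 q1] L0; pose a := 1 - q; have a0 : 0 < a by rewrite subr_gt0.
have L3 : 0 < (3 * L)%N%:R :> R by rewrite ltr0n muln_gt0.
(* Half of the available decay rate: the other half absorbs the factor [n.+1]. The factor [expR a]
   below pays for the rounding in [n %/ (3 * L)]. *)
pose b := a / (3 * L)%:R / 2; have b0 : 0 < b by rewrite !divr_gt0.
have m0 : 0 < Num.min 1 b by rewrite lt_min ltr01.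
exists (expR a / Num.min 1 b), b; split=> // [|n]; first by rewrite divr_gt0 ?expR_gt0.
rewrite -divnMA; set m := (n %/ (3 * L))%N.
have qe : q <= expR (- a) by apply: le_trans (expR_ge1Dx _); rewrite /a; lra.
have h1 : q ^+ m <= expR (- a * m%:R).
  by rewrite mulrC expRM_natl; apply: lerXn2r => //; rewrite nnegrE ?expR_ge0.
have h2 : expR (- a * m%:R) <= expR a * expR (- (b * n%:R)) * expR (- (b * n%:R)).
  rewrite -!expRD ler_expR.
  have : n%:R <= (m.+1)%:R * (3 * L)%:R :> R.
    by rewrite -natrM ler_nat ltnW// ltn_ceil// muln_gt0.
  move=> hn.
  have : a * (n%:R / (3 * L)%:R) <= a * m.+1%:R.
    by rewrite ler_pM2l// ler_pdivrMr.
  by rewrite /b -natr1 -mulrA => hh; lra.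
have h3 : n.+1%:R * Num.min 1 b <= expR (b * n%:R).
  apply: le_trans (expR_ge1Dx _); rewrite -natr1 mulrDl mul1r addrC.
  apply: lerD; first by rewrite ge_min lexx.
  by rewrite mulrC ler_wpM2r// ge_min lexx orbT.
rewrite mulrAC ler_pdivlMr// mulrAC.
apply: (@le_trans _ _ (expR (b * n%:R) * (expR a * expR (- (b * n%:R)) * expR (- (b * n%:R))))).
  apply: ler_pM => //; [by rewrite mulr_ge0// ltW|exact: exprn_ge0|exact: le_trans h2].
set A := expR a; set i := expR (- _); set e := expR (b * _).
rewrite (_ : e * (A * i * i) = A * i * (e * i)); last by ring.
have -> : e * i = 1 by rewrite /e /i -expRD subrr expR0.
by rewrite mulr1.
Qed.

Lemma nceil_itv (x : R) : 0 <= x -> x <= `|Num.ceil x|%N%:R < x + 1.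
Proof.
move=> x0; have h0 : (0 <= Num.ceil x) by rewrite ceil_ge0; apply: lt_le_trans x0; rewrite ltrN10.
have -> : `|Num.ceil x|%N%:R = (Num.ceil x)%:~R :> R by rewrite -[in RHS](gez0_abs h0).
by have /andP[h1 h2] := ceil_itv x; rewrite h2/= -ltrBlDr; move: h1; rewrite intrB.
Qed.

Lemma rate_at1 (r : nat -> R) n : rate_at r 1 n = r n.
Proof.
rewrite /rate_at mul1r (_ : Num.ceil n%:R = n%:Z)//.
by apply/eqP; rewrite ceil_eq intrB lexx andbT gtrBl.
Qed.

Lemma exp_rate_ge (c : R) n : 0 < c ->
  expR (- (c * n%:R)) <= expR 1 * rate_at (@exp_rate R) c n.
Proof.
move=> c0; rewrite /rate_at /exp_rate -expRD ler_expR.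
have /nceil_itv/andP[_] : 0 <= c * n%:R by rewrite mulr_ge0// ltW.
by move=> h; lra.
Qed.

Lemma expN_le_inv (c : R) n : 0 < c -> (0 < n)%N -> expR (- (c * n%:R)) <= c^-1 * n%:R^-1.
Proof.
move=> c0 n0; rewrite expRN -invfM lef_pV2 ?posrE ?expR_gt0 ?mulr_gt0 ?ltr0n//.
rewrite mulrC; apply: le_trans (expR_ge1Dx _); rewrite mulrC; lra.
Qed.

End rates.

Section upper.
Context (R : realType) (X : ptopologicalType) (H : set (X -> bool)) (k : nat -> nat).
Hypotheses (pX : polish R X) (mH : measurable_concept_class R H).
Local Notation Z := (borel X * bool)%type.
Hypotheses (k0 : forall t, (0 < k t)%N)
  (kmono : forall t u, (t <= u)%N -> (k t <= k u)%N).

(** The one-inclusion term keeps the factor [(k m).-1], which vanishes for the game with one point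
    per round: this separates the exponential rate from [1/n]. *)
Lemma learner_rate (st0 : state X) (P : probability Z R) : valid H k st0 ->
  st0.2 = [::] -> lvl st0 = 0%N -> realizable H P ->
  exists (C c : R) (m : nat), [/\ 0 < C, 0 < c & forall n, (0 < n)%N ->
    (exp_error (learner H k st0) P n <=
      (C * expR (- (c * n%:R)) + C * (k m).-1%:R * n%:R^-1)%:E)%E].
Proof.
move=> vst0 st0nil lvl0 rP.
have [ts [q [ts0 /andP[q0 q1] hq]]] := learner_error pX mH k0 kmono vst0 st0nil lvl0 rP.
set L := len k ts in hq; have L0 : (0 < L)%N by rewrite muln_gt0 ts0 k0.
pose r := Num.max (3 / 4) q.
have r01 : 0 <= r < 1 by rewrite le_max q0 orbT/= gt_max q1 andbT; lra.
have [r0 r1] := andP r01.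
have r34 : 3 / 4 <= r by rewrite le_max lexx.
have z34 : 0 <= 3 / 4 :> R by lra.
have rq : q <= r by rewrite le_max lexx orbT.
have [C [c [C0 c0 hC]]] := geometric_exp r01 L0.
have tsC : 0 < ts%:R * C by rewrite mulr_gt0 ?ltr0n.
(* The summands serve the geometric terms, the small [n] with [n %/ 3 < L], where the error is just
   bounded by 1, and the one-inclusion term. There 24 is 4 from the vote, 2 from the degree bound
   and 3 from the third batch, of size at least [n / 3]. *)
exists (ts%:R * C + expR (c * (3 * L)%:R) + ts%:R * 24), c, ts; split=> //.
  by rewrite !addr_gt0 ?expR_gt0 ?mulr_gt0 ?ltr0n.
move=> n n0; have n0' : 0 < n%:R^-1 :> R by rewrite invr_gt0 ltr0n.
set D := _ + expR _ + _; set e := expR (- _).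
have e0 : 0 < e by exact: expR_gt0.
have D0 : 0 <= D by rewrite /D !addr_ge0 ?expR_ge0 ?(ltW tsC) ?mulr_ge0.
have [lN|lN] := leqP L (n %/ 3); last first.
  apply: le_trans (exp_error_le1 P _ n) _; rewrite lee_fin.
  have n3 : (n <= 3 * L)%N by rewrite ltnW// mulnC -ltn_divLR.
  have h1 : 1 <= expR (c * (3 * L)%:R) * e.
    rewrite /e -expRD -[leLHS]expR0 ler_expR subr_ge0 ler_pM2l// ler_nat //.
  apply: (@le_trans _ _ (D * e)).
    apply: le_trans h1 _; rewrite ler_pM2r// /D.
    have : 0 <= ts%:R * 24 :> R by rewrite mulr_ge0.
    by move: tsC; move: (ts%:R * 24) (ts%:R * C) (expR _) => x y z; lra.
  rewrite lerDl; apply: mulr_ge0; last exact: ltW.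
  by apply: mulr_ge0.
apply: le_trans (hq n lN) _; rewrite lee_fin.
set N := (n %/ 3)%N in lN *; set p := (k ts).-1.
have h1 : (3 / 4) ^+ (N %/ L) <= r ^+ (N %/ L).
  by apply: lerXn2r; rewrite ?nnegrE.
have h2 : q ^+ (N %/ k ts) <= r ^+ (N %/ L).
  apply: (@le_trans _ _ (r ^+ (N %/ k ts))).
    by apply: lerXn2r; rewrite ?nnegrE.
  apply: ler_wiXn2l => //; first exact: ltW.
  by apply: leq_div2l; rewrite ?k0// leq_pmull.
have h3 : (3 / 4) ^+ (N %/ L) + N%:R * q ^+ (N %/ k ts) <= C * e.
  apply: le_trans (hC n).
  apply: (@le_trans _ _ (r ^+ (N %/ L) + N%:R * r ^+ (N %/ L))).
    by apply: lerD => //; apply: ler_wpM2l.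
  have -> : r ^+ (N %/ L) + N%:R * r ^+ (N %/ L) = N.+1%:R * r ^+ (N %/ L).
    by rewrite -natr1; ring.
  apply: ler_wpM2r; first by rewrite exprn_ge0//; case/andP: r01.
  by rewrite ler_nat ltnS; apply: leq_div.
have h4 : 4 * ((2 * p)%N%:R / (n - (N + N)).+1%:R) <= 24 * (p%:R * n%:R^-1) :> R.
  have hn : (n - (N + N)).+1%:R^-1 <= 3 * n%:R^-1 :> R.
    rewrite -[leRHS]invrK lef_pV2 ?posrE ?invr_gt0 ?mulr_gt0 ?ltr0n//.
    rewrite invfM invrK mulrC ler_pdivrMr// -natrM ler_nat.
    by rewrite mulnC; exact: le_third.
  rewrite natrM; apply: (@le_trans _ _ (4 * (2 * p%:R * (3 * n%:R^-1)))).
    by rewrite ler_pM2l// ler_wpM2l// mulr_ge0.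
  by rewrite le_eqVlt; apply/orP; left; apply/eqP; ring.
rewrite mulrDr; apply: lerD.
  apply: (@le_trans _ _ (ts%:R * C * e)); first by rewrite -mulrA ler_pM2l ?ltr0n.
  by rewrite ler_pM2r// /D -addrA lerDl addr_ge0 ?expR_ge0 ?mulr_ge0.
apply: (@le_trans _ _ (ts%:R * 24 * (p%:R * n%:R^-1))).
  by rewrite -mulrA ler_pM2l ?ltr0n.
rewrite -[leRHS]mulrA; apply: ler_wpM2r; first by rewrite mulr_ge0// ltW.
by rewrite /D lerDr addr_ge0 ?expR_ge0// ltW.
Qed.

Hypothesis no_tree : ~ inf_tree H k.

Lemma winning_start : exists2 st0 : state X, valid H k st0 & st0.2 = [::] /\ lvl st0 = 0%N.
Proof.
have : ~ forall c, Dc H k c 0 [::] by move=> h; apply: no_tree; exact: game_tree pX mH h.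
by move=> /existsNP[c hc]; exists (c, 0%N, [::]).
Qed.

End upper.

Theorem learnable_exp (R : realType) (X : ptopologicalType) (H : set (X -> bool)) :
  polish R X -> measurable_concept_class R H -> ~ inf_tree H (fun=> 1%N) ->
  learnable_at_rate H (@exp_rate R).
Proof.
move=> pX mH nt; have [st0 v0 [n0 l0]] := winning_start pX mH nt.
exists (learner H (fun=> 1%N) st0); split; first exact: learner_algorithm.
move=> P rP.
have [//|//|C [c [m [C0 c0 h]]]] := @learner_rate R X H (fun=> 1%N) pX mH _ _ st0 P v0 n0 l0 rP.
exists (C * expR 1), c; split; first by rewrite mulr_gt0 ?expR_gt0.
split=> // n n1; apply: le_trans (h n n1) _.
by rewrite mulr0 mul0r addr0 lee_fin -mulrA ler_pM2l//; exact: exp_rate_ge.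
Qed.

Theorem learnable_inv (R : realType) (X : ptopologicalType) (H : set (X -> bool)) :
  polish R X -> measurable_concept_class R H -> ~ inf_tree H S ->
  learnable_at_rate H (@inv_rate R).
Proof.
move=> pX mH nt; have [st0 v0 [n0 l0]] := winning_start pX mH nt.
exists (learner H S st0); split; first exact: learner_algorithm.
move=> P rP.
have [//|//|C [c [m [C0 c0 h]]]] := @learner_rate R X H S pX mH _ _ st0 P v0 n0 l0 rP.
exists (C * c^-1 + C * m.+1.-1%:R), 1; split.
  by rewrite ltr_wpDr// ?mulr_ge0 ?(ltW C0)// mulr_gt0 ?invr_gt0.
split=> // n n1; apply: le_trans (h n n1) _.
rewrite rate_at1 lee_fin mulrDl; apply: lerD; last by [].
by rewrite -mulrA ler_pM2l//; exact: expN_le_inv.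
Qed.

(** * Lower bounds *)

Section discrete.
Context {R : realType} {d : measure_display} {Z : measurableType d}.
Hypothesis mset1 : forall z : Z, measurable [set z].
Variable lv : nat -> seq (R * Z).
Hypothesis lv0 : forall j u, u \in lv j -> 0 <= u.1.
Hypothesis lv1 : (\sum_(j < J) \sum_(u <- lv j) u.1) @[J --> \oo] --> (1 : R).
Local Open Scope ereal_scope.

Let u0 : R * Z := (0%R, point).
Let layer (j i : nat) : {measure set Z -> \bar R} :=
  mscale (`|(nth u0 (lv j) i).1|%:nng)%R (dirac (nth u0 (lv j) i).2).
Let total j : {measure set Z -> \bar R} := msum (layer j) (size (lv j)).
Let mu : {measure set Z -> \bar R} := mseries total 0.

Let integral_mu (s : Z -> \bar R) : (forall z, 0 <= s z) -> measurable_fun setT s ->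
  \int[mu]_z s z = \sum_(j <oo) \sum_(u <- lv j) u.1%:E * s u.2.
Proof.
move=> s0 ms; rewrite ge0_integral_measure_series//; apply: eq_eseriesr => j _.
rewrite ge0_integral_measure_sum//= (big_nth u0) big_mkord; apply: eq_bigr => i _.
rewrite ge0_integral_mscale// integral_dirac// diracT mul1e /=.
by rewrite ger0_norm//; apply: (lv0 (j := j)); exact: mem_nth.
Qed.

Let mu1 : mu setT = 1.
Proof.
have := integral_mu (s := fun=> 1) (fun=> ltW (@lte01 _)) (@measurable_cst _ _ _ _ _ _).
rewrite integral_cst// mul1e => ->; apply/cvg_lim => //.
rewrite (_ : (fun _ => _) = EFin \o (fun J => \sum_(j < J) \sum_(u <- lv j) u.1))%R; last first.
  apply/funext => J /=; rewrite -sumEFin big_mkord; apply: eq_bigr => j _.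
  by rewrite -sumEFin; apply: eq_bigr => u _; rewrite mule1.
by apply/fine_cvgP; split; [near=> J|].
Unshelve. all: by end_near.
Qed.

Lemma ind_sum (r : seq Z) (g : Z -> \bar R) z : uniq r ->
  \sum_(a <- r) g a * (\1_[set a] z)%:E = if z \in r then g z else 0.
Proof.
elim: r => [|a r IH] /=; first by rewrite big_nil.
move=> /andP[ar ur]; rewrite big_cons IH// inE indicE.
have [->|za] := eqVneq z a; first by rewrite mem_set// (negbTE ar) mule1 adde0.
by rewrite memNset ?mule0 ?add0e//=; exact/eqP.
Qed.

(** Only a lower bound is claimed, so [g] need not be measurable: its restriction to the atoms of
    the first [J] levels is a finite combination of indicators of points. *)
Lemma discrete_probability : exists P : probability Z R,
  forall J (g : Z -> \bar R), (forall z, 0 <= g z) ->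
  \sum_(j < J) \sum_(u <- lv j) u.1%:E * g u.2 <= \int[P]_z g z.
Proof.
(* [mu] already has mass 1; normalizing only packages it as a probability. *)
exists (mnormalize mu (dirac point)) => J g g0.
have nE (A : set Z) : mnormalize mu (dirac point) A = mu A.
  rewrite /mnormalize mu1 ifF; first by rewrite invr1 mule1.
  by apply/negbTE; rewrite negb_or eqe oner_eq0.
pose r := undup [seq u.2 | u <- flatten [seq lv j | j <- iota 0 J]].
pose s z := \sum_(a <- r) g a * (\1_[set a] z)%:E.
have sE z : s z = if z \in r then g z else 0 by rewrite /s ind_sum// undup_uniq.
have s0 z : 0 <= s z by rewrite sE; case: ifP.
have ms : measurable_fun setT s.
  apply: emeasurable_sum => a; apply: emeasurable_funM; first exact: measurable_cst.
  by apply/measurable_EFinP; exact: measurable_indic.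
apply: (@le_trans _ _ (\int[mu]_z s z)); last first.
  rewrite (@eq_measure_integral _ _ _ setT (mnormalize mu (dirac point)) mu s).
    2: by move=> A _ _; exact/esym/nE.
  by apply: le_nonmeas_integral => // z; rewrite sE; case: ifP.
rewrite integral_mu//; apply: le_trans (nneseries_lim_ge J _); last first.
  move=> j _ _; rewrite big_seq; apply: sume_ge0 => u uj.
  by rewrite mule_ge0// lee_fin (lv0 uj).
rewrite big_mkord; apply: lee_sum => j _; rewrite big_seq [leRHS]big_seq.
apply: lee_sum => u uj; rewrite sE ifT// mem_undup; apply: map_f.
by apply/flattenP; exists (lv j) => //; apply: map_f; rewrite mem_iota add0n/=.
Qed.

End discrete.

Section weighted_sums.
Context {R : realType} {Z : Type}.
Implicit Types (L : seq (R * Z)) (f : seq Z -> R).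

Definition wsum L (g : Z -> R) : R := \sum_(u <- L) u.1 * g u.2.

(** The iterated integral against finitely many atoms whose total mass may be below 1; neither
    measurability nor convergence is at issue here. *)
Fixpoint witer L n f : R :=
  if n is n'.+1 then wsum L (fun z => witer L n' (fun s => f (z :: s))) else f [::].

Definition weight L : R := wsum L (fun=> 1).

Lemma wsum_le L g h : all (fun u => 0 <= u.1) L -> (forall z, g z <= h z) ->
  wsum L g <= wsum L h.
Proof.
rewrite /wsum; elim: L => [|u L IH] /=; first by rewrite !big_nil.
move=> /andP[u0 L0] gh; rewrite !big_cons; apply: lerD; last exact: IH.
by apply: ler_wpM2l.
Qed.

Lemma wsum_cat L L' g : wsum (L ++ L') g = wsum L g + wsum L' g.
Proof. exact: big_cat. Qed.

Lemma wsum_add L g h : wsum L (fun z => g z + h z) = wsum L g + wsum L h.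
Proof. by rewrite /wsum -big_split/=; apply: eq_bigr => u _; rewrite mulrDr. Qed.

Lemma wsum_scale L c g : wsum L (fun z => c * g z) = c * wsum L g.
Proof. by rewrite /wsum big_distrr/=; apply: eq_bigr => u _; rewrite mulrCA. Qed.

Lemma eq_wsum L g h : g =1 h -> wsum L g = wsum L h.
Proof. by move=> gh; apply: eq_bigr => u _; rewrite gh. Qed.

Lemma wsum_ge0 L g : all (fun u => 0 <= u.1) L -> (forall z, 0 <= g z) -> 0 <= wsum L g.
Proof.
move=> L0 g0; apply: le_trans (wsum_le L0 g0).
by rewrite /wsum; apply: sumr_ge0 => u _; rewrite mulr0.
Qed.

Lemma witer_ge0 L n f : all (fun u => 0 <= u.1) L -> (forall s, 0 <= f s) -> 0 <= witer L n f.
Proof. by move=> L0; elim: n f => //= n IH f f0; apply: wsum_ge0 => // z; exact: IH. Qed.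

Lemma eq_witer L n f (g : seq Z -> R) : f =1 g -> witer L n f = witer L n g.
Proof. by elim: n f g => //= n IH f g fg; apply: eq_wsum => z; apply: IH => s. Qed.

Lemma witer_add L n f (g : seq Z -> R) : witer L n (fun s => f s + g s) = witer L n f + witer L n g.
Proof. by elim: n f g => //= n IH f g; rewrite -wsum_add; apply: eq_wsum => z; rewrite IH. Qed.

Lemma witer_scale L n c f : witer L n (fun s => c * f s) = c * witer L n f.
Proof. by elim: n f => //= n IH f; rewrite -wsum_scale; apply: eq_wsum => z; rewrite IH. Qed.

Lemma witer_sum L n (I : Type) (r : seq I) (f : I -> seq Z -> R) :
  witer L n (fun s => \sum_(i <- r) f i s) = \sum_(i <- r) witer L n (f i).
Proof.
elim: r => [|i r IH].
  rewrite big_nil -[RHS](mul0r (witer L n (fun=> 0))) -witer_scale.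
  by apply: eq_witer => s; rewrite big_nil mul0r.
rewrite big_cons -IH -witer_add; apply: eq_witer => s; exact: big_cons.
Qed.

Lemma witer_cst L n : witer L n (fun=> 1) = weight L ^+ n.
Proof.
elim: n => [|n IH] /=; first by rewrite expr0.
rewrite (@eq_wsum _ _ (fun z => weight L ^+ n * 1)) => [|z]; last by rewrite mulr1.
by rewrite wsum_scale exprS mulrC.
Qed.

Lemma witer_mono L L' n f : all (fun u => 0 <= u.1) L -> all (fun u => 0 <= u.1) L' ->
  (forall g : Z -> R, (forall z, 0 <= g z) -> wsum L g <= wsum L' g) ->
  (forall s, 0 <= f s) -> witer L n f <= witer L' n f.
Proof.
move=> L0 L0' LL; elim: n f => //= n IH f f0.
apply: (@le_trans _ _ (wsum L (fun z => witer L' n (fun s => f (z :: s))))).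
  by apply: wsum_le => // z; exact: IH.
by apply: LL => z; exact: witer_ge0.
Qed.

Lemma wsum_filter (I : Type) (r : seq I) (a : pred I) (F : I -> R * Z) (g : Z -> R) :
  (forall i, 0 <= (F i).1 * g (F i).2) ->
  wsum [seq F i | i <- r & a i] g <= wsum [seq F i | i <- r] g.
Proof.
move=> F0; rewrite /wsum; elim: r => [|i r IH] /=; first by rewrite !big_nil.
case: ifP => _; rewrite /= !big_cons; first by rewrite lerD2l.
by rewrite -[leLHS]add0r lerD.
Qed.

End weighted_sums.

Lemma bernoulli (R : realType) (x : R) n : 0 <= x <= 1 -> 1 - n%:R * x <= (1 - x) ^+ n.
Proof.
move=> /andP[x0 x1]; elim: n => [|n IH]; first by rewrite mul0r subr0 expr0.
rewrite exprS; apply: (@le_trans _ _ ((1 - x) * (1 - n%:R * x))).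
  rewrite -natr1; have : 0 <= n%:R * x * x by rewrite !mulr_ge0.
  by move: (n%:R) => m; nra.
by apply: ler_wpM2l => //; rewrite subr_ge0.
Qed.

(* Flipping the label of a point that the sample avoids leaves the sample unchanged, so on average over the labels the answer there is wrong half of the time. *)
Section adversary.
Context {R : realType} {X : Type}.
Local Notation Z := (X * bool)%type.
Variables (K n : nat) (L : seq (R * Z)) (xs : 'I_K -> X) (p : R).
Variable phi : seq Z -> X -> bool.
Hypotheses (p0 : 0 <= p) (L0 : all (fun u => 0 <= u.1) L).
(** The difference is the mass left out by [L] and by all points of the level but one; by
    Bernoulli's inequality a sample of size [n] misses it with probability at least 1/2. *)
Hypothesis heavy : n%:R * (1 - (weight L + p * K%:R - p)) * 2 <= 1.
Hypothesis light : 0 <= 1 - (weight L + p * K%:R - p) <= 1.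

Definition extension (y : {ffun 'I_K -> bool}) : seq (R * Z) :=
  L ++ [seq (p, (xs i, y i)) | i <- enum 'I_K].

Let others (i : 'I_K) (y : {ffun 'I_K -> bool}) : seq (R * Z) :=
  L ++ [seq (p, (xs l, y l)) | l <- enum 'I_K & l != i].

Let flip (i : 'I_K) (y : {ffun 'I_K -> bool}) : {ffun 'I_K -> bool} :=
  [ffun l => if l == i then ~~ y l else y l].

Let flipK i : involutive (flip i).
Proof. by move=> y; apply/ffunP => l; rewrite !ffunE; case: eqP; rewrite ?negbK. Qed.

Let ext_ge0 y : all (fun u => 0 <= u.1) (extension y).
Proof. by rewrite all_cat L0 all_map; apply/allP. Qed.

Let others_ge0 i y : all (fun u => 0 <= u.1) (others i y).
Proof. by rewrite all_cat L0 all_map; apply/allP. Qed.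

Let others_flip i y : others i (flip i y) = others i y.
Proof.
congr (_ ++ _); apply/eq_in_map => l; rewrite mem_filter => /andP[li _].
by rewrite ffunE (negbTE li).
Qed.

Let weight_others i y : weight (others i y) = weight L + p * K%:R - p.
Proof.
rewrite /weight /others wsum_cat -addrA; congr (_ + _).
rewrite /wsum big_map big_filter /=.
rewrite (eq_bigr (fun=> p)) => [|l _]; last by rewrite mulr1.
have -> : p * K%:R = \sum_(l < K) p by rewrite sumr_const card_ord mulr_natr.
by rewrite (bigD1 i)//= (addrC p) addrK big_enum_cond.
Qed.

Let err i y s : R := (phi s (xs i) != y i)%:R.

Let err_ge0 i y s : 0 <= err i y s. Proof. by rewrite /err ler0n. Qed.

Let half : 2^-1 <= (weight L + p * K%:R - p) ^+ n.
Proof.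
have := bernoulli n light; rewrite subKr; apply: le_trans.
by move: heavy; move: (1 - _) => x; lra.
Qed.

Let pair i y : 2^-1 <= witer (others i y) n (err i y) + witer (others i (flip i y)) n (err i (flip i y)).
Proof.
rewrite others_flip -witer_add (@eq_witer _ _ _ _ _ (fun=> 1)) => [|s].
  by rewrite witer_cst weight_others.
by rewrite /err ffunE eqxx -natrD; case: (phi _ _); case: (y i).
Qed.

Let mean i : 2^-1 * (#|{ffun 'I_K -> bool}|)%:R <=
  2 * \sum_y witer (others i y) n (err i y).
Proof.
rewrite [leRHS]mulr_natl mulr2n [X in _ <= _ + X](reindex_inj (inv_inj (@flipK i)))/=.
rewrite -big_split/= mulr_natr -sumr_const.
by apply: ler_sum => y _; exact: pair.
Qed.

(** In the constant 4, one factor 2 is for samples that do not miss the point, the other for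
    averaging over its two labels; some labeling is at least as bad as the average. *)
Lemma adversary : exists y, K%:R * p / 4 <=
  witer (extension y) n (fun s => \sum_(i < K) p * (phi s (xs i) != y i)%:R).
Proof.
apply: contrapT => /forallNP none.
have lt y : witer (extension y) n (fun s => \sum_(i < K) p * err i y s) < K%:R * p / 4.
  by rewrite ltNge; apply/negP.
have c0 : (0 < #|{ffun 'I_K -> bool}|)%N by apply/card_gt0P; exists [ffun=> true].
pose N : R := (#|{ffun 'I_K -> bool}|)%:R; have N0 : 0 < N by rewrite ltr0n.
have : \sum_y witer (extension y) n (fun s => \sum_(i < K) p * err i y s) < N * (K%:R * p / 4).
  rewrite mulrC /N mulr_natr -sumr_const; apply: ltr_sum => //.
  by case/card_gt0P: c0 => y _; apply/hasP; exists y; rewrite ?mem_index_enum.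
rewrite ltNge => /negP; apply.
apply: (@le_trans _ _ (\sum_y \sum_(i < K) p * witer (others i y) n (err i y))).
  rewrite exchange_big/=; under eq_bigr do rewrite -big_distrr/=.
  rewrite (_ : N * _ = \sum_(i < K) p * (N / 4)).
    apply: ler_sum => i _; apply: ler_wpM2l => //.
    have := mean i; rewrite -/N; lra.
  by rewrite sumr_const card_ord -mulr_natr; ring.
apply: ler_sum => y _; rewrite witer_sum; apply: ler_sum => i _.
rewrite witer_scale; apply: ler_wpM2l => //; apply: witer_mono => // g g0.
rewrite !wsum_cat lerD2l; apply: wsum_filter => // l.
by rewrite mulr_ge0.
Qed.

End adversary.

(** * Passing to subtrees *)

Section subtree.
Context (X : choiceType) (H : set (X -> bool)) (k l tau : nat -> nat).
Hypotheses (tau_mono : forall i j, (i < j)%N -> (tau i < tau j)%N)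
  (lk : forall j, (l j <= k (tau j))%N).

Let tau_inj i j : tau i = tau j -> i = j.
Proof.
have [/tau_mono|/tau_mono|//] := ltngtP i j => h e; move: h; by rewrite e ltnn.
Qed.

Let lt_tau i j : (tau i < tau j)%N -> (i < j)%N.
Proof.
have [//|/tau_mono h|->] := ltngtP i j; last by rewrite ltnn.
by move/(ltn_trans h); rewrite ltnn.
Qed.

Let source t : nat := xget 0%N [set j | tau j = t].

Let source_tau j : source (tau j) = j.
Proof. by rewrite /source; case: xgetP => [i _ /tau_inj//|h]; case: (h j). Qed.

Definition padded (n : nat) (y : seq bool) := take n (y ++ nseq n false).

Let size_padded n y : size (padded n y) = n.
Proof. by rewrite size_takel// size_cat size_nseq leq_addl. Qed.

Let lab bs t : seq bool :=
  if `[< exists j, tau j = t >] then padded (k t) (nth [::] bs (source t))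
  else nseq (k t) false.

Let fill bs : seq (seq bool) := mkseq (lab bs) (tau (size bs)).

Let size_lab bs t : size (lab bs t) = k t.
Proof. by rewrite /lab; case: ifP => _; rewrite ?size_padded ?size_nseq. Qed.

Let labels_fill bs : labels k (fill bs).
Proof. by move=> i; rewrite size_mkseq => h; rewrite nth_mkseq// size_lab. Qed.

(** Truncation at a selected level commutes with filling, so the nodes met along [bs] lie on a
    single branch of the big tree. *)
Let take_fill bs i : (i < size bs)%N -> take (tau i) (fill bs) = fill (take i bs).
Proof.
move=> im; rewrite /fill /mkseq -map_take take_iota size_takel; last exact: ltnW.
rewrite (minn_idPl _); last by rewrite ltnW// tau_mono.
apply/eq_in_map => t; rewrite mem_iota add0n => /andP[_ ti].
rewrite /lab; case: asboolP => // -[j jt]; rewrite -jt source_tau nth_take//.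
by apply: lt_tau; rewrite jt.
Qed.

(* Keep the first [l j] points of level [tau j] and label everything else [false]. *)
Lemma inf_tree_sub : inf_tree H k -> inf_tree H l.
Proof.
move=> [tr htr]; exists (fun bs => take (l (size bs)) (tr (fill bs))) => bs lbs.
have [str [h Hh hc]] := htr (fill bs) (@labels_fill bs); split.
  by rewrite size_takel// str size_mkseq.
exists h => //; apply/allP => z /flattenP[b /mapP[i]].
rewrite mem_iota add0n => /andP[_ im] -> zb; apply: (allP hc).
apply/flattenP; exists (zip (tr (take (tau i) (fill bs))) (nth [::] (fill bs) (tau i))).
  by apply: (map_f (fun t => zip (tr (take t (fill bs))) (nth [::] (fill bs) t)));
    rewrite mem_iota add0n size_mkseq tau_mono.
rewrite take_fill// nth_mkseq ?tau_mono// /lab asboolT; last by exists i.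
rewrite source_tau; move: zb; rewrite size_takel; last exact: ltnW.
set y := padded _ _.
have -> : nth [::] bs i = take (l i) y.
  by rewrite /y /padded take_takel// -(lbs i im) take_size_cat.
move=> zb; apply: (@mem_take (l i)); move: zb.
move: (tr _) (y) => xs ys.
by elim: (l i) xs ys => [|n IH] [|x xs] [|b0 ys] //=; rewrite !inE => /orP[/eqP ->|/IH ->]; rewrite ?eqxx ?orbT.
Qed.

End subtree.

Lemma measurable_point (R : realType) (X : ptopologicalType) (z : borel X * bool) :
  polish R X -> measurable [set z].
Proof.
move=> pX; rewrite (_ : [set z] = [set z.1] `*` [set z.2]).
  by apply: measurableX => //; exact: (borel_set1 _ pX).
by apply/seteqP; split=> -[x y] /=; [move=> <-|case: z => z1 z2 /= [-> ->]].
Qed.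

Section domination.
Context (R : realType) (X : ptopologicalType).
Local Notation Z := (borel X * bool)%type.
Variable P : probability Z R.
Local Open Scope ereal_scope.

(** The test functions need not be measurable, so the error of an arbitrary algorithm can be bounded
    from below directly. *)
Definition dominated (L : seq (R * Z)) := forall g : Z -> R, (forall z, (0 <= g z)%R) ->
  (wsum L g)%:E <= \int[P]_z (g z)%:E.

Lemma iexp_ge n L (f : seq Z -> R) (F : n.-tuple Z -> \bar R) :
  all (fun u => (0 <= u.1)%R) L -> dominated L -> (forall s, (0 <= f s)%R) ->
  (forall t, (f (tval t))%:E <= F t) -> (witer L n f)%:E <= iexp P F.
Proof.
move=> L0 dL; elim: n f F => [|n IH] f F f0 fF /=; first exact: fF [tuple].
apply: le_trans (dL _ _) _; first by move=> z; exact: witer_ge0.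
apply: le_nonmeas_integral => z; first by rewrite lee_fin; exact: witer_ge0.
by apply: IH => // t; exact: fF (cons_tuple z t).
Qed.

Lemma integral_indicator (B : set Z) : measurable B ->
  \int[P]_z (\1_B z)%:E = P B.
Proof. by move=> mB; rewrite integral_indic// setIT. Qed.

Lemma er_ge L h : all (fun u => (0 <= u.1)%R) L -> dominated L ->
  (wsum L (fun z => (h z.1 != z.2)%:R))%:E <= er P h.
Proof.
move=> L0 dL; apply: le_ereal_inf_tmp => _ [B [mB hB] <-].
rewrite -integral_indicator//; apply: le_trans (dL _ _); last first.
  by move=> z; rewrite indicE.
rewrite lee_fin; apply: wsum_le => // z; rewrite indicE.
have [hz|/negP hz] := pselect (is_true (h z.1 != z.2)).
  by rewrite mem_set//; [rewrite hz|exact: hB].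
by rewrite (negbTE hz).
Qed.

Lemma er_le L h : polish R X -> dominated L -> (forall u, u \in L -> h u.2.1 = u.2.2) ->
  er P h <= (1 - weight L)%:E.
Proof.
move=> pX dL hL; pose F : set Z := [set z | z \in [seq u.2 | u <- L]].
have mF : measurable F.
  rewrite (_ : F = \bigcup_(z in F) [set z]); last first.
    by apply/seteqP; split=> z; [exists z|case=> a Fa ->].
  apply: fin_bigcup_measurable; first exact: finite_seq.
  by move=> z _; exact: (measurable_point _ pX).
apply: (@le_trans _ _ (P (~` F))).
  apply: ereal_inf_lbound; exists (~` F) => //; split; first exact: measurableC.
  by move=> z /= hz /mapP[u uL zu]; move: hz; rewrite zu (hL _ uL) eqxx.
rewrite probability_setC// EFinB; apply: leeB => //.
rewrite -integral_indicator//; apply: le_trans (dL _ _); last by move=> z; rewrite indicE ler0n.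
rewrite lee_fin /weight /wsum big_seq [leRHS]big_seq; apply: ler_sum => u uL.
by rewrite indicE mem_set//; apply: map_f.
Qed.

End domination.

Lemma zip_map (T1 T2 I : Type) (f : I -> T1) (g : I -> T2) (r : seq I) :
  zip (map f r) (map g r) = [seq (f i, g i) | i <- r].
Proof. by elim: r => //= i r ->. Qed.

(** * Hard distributions along a branch *)

Section slow_learning.
Context (R : realType) (X : ptopologicalType) (H : set (X -> bool)).
Hypothesis pX : polish R X.
Local Notation Z := (borel X * bool)%type.
Variables (l : nat -> nat) (tr : seq (seq bool) -> seq X).
Hypothesis l0 : forall j, (0 < l j)%N.
Hypothesis htr : forall bs, labels l bs ->
  size (tr bs) = l (size bs) /\ consistent H (branch tr bs).
(** [b j] is the mass of the levels from [j] on; level [j] has mass [q j], shared equally by its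
    [l j] points, and is meant to defeat samples of size [n j]. *)
Variables (b : nat -> R) (n : nat -> nat).
Hypotheses (b0 : b 0 = 1) (b_gt0 : forall j, 0 < b j) (b_half : forall j, b j.+1 <= b j / 2).
Local Notation q j := (b j - b j.+1).
Hypothesis sparse : forall j, (n j)%:R * (b j.+1 + q j / (l j)%:R) * 2 <= 1.
Variable A : forall n : nat, (n.-tuple Z * borel X)%type -> bool.

(* [A] extended to lists; the value on lists of the wrong length is junk. *)
Definition answer m (s : seq Z) (x : borel X) : bool :=
  if insub s is Some t then A (n := m) (t, x) else false.

Lemma answerE m (t : m.-tuple Z) x : answer m t x = A (t, x).
Proof. by rewrite /answer valK. Qed.

Definition weigh j (xs : seq X) (y : seq bool) : seq (R * Z) :=
  [seq (q j / (l j)%:R, z) | z <- zip xs y].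

Definition weighted_branch (bs : seq (seq bool)) : seq (R * Z) :=
  flatten [seq weigh i (tr (take i bs)) (nth [::] bs i) | i <- iota 0 (size bs)].

Definition good bs (y : seq bool) : Prop := let j := size bs in
  size y = l j /\ q j / 4 <= witer (weighted_branch bs ++ weigh j (tr bs) y) (n j)
    (fun s => wsum (weigh j (tr bs) y) (fun z => (answer (n j) s z.1 != z.2)%:R)).

Let q_ge0 j : 0 <= q j.
Proof. by have := b_half j; have := b_gt0 j; lra. Qed.

Let weigh_ge0 j xs y : all (fun u => 0 <= u.1) (weigh j xs y).
Proof. by rewrite all_map; apply/allP => z _; rewrite /= divr_ge0. Qed.

Let weighted_branch_ge0 bs : all (fun u => 0 <= u.1) (weighted_branch bs).
Proof.
apply/allP => u /flattenP[w /mapP[i _ ->]]; exact: (allP (weigh_ge0 _ _ _)).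
Qed.

Lemma weighted_branch_rcons bs y :
  weighted_branch (rcons bs y) = weighted_branch bs ++ weigh (size bs) (tr bs) y.
Proof.
rewrite /weighted_branch size_rcons -addn1 iotaD map_cat flatten_cat/= add0n cats0.
rewrite nth_rcons ltnn eqxx -cats1 take_size_cat//; congr (_ ++ _).
congr flatten; apply/eq_in_map => i; rewrite mem_iota add0n => /andP[_ ib].
by rewrite nth_cat ib takel_cat// ltnW.
Qed.

Let labels_rcons bs y : labels l (rcons bs y) -> labels l bs /\ size y = l (size bs).
Proof.
move=> h; split=> [i ib|].
  by have := h i; rewrite size_rcons nth_rcons ib; apply; exact: ltnW.
by have := h (size bs); rewrite size_rcons nth_rcons ltnn eqxx; apply.
Qed.

Lemma weight_weigh j xs y : size xs = l j -> size y = l j -> weight (weigh j xs y) = q j.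
Proof.
move=> sx sy; rewrite /weight /wsum big_map /= big_const_seq count_predT size_zip sx sy minnn.
by rewrite iter_addr_0 mulr1 -[LHS]mulr_natr mulfVK// pnatr_eq0 -lt0n.
Qed.

Lemma weight_weighted_branch bs : labels l bs -> weight (weighted_branch bs) = 1 - b (size bs).
Proof.
elim/last_ind: bs => [|bs y IH] h.
  by rewrite /weight /wsum big_nil b0 subrr.
have [lb sy] := labels_rcons h.
rewrite weighted_branch_rcons /weight wsum_cat -!/(weight _) IH// weight_weigh//; last by case: (htr lb).
by rewrite size_rcons; ring.
Qed.

Lemma good_exists bs : labels l bs -> exists y, good bs y.
Proof.
move=> lb; have [st _] := htr lb; set j := size bs in st.
pose xs (i : 'I_(l j)) : X := nth point (tr bs) i.
have p0 : 0 <= q j / (l j)%:R by rewrite divr_ge0.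
have lne : (l j)%:R != 0 :> R by rewrite pnatr_eq0 -lt0n.
have lge1 : 1 <= (l j)%:R :> R by rewrite ler1n.
have ql : q j / (l j)%:R * (l j)%:R = q j by rewrite mulfVK.
have W : 1 - (weight (weighted_branch bs) + q j / (l j)%:R * (l j)%:R - q j / (l j)%:R) =
    b j.+1 + q j / (l j)%:R.
  by rewrite weight_weighted_branch// ql -/j; ring.
have light : 0 <= b j.+1 + q j / (l j)%:R <= 1.
  rewrite addr_ge0 ?(ltW (b_gt0 _))//=.
  have bj : b j <= 1.
    by elim: (j) => [|i]; [rewrite b0|have := b_half i; have := b_gt0 i; lra].
  apply: le_trans bj; rewrite -lerBrDl.
  by rewrite ler_pdivrMr ?ltr0n// ler_peMr.
have [||y hy] := @adversary R X (l j) (n j) (weighted_branch bs) xs (q j / (l j)%:R) (answer (n j)) p0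
  (weighted_branch_ge0 bs).
- by rewrite W sparse.
- by rewrite W.
pose ys := [seq y i | i <- enum 'I_(l j)].
have xsE : tr bs = [seq xs i | i <- enum 'I_(l j)].
  rewrite /xs (map_comp (nth point (tr bs)) val) val_enum_ord -st.
  by rewrite -/(mkseq _ _) mkseq_nth.
have wlE : weigh j (tr bs) ys = [seq (q j / (l j)%:R, (xs i, y i)) | i <- enum 'I_(l j)].
  by rewrite /weigh xsE zip_map -map_comp.
exists ys; split; first by rewrite size_map size_enum_ord.
rewrite -/j wlE; have -> : q j / 4 = (l j)%:R * (q j / (l j)%:R) / 4.
  by rewrite mulrCA mulfV// mulr1.
apply: le_trans hy _; rewrite le_eqVlt; apply/orP; left; apply/eqP.
by apply: eq_witer => s; rewrite /wsum big_map big_enum.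
Qed.

(** The labels of level [j] are fixed against samples of size [n j] before any deeper level exists.
    The bound obtained uses only the mass down to level [j], so it survives all later choices. *)
Fixpoint hard_path j : seq (seq bool) :=
  if j is j'.+1 then rcons (hard_path j') (xget (nseq (l j') false) (good (hard_path j'))) else [::].

Lemma size_path j : size (hard_path j) = j.
Proof. by elim: j => //= j IH; rewrite size_rcons IH. Qed.

Lemma labels_path j : labels l (hard_path j).
Proof.
elim: j => [//|j IH] i /=; rewrite size_rcons ltnS leq_eqVlt nth_rcons => /orP[/eqP ->|ij].
  rewrite ltnn eqxx; case: xgetP => [y _ [-> _]//|_].
  by rewrite size_nseq size_path.
by rewrite ij; exact: IH.
Qed.

Definition level j := weigh j (tr (hard_path j)) (xget (nseq (l j) false) (good (hard_path j))).

Lemma weighted_branch_path J : weighted_branch (hard_path J) = flatten [seq level j | j <- iota 0 J].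
Proof.
elim: J => [//|J IH]; rewrite [hard_path _]/= weighted_branch_rcons IH size_path.
by rewrite -addn1 iotaD map_cat flatten_cat/= cats0 add0n.
Qed.

Lemma b_cvg0 : b @ \oo --> 0.
Proof.
have bj j : b j <= 2^-1 ^+ j.
  elim: j => [|j IH]; first by rewrite b0 expr0.
  by rewrite exprS; have := b_half j; lra.
apply: (@squeeze_cvgr _ _ _ _ (fun=> 0) (fun j => 2^-1 ^+ j)).
- by near=> j; rewrite ltW//= bj.
- exact: cvg_cst.
- by apply: cvg_expr; rewrite ger0_norm// invf_lt1// ltr1n.
Unshelve. all: by end_near.
Qed.

Lemma exists_measure : exists P : probability Z R, forall J, dominated P (weighted_branch (hard_path J)).
Proof.
have iotaE J : iota 0 J = index_iota 0 J by rewrite /index_iota subn0.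
have WE J : weight (weighted_branch (hard_path J)) = \sum_(j < J) \sum_(u <- level j) u.1.
  rewrite weighted_branch_path /weight /wsum big_flatten/= big_map (iotaE J) big_mkord.
  by apply: eq_bigr => j _; apply: eq_bigr => u _; rewrite mulr1.
have [|P HP] := @discrete_probability R _ Z (fun z => measurable_point z pX) level (fun j u uj => allP (weigh_ge0 _ _ _) u uj).
  rewrite (_ : (fun _ => _) = (fun J => 1 - b J)).
    by rewrite -[X in _ --> X]subr0; apply: cvgB; [exact: cvg_cst|exact: b_cvg0].
  by apply/funext => J; rewrite -WE weight_weighted_branch ?size_path//; exact: labels_path.
exists P => J g g0; apply: le_trans (HP J (fun z => (g z)%:E) _); last first.
  by move=> z; rewrite lee_fin.
rewrite weighted_branch_path /wsum big_flatten/= big_map (iotaE J) big_mkord.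
by rewrite -sumEFin lee_sum// => j _; rewrite -sumEFin lee_sum.
Qed.

Lemma weighted_branch_sub bs u : u \in weighted_branch bs -> u.2 \in branch tr bs.
Proof.
move=> /flattenP[w /mapP[i ii ->]] /mapP[z zz ->] /=.
by apply/flattenP; eexists; [apply: map_f; exact: ii|].
Qed.

(* Level [j] carries mass [q j], and [sparse] makes a sample of size [n j] avoid a given point of level [j] and all deeper levels with probability at least 1/2. *)
Theorem slow_learning : exists P : probability Z R, realizable H P /\
  forall j, ((q j / 4)%:E <= exp_error A P (n j))%E.
Proof.
have [P dP] := exists_measure; exists P; split.
  apply/eqP; rewrite eq_le; apply/andP; split; last first.
    by apply: le_ereal_inf_tmp => _ [h _ <-]; exact: er_ge0.
  apply/lee_addgt0Pr => e e0; rewrite add0e.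
  (* No single concept need realize the whole branch; one that realizes its first [J] levels errs at
     most on the remaining mass [b J]. *)
  have [J _ /(_ J (leqnn _))] := (cvgrPdist_le _ _).1 b_cvg0 _ e0.
  rewrite sub0r normrN => /(le_trans (ler_norm _)) bJ.
  have [_ [h Hh hc]] := htr (@labels_path J).
  apply: (@le_trans _ _ (er P h)); first by apply: ereal_inf_lbound; exists h.
  apply: le_trans (er_le pX (h := h) (dP J) _) _; last first.
    by rewrite weight_weighted_branch ?size_path ?subKr ?lee_fin//; exact: labels_path.
  by move=> u /weighted_branch_sub ub; apply/eqP; exact: (allP hc).
move=> j; have gj : good (hard_path j) (xget (nseq (l j) false) (good (hard_path j))).
  have [y gy] := good_exists (@labels_path j).
  by case: xgetP => [//|/(_ y)].
case: gj => sz; rewrite !size_path -/(level j) => hj.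
apply: (@le_trans _ _ (witer (weighted_branch (hard_path j) ++ level j) (n j)
    (fun s => wsum (level j) (fun z => (answer (n j) s z.1 != z.2)%:R)))%:E).
  by rewrite lee_fin.
have wE : weighted_branch (hard_path j) ++ level j = weighted_branch (hard_path j.+1).
  by rewrite /= weighted_branch_rcons size_path.
rewrite wE; apply: (iexp_ge (P := P)) => // [s|t].
  by apply: wsum_ge0 => //; exact: weigh_ge0.
rewrite (_ : er P _ = er P (answer (n j) t)); last first.
  by congr er; apply/funext => x; rewrite answerE.
apply: er_ge; first exact: weigh_ge0.
move=> g g0; apply: le_trans (dP j.+1 g g0); rewrite -wE wsum_cat lee_fin lerDr.
exact: wsum_ge0.
Qed.

End slow_learning.

(** Otherwise any two distinct concepts are complementary, and two of the three coincide. *)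
Lemma separating_pair (X : Type) (H : set (X -> bool)) :
  (exists h1 h2 h3, [/\ H h1, H h2, H h3 & [/\ h1 <> h2, h1 <> h3 & h2 <> h3]]) ->
  exists h h' x x', [/\ H h, H h', h x = h' x & h x' <> h' x'].
Proof.
move=> [h1 [h2 [h3 [H1 H2 H3 [n12 n13 n23]]]]]; apply: contrapT => none.
have opp h h' : H h -> H h' -> h <> h' -> h' = (fun x => ~~ h x).
  move=> Hh Hh' /eqP/negP ne; apply/funext => x.
  have [x' hx'] : exists x', h x' <> h' x'.
    by apply: contrapT => /forallNP all; apply: ne; apply/eqP/funext => y; exact: contrapT (all y).
  have [//|ne'] := eqVneq (h' x) (~~ h x); case: none; exists h, h', x, x'; split=> //.
  by move: ne'; case: (h x); case: (h' x).
by apply: n23; rewrite (opp _ _ H1 H2 n12) (opp _ _ H1 H3 n13).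
Qed.

Lemma witer_point (R : realType) (Z : Type) (w : R) (a : Z) n (f : seq Z -> R) :
  witer [:: (w, a)] n f = w ^+ n * f (nseq n a).
Proof.
elim: n f => [|n IH] f /=; first by rewrite expr0 mul1r.
by rewrite /wsum big_seq1 /= IH exprS mulrA.
Qed.

(** * Lower bounds for the three rates *)

Section lower_bounds.
Context (R : realType) (X : ptopologicalType) (H : set (X -> bool)).
Hypothesis pX : polish R X.
Local Notation Z := (borel X * bool)%type.

(** With mass 1/2 on a labeled example at each of [x] and [x'], the sample shows only [x] with
    probability [2^-n], at least [e^-n], and then says nothing about the label of [x']. *)
Theorem not_faster_exp :
  (exists h1 h2 h3, [/\ H h1, H h2, H h3 & [/\ h1 <> h2, h1 <> h3 & h2 <> h3]]) ->
  not_learnable_faster H (@exp_rate R).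
Proof.
move=> /separating_pair[h [h' [x [x' [Hh Hh' hx hx']]]]] A _.
pose a : Z := (x, h x); pose w : R := 2^-1.
have w0 : 0 <= w by rewrite invr_ge0.
pose L (y : bool) : seq (R * Z) := [:: (w, a); (w, (x', y))].
have L0 y : all (fun u => 0 <= u.1) (L y) by rewrite /= w0.
have L1 y : weight (L y) = 1.
  by rewrite /weight /wsum !big_cons big_nil /= /w; lra.
have [P HP] : exists P : bool -> probability Z R, forall y, dominated (P y) (L y).
  have ex y : exists P : probability Z R, dominated P (L y).
    pose lv j := if j is 0%N then L y else [::].
    have lv0 j u : u \in lv j -> 0 <= u.1 by case: j => //; exact: (allP (L0 y)).
    have lvS (g : Z -> \bar R) J :
        (\sum_(j < J.+1) \sum_(u <- lv j) u.1%:E * g u.2 = \sum_(u <- L y) u.1%:E * g u.2)%E.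
      by rewrite big_ord_recl [X in (_ + X)%E]big1 ?adde0// => i _; rewrite big_nil.
    have [|P HP] := @discrete_probability R _ Z (fun z => measurable_point z pX) lv lv0.
      apply: (cvg_near_cst); exists 1%N => // -[//|J] _.
      rewrite big_ord_recl [X in _ + X]big1 ?addr0 => [|i _]; last by rewrite big_nil.
      by rewrite -[RHS](L1 y); apply: eq_bigr => u _; rewrite mulr1.
    exists P => g g0; have := HP 1%N (fun z => (g z)%:E) (fun z => g0 z).
    rewrite (lvS (fun z => (g z)%:E) 0%N) /wsum -sumEFin; apply: le_trans.
    by rewrite le_eqVlt; apply/orP; left; apply/eqP; apply: eq_bigr.
  by exists (fun y => sval (cid (ex y))) => y; case: cid.
have rP y : realizable H (P y).
  apply/eqP; rewrite eq_le; apply/andP; split; last first.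
    by apply: le_ereal_inf_tmp => _ [g _ <-]; exact: er_ge0.
  have [g Hg [gx gx']] : exists2 g, H g & g x = h x /\ g x' = y.
    have [<-|ne] := eqVneq (h x') y; first by exists h.
    exists h' => //; split=> //.
    by move: hx' ne; case: (h x'); case: (h' x'); case: y.
  apply: (@le_trans _ _ (er (P y) g)); first by apply: ereal_inf_lbound; exists g.
  have := @er_le R X (P y) (L y) g pX (HP y); rewrite L1 subrr; apply.
  by move=> u; rewrite !inE => /orP[/eqP ->|/eqP ->].
(* The label missed at [x'] may change with [n]; below, a value that recurs infinitely often
   determines the distribution. *)
pose y n := ~~ answer A n (nseq n a) x'.
have lower n : ((4^-1 * exp_rate R n)%:E <= exp_error A (P (y n)) n)%E.
  pose err s : R := wsum [:: (w, (x', y n))] (fun z => (answer A n s z.1 != z.2)%:R).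
  have err0 s : 0 <= err s by rewrite /err /wsum big_seq1 mulr_ge0.
  have d1 : dominated (P (y n)) [:: (w, a)].
    move=> g g0; apply: le_trans (HP (y n) g g0); rewrite lee_fin /wsum big_seq1 !big_cons big_nil.
    by rewrite lerDl addr0 mulr_ge0.
  have d2 : dominated (P (y n)) [:: (w, (x', y n))].
    move=> g g0; apply: le_trans (HP (y n) g g0); rewrite lee_fin /wsum big_seq1 !big_cons big_nil.
    by rewrite addr0 lerDr mulr_ge0.
  apply: (@le_trans _ _ (witer [:: (w, a)] n err)%:E).
    rewrite witer_point lee_fin /err /wsum big_seq1 /= /y.
    have -> : (answer A n (nseq n a) x' != ~~ answer A n (nseq n a) x') = true.
      by case: (answer _ _ _ _).
    rewrite mulr1 (_ : 4^-1 = w / 2); last by rewrite /w; lra.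
    have wn : exp_rate R n <= w ^+ n.
      rewrite /exp_rate expRN /w exprVn lef_pV2 ?posrE ?expR_gt0 ?exprn_gt0//.
      rewrite -[n%:R]mulr1 expRM_natl; apply: lerXn2r; rewrite ?nnegrE ?expR_ge0//.
      by apply: le_trans (expR_ge1Dx _); lra.
    have wn0 : 0 <= w ^+ n by rewrite exprn_ge0.
    apply: (@le_trans _ _ (w / 2 * w ^+ n)); first by apply: ler_wpM2l => //; rewrite divr_ge0.
    by rewrite mulrC; apply: ler_wpM2l => //; rewrite /w; lra.
  apply: (iexp_ge (P := P (y n))) => //=; first by rewrite w0.
  move=> t; rewrite (_ : er _ _ = er (P (y n)) (answer A n t)); last first.
    by congr er; apply/funext => z; rewrite answerE.
  by apply: er_ge => //=; rewrite w0.
have [y0 hy0] : exists y0, forall N, exists n, (N < n)%N /\ y n = y0.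
  apply: contrapT => /forallNP none.
  have /existsNP[N1 h1] := none true; have /existsNP[N2 h2] := none false.
  pose m := (maxn N1 N2).+1; case E0 : (y m).
    by apply: h1; exists m; split=> //; rewrite ltnS leq_maxl.
  by apply: h2; exists m; split=> //; rewrite ltnS leq_maxr.
exists (P y0); split; first exact: rP.
exists 4^-1, 1; split; first by rewrite invr_gt0.
split=> // N; have [n [Nn yn]] := hy0 N; exists n; split=> //.
by rewrite rate_at1 -yn.
Qed.

Theorem not_faster_inv : inf_tree H (fun=> 1%N) -> not_learnable_faster H (@inv_rate R).
Proof.
move=> [tr htr] A _.
(* For [j > 0], [n j * b j = 1/2] is the most that [sparse] admits when [l] is 1: the single point
   of level [j] and everything deeper have mass [b j] together. *)
pose b j : R := 2^-1 ^+ j; pose n j := (2 ^ j)./2.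
have bS j : b j.+1 = b j / 2 by rewrite /b exprS mulrC.
have b0 j : 0 < b j by rewrite exprn_gt0// invr_gt0.
have nb j : (0 < j)%N -> (n j)%:R * b j = 2^-1.
  case: j => // j _; rewrite /n expnS mul2n doubleK natrX bS mulrA /b -exprMn.
  by rewrite mulfV// expr1n mul1r.
have [|||j|P [rP hP]] := @slow_learning R X H pX (fun=> 1%N) tr _ htr b n _ b0 _ _ A => //.
- by move=> j; rewrite bS.
- rewrite divr1 addrC subrK; case: j => [|j]; first by rewrite mul0r mul0r.
  by rewrite nb// mulVf.
(* Level [j] has mass [b j / 2 = 1 / (4 * n j)], a quarter of which is the guaranteed error. *)
exists P; split=> //; exists 16^-1, 1; split; first by rewrite invr_gt0.
split=> // N; exists (n N.+2); split.
  rewrite /n expnS mul2n doubleK; by apply: ltnW; exact: ltn_expl.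
rewrite rate_at1; apply: le_trans (hP N.+2); rewrite lee_fin (bS N.+2) /inv_rate.
have n0 : (n N.+2)%:R != 0 :> R.
  by apply/eqP => e; have := nb N.+2 isT; rewrite e mul0r => /eqP; rewrite eq_sym invr_eq0 pnatr_eq0.
have -> : b N.+2 = 2^-1 * (n N.+2)%:R^-1 by rewrite -(nb N.+2)// mulrAC mulfV// mul1r.
by move: ((n N.+2)%:R^-1) => u; lra.
Qed.

(* [b] is chosen so that the mass below level [j] is invisible to [n j] examples, where [n j] is large enough for the prescribed rate to drop to [b j]. *)
Theorem slow_rates : inf_tree H S -> arbitrarily_slow R H.
Proof.
move=> tS r [r01 r0] A _.
have ex (c : R) m : exists N, (m < N)%N /\ (0 < c -> r N <= c).
  have [c0|] := ltP 0 c; last by exists m.+1.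
  have [J _ hJ] := (cvgrPdist_le _ _).1 r0 _ c0.
  exists (maxn J m.+1); split; first by rewrite leq_max leqnn orbT.
  move=> _; have := hJ (maxn J m.+1) (leq_maxl _ _).
  by rewrite sub0r normrN; apply: le_trans; exact: ler_norm.
pose pick c m := sval (cid (ex c m)).
have pickP c m : (m < pick c m)%N /\ (0 < c -> r (pick c m) <= c) by rewrite /pick; case: cid.
(* The cap [1 / (4 * n j)] hides all deeper levels from [n j] examples, however large [n j] had to
   be. *)
pose fix b j : R := if j is j'.+1 then Num.min (b j' / 2) (4 * (pick (b j') j')%:R)^-1 else 1.
pose n j := pick (b j) j.
have n0 j : (0 < n j)%N by apply: leq_ltn_trans (pickP (b j) j).1.
have bS j : b j.+1 = Num.min (b j / 2) (4 * (n j)%:R)^-1 by [].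
have b0 j : 0 < b j.
  elim: j => //= j IH; rewrite lt_min divr_gt0//= invr_gt0 mulr_gt0// ltr0n; exact: n0.
have bh j : b j.+1 <= b j / 2 by rewrite bS ge_min lexx.
have b1 j : b j <= 1.
  by elim: j => [|j IH]; [exact: lexx|have := bh j; have := b0 j; lra].
(* With this many points on level [j] each has mass at most [1 / (4 * n j)], which together with the
   cap on [b j.+1] gives [sparse]; [tau j] is a depth at which the tree offers as many points. *)
pose l j := (4 * n j)%N.
pose tau := fix tau j := if j is j'.+1 then (tau j' + l j'.+1).+1 else l 0%N.
have tauS j : (tau j < tau j.+1)%N by rewrite /= ltnS leq_addr.
have tau_mono i j : (i < j)%N -> (tau i < tau j)%N.
  by elim: j => // j IH; rewrite ltnS leq_eqVlt => /orP[/eqP ->//|/IH h]; exact: ltn_trans (tauS j).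
have ltau j : (l j <= (tau j).+1)%N.
  by case: j => [|j] /=; [exact: leqnSn|rewrite -addnS; lia].
have [tr htr] := inf_tree_sub tau_mono ltau tS.
have l0 j : (0 < l j)%N by rewrite /l muln_gt0 n0.
have nn j : 0 < (n j)%:R :> R by rewrite ltr0n.
have sparse j : (n j)%:R * (b j.+1 + (b j - b j.+1) / (l j)%:R) * 2 <= 1.
  have h1 : (n j)%:R * b j.+1 <= 4^-1.
    rewrite bS; apply: (@le_trans _ _ ((n j)%:R * (4 * (n j)%:R)^-1)).
      by rewrite ler_pM2l// ge_min lexx orbT.
    by rewrite invfM mulrCA mulfV ?mulr1// gt_eqF.
  have h2 : (n j)%:R * ((b j - b j.+1) / (l j)%:R) <= 4^-1.
    rewrite /l natrM invfM.
    have -> : (n j)%:R * ((b j - b j.+1) * (4^-1 * (n j)%:R^-1)) = (b j - b j.+1) / 4.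
      by field; rewrite gt_eqF.
    by have := b1 j; have := b0 j.+1; lra.
  by rewrite mulrDr; lra.
have [P [rP hP]] := slow_learning pX l0 htr (erefl : b 0 = 1) b0 bh sparse A.
exists P; split=> //; exists 8^-1, 1; split; first by rewrite invr_gt0.
split=> // N; exists (n N); split; first by have [] := pickP (b N) N.
rewrite rate_at1; apply: le_trans (hP N); rewrite lee_fin.
have [_ /(_ (b0 N)) hr] := pickP (b N) N.
have := bh N; rewrite -/(n N) in hr.
by move: hr; move: (r _) (b N) (b N.+1) => u v w'; lra.
Qed.

End lower_bounds.

(** * Comparison of the rates *)

Section rate_comparison.
Context {R : realType}.

(** A rate function slower than [1/n], at which arbitrarily slow rates contradict learnability at
    rate [1/n]. *)
Definition root_rate (n : nat) : R := (Num.sqrt n.+1%:R)^-1.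

Lemma rate_function_inv : rate_function (@inv_rate R).
Proof.
split=> [[|n]|].
- by rewrite /inv_rate invr0 lexx ler01.
- by rewrite /inv_rate invr_ge0 ler0n/= invf_le1 ?ltr0n// ler1n.
apply/cvgrPdist_le => e e0; exists (Num.truncn e^-1).+1 => // n /= hn.
rewrite sub0r normrN ger0_norm ?invr_ge0// invf_ple ?posrE// ?ltr0n; last exact: leq_trans hn.
by apply: le_trans (ltW (truncnS_gt _)) _; rewrite ler_nat.
Qed.

Lemma rate_function_root : rate_function root_rate.
Proof.
have s0 n : 0 < Num.sqrt n.+1%:R :> R by rewrite sqrtr_gt0 ltr0n.
split=> [n|].
  rewrite /root_rate invr_ge0 sqrtr_ge0/= invf_le1//.
  by rewrite -[leLHS]sqrtr1 ler_wsqrtr// ler1n.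
apply/cvgrPdist_le => e e0; exists (Num.truncn (e^-1 ^+ 2)) => // n /= hn.
rewrite sub0r normrN ger0_norm ?invr_ge0 ?sqrtr_ge0// invf_ple ?posrE//.
rewrite -[leLHS]ger0_norm ?invr_ge0 ?(ltW e0)// -sqrtr_sqr ler_wsqrtr//.
by apply: le_trans (ltW (truncnS_gt _)) _; rewrite ler_nat.
Qed.

Lemma unbounded (B : R) : exists N : nat, forall n, (N < n)%N -> B < n%:R.
Proof.
exists (Num.truncn B) => n hn; apply: lt_le_trans (truncnS_gt _) _.
by rewrite ler_nat.
Qed.

Context (X : ptopologicalType) (H : set (X -> bool)).

Lemma exp_excludes_inv : learnable_at_rate H (@exp_rate R) ->
  ~ not_learnable_faster H (@inv_rate R).
Proof.
move=> [A [lA up]] /(_ A lA)[P [rP [C [c [C0 [c0 low]]]]]].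
have [C' [c' [C0' [c0' {}up]]]] := up P rP.
have [N hN] := unbounded (4 * C' * (c + 1) / (C * c' ^+ 2)).
have [n [Nn ln]] := low N; have n0 : (0 < n)%N by apply: leq_ltn_trans Nn.
have nR : 0 < n%:R :> R by rewrite ltr0n.
have n1 : 1 <= n%:R :> R by rewrite ler1n.
have := le_trans ln (up n n0); rewrite lee_fin /rate_at /inv_rate /exp_rate.
have /nceil_itv/andP[] : 0 <= c * n%:R by rewrite mulr_ge0// ltW.
have /nceil_itv/andP[] : 0 <= c' * n%:R by rewrite mulr_ge0// ltW.
set m := (`|_|%N)%:R; set m' := (`|_|%N)%:R => m1 _ m1' m2 h.
have cn0 : 0 < c * n%:R by rewrite mulr_gt0.
have cn0' : 0 < c' * n%:R by rewrite mulr_gt0.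
have m'0 : 0 < m' by lra.
have m0 : 0 < m by lra.
(* A quadratic minorant of the exponential suffices, since the inverse of the other rate grows only
   linearly. *)
have e2 : (m / 2) ^+ 2 <= expR m.
  have -> : expR m = expR (m / 2) ^+ 2 by rewrite -expRM_natl; congr expR; lra.
  apply: lerXn2r; rewrite ?nnegrE ?expR_ge0 ?divr_ge0 ?(ltW m0)//.
  by apply: le_trans (expR_ge1Dx _); lra.
have h1 : C * (m / 2) ^+ 2 <= C' * m'.
  apply: (@le_trans _ _ (C * expR m)); first by rewrite ler_pM2l.
  move: h; rewrite expRN ler_pdivlMr ?expR_gt0// mulrAC ler_pdivrMr//.
have h2 : C * ((c' * n%:R) / 2) ^+ 2 <= C' * ((c + 1) * n%:R).
  apply: (@le_trans _ _ (C * (m / 2) ^+ 2)).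
    rewrite ler_pM2l//; apply: lerXn2r; rewrite ?nnegrE ?divr_ge0 ?(ltW m0) ?(ltW cn0')//.
    by rewrite ler_pM2r ?invr_gt0.
  by apply: le_trans h1 _; rewrite ler_pM2l// mulrDl; lra.
have := hN n Nn; rewrite ltr_pdivrMr ?mulr_gt0 ?exprn_gt0// ltNge => /negP; apply.
rewrite -(ler_pM2r nR).
rewrite (_ : n%:R * (C * c' ^+ 2) * n%:R = 4 * (C * (c' * n%:R / 2) ^+ 2)); last by field.
rewrite (_ : 4 * C' * (c + 1) * n%:R = 4 * (C' * ((c + 1) * n%:R))); last by ring.
by rewrite ler_pM2l.
Qed.

Lemma inv_excludes_root : learnable_at_rate H (@inv_rate R) ->
  ~ not_learnable_faster H root_rate.
Proof.
move=> [A [lA up]] /(_ A lA)[P [rP [C [c [C0 [c0 low]]]]]].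
have [C' [c' [C0' [c0' {}up]]]] := up P rP.
have [N hN] := unbounded (C' ^+ 2 * (c + 2) / (C * c') ^+ 2).
have [n [Nn ln]] := low N; have n0 : (0 < n)%N by apply: leq_ltn_trans Nn.
have nR : 0 < n%:R :> R by rewrite ltr0n.
have n1 : 1 <= n%:R :> R by rewrite ler1n.
have := le_trans ln (up n n0); rewrite lee_fin /rate_at /inv_rate /root_rate.
have /nceil_itv/andP[] : 0 <= c' * n%:R by rewrite mulr_ge0// ltW.
have /nceil_itv/andP[] : 0 <= c * n%:R by rewrite mulr_ge0// ltW.
move: (`|Num.ceil (c * _)|%N) (`|Num.ceil (c' * _)|%N) => m m' _ m1 m2 _.
have cn0 : 0 < c * n%:R by rewrite mulr_gt0.
have cn0' : 0 < c' * n%:R by rewrite mulr_gt0.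
have m'0 : 0 < m'%:R :> R by lra.
have s0 : 0 < Num.sqrt m.+1%:R :> R by rewrite sqrtr_gt0 ltr0n.
have sq : Num.sqrt m.+1%:R ^+ 2 = m.+1%:R :> R by rewrite sqr_sqrtr.
move: (Num.sqrt _) s0 sq => s s0 sq.
rewrite ler_pdivrMr// mulrAC ler_pdivlMr// => h.
have h1 : C * c' * n%:R <= C' * s.
  by apply: le_trans h; rewrite -mulrA ler_pM2l.
have h2 : (C * c' * n%:R) ^+ 2 <= C' ^+ 2 * ((c + 2) * n%:R).
  apply: (@le_trans _ _ ((C' * s) ^+ 2)).
    by apply: lerXn2r; rewrite ?nnegrE// ltW// !mulr_gt0.
  rewrite exprMn sq ler_pM2l ?exprn_gt0// -natr1 mulrDl; lra.
have := hN n Nn; rewrite ltr_pdivrMr ?exprn_gt0 ?mulr_gt0// ltNge => /negP; apply.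
rewrite -(ler_pM2r nR).
rewrite (_ : n%:R * (C * c') ^+ 2 * n%:R = (C * c' * n%:R) ^+ 2); last by ring.
by rewrite -[leRHS]mulrA.
Qed.

End rate_comparison.

Theorem mainTheorem1 (R : realType) (X : ptopologicalType)
  (H : set (X -> bool)) :
  polish R X ->
  measurable_concept_class R H ->
  (exists h1 h2 h3, [/\ H h1, H h2, H h3 & [/\ h1 <> h2, h1 <> h3 & h2 <> h3]]) ->
  let i := optimal_rate H (@exp_rate R) in
  let ii := optimal_rate H (@inv_rate R) in
  let iii := arbitrarily_slow R H in
  (i /\ ~ ii /\ ~ iii) \/ (~ i /\ ii /\ ~ iii) \/ (~ i /\ ~ ii /\ iii).
Proof.
move=> pX mH H3 i ii iii.
have [t1|t1] := pselect (inf_tree H (fun=> 1%N)); last first.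
  have le := learnable_exp pX mH t1; left; split.
    by split=> //; exact: not_faster_exp.
  split=> [[_]|s]; first exact: exp_excludes_inv.
  exact: exp_excludes_inv le (s _ rate_function_inv).
right; have [tS|tS] := pselect (inf_tree H S).
  have s : iii by exact: slow_rates.
  right; split=> [[le _]|]; first exact: exp_excludes_inv le (s _ rate_function_inv).
  by split=> // -[li _]; exact: inv_excludes_root li (s _ rate_function_root).
have li := learnable_inv pX mH tS; have nf : not_learnable_faster H (@inv_rate R).
  exact: not_faster_inv.
left; split=> [[le _]|]; first exact: exp_excludes_inv le nf.
by split=> // s; exact: inv_excludes_root li (s _ rate_function_root).
Qed.
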